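(* Let $p>1$, and let $\alpha,\gamma$ be real numbers satisfying one of the following: (i) $1<\alpha<2$ and $-1<\gamma<\alpha p-\alpha/2-p$; (ii) $1/2<\alpha\le 1$ and $-1<\gamma<-1/2$; (iii) $0<\alpha\le 1/2$ and $-1<\gamma<\alpha-1$. Then for all $A>0$ and $d\ge 0$ there is a constant $C<\infty$, depending only on $p,\alpha,\gamma,A,d$, such that for every nonnegative compactly supported Borel measure $\mu$ on $\mathbb{R}^2$ whose support has diameter $d$ and which satisfies $$\mu\big(B(y,r)\big)\le A\,r^{\alpha}\qquad\text{for all } y\in\mathbb{R}^2\text{ and } r>0,$$ one has $$\int_0^\infty |\widehat{\mu}(t,t^p)|^2\,t^{\gamma}\,dt\le C.$$
   Context: $B(y,r)$ denotes the ball in $\mathbb{R}^2$ with center $y$ and radius $r$. The Fourier transform of a finite Borel measure $\mu$ on $\mathbb{R}^2$ is $\widehat{\mu}(\xi)=\int e^{-2\pi i \xi\cdot x}\,d\mu(x)$. *)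

(* Defs.v *)
From HB Require Import structures.
From mathcomp Require Import all_boot all_order all_algebra.
From mathcomp Require Import all_classical all_reals all_analysis.
From mathcomp Require Import complex.

Set Implicit Arguments.
Unset Strict Implicit.
Unset Printing Implicit Defensive.

Import Order.TTheory GRing.Theory Num.Theory.
Import numFieldNormedType.Exports.

Local Open Scope classical_set_scope.
Local Open Scope ring_scope.

(* The measurable structure on the product is the product sigma-algebra, which
   is the Borel sigma-algebra of the plane. *)
Notation plane R := (R * R)%type.

Definition dot (R : realType) (x y : plane R) : R := x.1 * y.1 + x.2 * y.2.

(* The library norm on a product is the max norm, so [ball] is not used. *)
Definition edist (R : realType) (x y : plane R) : R :=
  Num.sqrt ((x.1 - y.1) ^+ 2 + (x.2 - y.2) ^+ 2).

Definition eball (R : realType) (y : plane R) (r : R) : set (plane R) :=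
  [set x | edist y x < r].

(* [sup] is 0 on the empty set and on unbounded sets: [ediam] is the Euclidean
   diameter for bounded sets, with diameter 0 for the empty set. *)
Definition ediam (R : realType) (S : set (plane R)) : R :=
  sup [set edist z.1 z.2 | z in S `*` S].

Definition msupport (R : realType) (mu : {measure set (plane R) -> \bar R}) :
    set (plane R) :=
  [set x | forall r : R, 0 < r -> (0 < mu (eball x r))%E].

Definition cexpi (R : realType) (a : R) : R[i] := Complex (cos a) (sin a).

Definition cintegral (d : measure_display) (T : measurableType d)
    (R : realType) (mu : {measure set T -> \bar R}) (f : T -> R[i]) : R[i] :=
  Complex (Rintegral mu setT (fun x => complex.Re (f x)))
          (Rintegral mu setT (fun x => complex.Im (f x))).

Definition fourier (R : realType) (mu : {measure set (plane R) -> \bar R})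
    (xi : plane R) : R[i] :=
  cintegral mu (fun x => cexpi (- (2 * pi * dot xi x))).

(* Main.v *)
Require Import Defs.
From HB Require Import structures.
From mathcomp Require Import all_boot all_order all_algebra.
From mathcomp Require Import all_classical all_reals all_analysis.
From mathcomp Require Import measurable_realfun complex ring lra zify.

Set Implicit Arguments.
Unset Strict Implicit.
Unset Printing Implicit Defensive.

Import Order.TTheory GRing.Theory Num.Theory.
Import numFieldNormedType.Exports.

Local Open Scope classical_set_scope.
Local Open Scope ring_scope.

(** Write [P t = |mu^(t, t^p)|^2] and cut the half-line into dyadic blocks
    [t = N s], [2 <= s <= 4].  On a block the integral of [P] is a quadratic form
    in [mu] whose kernel at [z = x1 - y1], [w = N^(p-1) (x2 - y2)] is the
    oscillatory integral of [cos (2 pi N (z s + w s^p))] over the fixed curve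
    [(s, s^p)], whose curvature is bounded below.  The measure is discretized, so
    that these forms become finite sums.

    For [1 < alpha < 2] the measure stretched by [N^(p-1)] in the second variable
    satisfies, at scales above [1/N], a Frostman bound with constant of size
    [N^((p-1)(1-alpha))].  The form restricted to an arc of length [rho] is
    estimated by induction on [rho], upwards from [N^(-1/2)], where Schur's test
    suffices.  Non-stationary phase localizes the points to strips normal to the
    arc; there the arc is divided into [K] shorter ones, interactions of
    neighbouring arcs are bounded by the induction hypothesis, and those of
    separated arcs by the Hilbert-Schmidt norm of the product of their kernels.
    Each step costs a fixed factor, hence a loss of only [N^epsilon] for [K]
    large, and the form on a block is at most [N^(epsilon - alpha/2)] times the
    squared norm of the test function, as in Wolff's circular decay theorem.

    For [alpha <= 1], van der Corput's lemma bounds the kernel by a multiple of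
    [(N |x - y|)^(-1/2)], and this is summed directly against the measure.
    In all cases the hypothesis on [gamma] is what makes the dyadic sum converge. *)

(** The exponents. Dividing the stretched measure by its Frostman constant [N^((p-1)(1-alpha))]
    costs that constant once, since the form is quadratic and the mass linear. So a block decays
    like [N^(-beta)] with [beta] just below [alpha/2 + (p-1)(alpha-1)]; as [dt = N ds], the blocks
    sum when [gamma + 1 < beta], which is case (i). In cases (ii) and (iii), [beta] is taken below
    [min(alpha, 1/2)], 1/2 being the decay of the kernel. Near [t = 0] the transform is merely
    bounded, and [gamma > -1] suffices.

    The obstacle to the induction is that the Hilbert-Schmidt bound grows with the total mass: for
    the whole measure it would lose [rho^((1-alpha)/2)]. A strip of width comparable to [rho] normal
    to the arc has mass [O(rho^(alpha-1))], and all powers of [rho] cancel. Hence the localization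
    at every scale, and an inductive statement about all measures with the spread condition, which
    passes to restrictions. The induction starts near [rho = M^(-1/2)] because there [rho^alpha]
    equals the bound to be proved. *)

Definition contI (R : realType) (a b : R) (f : R -> R) :=
  forall x, a <= x <= b -> {for x, continuous f}.

Definition intg (R : realType) (a b : R) (f : R -> R) : R :=
  (\int[lebesgue_measure]_(x in `[a, b]) f x)%R.

(** * Calculus of continuous functions on a segment *)

Section Continuity.
Variables (R : realType) (a b : R).
Implicit Types f g : R -> R.

Lemma contI_cst c : contI a b (fun=> c).
Proof. by move=> x _; exact: cvg_cst. Qed.

Lemma contID f g : contI a b f -> contI a b g -> contI a b (fun x => f x + g x).
Proof. by move=> hf hg x hx; apply: cvgD; [exact: hf|exact: hg]. Qed.

Lemma contIN f : contI a b f -> contI a b (fun x => - f x).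
Proof. by move=> hf x hx; apply: cvgN; exact: hf. Qed.

Lemma contIB f g : contI a b f -> contI a b g -> contI a b (fun x => f x - g x).
Proof. by move=> hf hg x hx; apply: cvgB; [exact: hf|exact: hg]. Qed.

Lemma contIM f g : contI a b f -> contI a b g -> contI a b (fun x => f x * g x).
Proof. by move=> hf hg x hx; apply: cvgM; [exact: hf|exact: hg]. Qed.

Lemma contIX f n : contI a b f -> contI a b (fun x => f x ^+ n).
Proof.
move=> hf; elim: n => [|n IH]; first exact: contI_cst.
by under eq_fun do rewrite exprS; apply: contIM.
Qed.

Lemma contI_comp f g : continuous g -> contI a b f -> contI a b (fun x => g (f x)).
Proof. by move=> hg hf x hx; apply: continuous_comp; [exact: hf|exact: hg]. Qed.

Lemma contI_sum (T : Type) (s : seq T) (F : T -> R -> R) :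
  (forall i, contI a b (F i)) -> contI a b (fun x => \sum_(i <- s) F i x).
Proof.
move=> hF; elim: s => [|i s IH].
  by under eq_fun do rewrite big_nil; exact: contI_cst.
by under eq_fun do rewrite big_cons; exact: contID.
Qed.

Lemma contI_sub c d f : a <= c -> d <= b -> contI a b f -> contI c d f.
Proof.
by move=> ac db hf x /andP[cx xd]; apply: hf; rewrite (le_trans ac)//= (le_trans xd).
Qed.

Lemma contI_within f : contI a b f -> {within `[a, b], continuous f}.
Proof.
move=> hf; apply: continuous_in_subspaceT => x; rewrite inE/= in_itv/=.
exact: hf.
Qed.

Lemma contI_integrable f : contI a b f ->
  lebesgue_measure.-integrable `[a, b] (EFin \o f).
Proof.
move=> hf; apply: continuous_compact_integrable; first exact: segment_compact.
exact: contI_within.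
Qed.

End Continuity.

Section Integral.
Variables (R : realType) (a b : R).
Implicit Types f g : R -> R.

Lemma intgD f g : contI a b f -> contI a b g ->
  intg a b (fun x => f x + g x) = intg a b f + intg a b g.
Proof. by move=> hf hg; apply: RintegralD => //; exact: contI_integrable. Qed.

Lemma intgZ f c : contI a b f -> intg a b (fun x => c * f x) = c * intg a b f.
Proof. by move=> hf; apply: RintegralZl => //; exact: contI_integrable. Qed.

Lemma eq_intg f g : (forall x, a <= x <= b -> f x = g x) -> intg a b f = intg a b g.
Proof.
by move=> fg; apply: eq_Rintegral => x; rewrite inE/= in_itv/= => /fg.
Qed.

Lemma le_intg f g : contI a b f -> contI a b g ->
  (forall x, a <= x <= b -> f x <= g x) -> intg a b f <= intg a b g.
Proof.
by move=> hf hg fg; apply: le_Rintegral => //; exact: contI_integrable.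
Qed.

Lemma intg_sum (T : Type) (s : seq T) (F : T -> R -> R) :
  (forall i, contI a b (F i)) ->
  intg a b (fun x => \sum_(i <- s) F i x) = \sum_(i <- s) intg a b (F i).
Proof.
move=> hF; elim: s => [|i s IH].
  rewrite big_nil -[RHS](mul0r (intg a b (cst 0))) -intgZ.
    by apply: eq_intg => x _; rewrite big_nil mul0r.
  exact: contI_cst.
rewrite big_cons -IH -intgD//; last exact: contI_sum.
by apply: eq_intg => x _; rewrite big_cons.
Qed.

Lemma intg_cst c : a <= b -> intg a b (fun=> c) = c * (b - a).
Proof.
move=> ab; rewrite /intg Rintegral_cst//= lebesgue_measure_itv/= lte_fin.
case: ltP => [//|ba].
by have -> : b = a by [apply/eqP; rewrite eq_le ab ba]; rewrite subrr.
Qed.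

Lemma intg_ge0 f : (forall x, a <= x <= b -> 0 <= f x) -> 0 <= intg a b f.
Proof. by move=> f0; apply: Rintegral_ge0 => x /=; rewrite in_itv/=; exact: f0. Qed.

Lemma intg_abs_le f C : a <= b -> contI a b f ->
  (forall x, a <= x <= b -> `|f x| <= C) -> `|intg a b f| <= C * (b - a).
Proof.
move=> ab hf fC; rewrite ler_norml -mulNr -!(intg_cst _ ab).
by apply/andP; split; apply: le_intg => //; try exact: contI_cst;
  move=> x /fC; rewrite ler_norml => /andP[].
Qed.

Lemma FTC f F : a <= b -> contI a b f ->
  (forall x, a <= x <= b -> is_derive x (1:R) F (f x)) ->
  intg a b f = F b - F a.
Proof.
rewrite le_eqVlt => /predU1P[<-|ab] hf hF.
  by rewrite subrr /intg set_itv1 Rintegral_set1.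
have cF x : a <= x <= b -> {for x, continuous F}.
  move=> /hF dF; apply: differentiable_continuous.
  by apply/derivable1_diffP; exact: ex_derive.
rewrite /intg /Rintegral (@continuous_FTC2 _ f F a b)//.
- exact: contI_within.
- split.
  + move=> x; rewrite in_itv/= => /andP[ax xb].
    have h : a <= x <= b by rewrite !ltW.
    by have := hF x h => dF; exact: ex_derive.
  + apply: cvg_at_right_filter; apply: cF; by rewrite lexx ltW.
  + apply: cvg_at_left_filter; apply: cF; by rewrite lexx ltW.
- move=> x; rewrite in_itv/= => /andP[ax xb]; rewrite derive1E.
  have h : a <= x <= b by rewrite !ltW.
  by have := hF x h => dF; exact: derive_val.
Qed.

Lemma intg_split f c : a <= c <= b -> contI a b f ->
  intg a b f = intg a c f + intg c b f.
Proof.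
move=> /andP[ac cb] hf.
have hi := contI_integrable hf.
have := @Rintegral_itvB R f (BLeft a) (BRight b) c hi.
rewrite !bnd_simp => /(_ ac cb) H.
rewrite /intg; apply/eqP; rewrite addrC -subr_eq; apply/eqP; rewrite H.
apply: Rintegral_itv_obnd_cbnd; apply: integrableS hi => //.
by apply: subset_itvr; rewrite bnd_simp.
Qed.

End Integral.

(** * The phase and its derivative on [1, 5] *)

Section PowerBounds.
Variable R : realType.

(** A single constant bounds [s^q] from above, and its inverse from below, on [1, 5], whatever the
    sign of [q]. The segment exceeds the block [2, 4] by the room needed for arcs of radius at most
    1 centred in the block. *)
Definition pw5 (q : R) : R := 5 `^ `|q|.

Lemma pw5_ge1 q : 1 <= pw5 q.
Proof.
rewrite /pw5 -[leLHS](powRr0 (5:R)); apply: ler_powR => //; lra.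
Qed.

Lemma pw5_gt0 q : 0 < pw5 q.
Proof. exact: lt_le_trans (pw5_ge1 q). Qed.

Lemma powR_bounds (q s : R) : 1 <= s <= 5 -> (pw5 q)^-1 <= s `^ q <= pw5 q.
Proof.
have key (r : R) t : 0 <= r -> 1 <= t <= 5 -> 1 <= t `^ r <= 5 `^ r.
  move=> r0 /andP[t1 t5]; apply/andP; split.
    rewrite -[leLHS](powRr0 t); exact: ler_powR.
  by apply: ge0_ler_powR => //; rewrite nnegrE; lra.
move=> hs; have [q0|q0] := leP 0 q.
  have /andP[h1 h2] := key _ _ q0 hs.
  rewrite /pw5 ger0_norm// h2 andbT (le_trans _ h1)//.
  have h3 := le_trans h1 h2.
  by rewrite invf_le1// (lt_le_trans _ h3).
have q0' : 0 <= - q by lra.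
have /andP[h1 h2] := key _ _ q0' hs.
rewrite /pw5 ltr0_norm// -[in s `^ q](opprK q) [s `^ _]powRN.
have h3 : 0 < s `^ (- q) by exact: lt_le_trans h1.
rewrite lef_pV2 ?posrE ?(lt_le_trans h3)// h2/=.
by apply: (@le_trans _ _ 1); rewrite ?invf_le1// (le_trans h1).
Qed.

End PowerBounds.

Section Phase.
Variables (R : realType) (p : R).
Implicit Types (M z w s rho lam : R).

(** [M * psi] is the derivative of [theta] in [s]. For fixed [s], [psi] is the inner product of
    [(z, w)] with the tangent [(1, p s^(p-1))] of the curve, so the sets where it is small are
    strips normal to the curve. *)
Definition psi z w s : R := z + p * w * s `^ (p - 1).
Definition theta M z w s : R := M * (z * s + w * s `^ p).

(** The mean value theorem for [s^(p-1)], whose derivative is bounded below on [1, 5] because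
    [p > 1]: this is the curvature of the curve. The factor [p] in the upper constant, in place of
    [p - 1], makes it at least 1. *)
Lemma powR_sub1_incr : 1 < p -> exists c C : R, [/\ 0 < c, 1 <= C &
  forall s t, 1 <= s -> s <= t -> t <= 5 ->
    c * (t - s) <= t `^ (p - 1) - s `^ (p - 1) <= C * (t - s)].
Proof.
move=> p1; exists ((p - 1) / pw5 (p - 2)), (p * pw5 (p - 2)).
have h5 := pw5_gt0 (p - 2); have h51 := pw5_ge1 (p - 2).
split.
- by apply: divr_gt0 => //; lra.
- by nra.
move=> s t s1; rewrite le_eqVlt => /predU1P[<- _|st t5].
  by rewrite !subrr !mulr0 lexx.
have dd x : x \in `]s, t[%R -> is_derive x (1:R) (fun x => x `^ (p - 1)) ((p - 1) * x `^ (p - 2)).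
  rewrite in_itv/= => /andP[sx xt].
  have x0 : 0 < x by lra.
  have := is_derive1_powR (p - 1) x0; congr (is_derive _ _ _ (_ * _ `^ _)); lra.
have cc : {within `[s, t], continuous (fun x : R => x `^ (p - 1))}.
  apply: contI_within => x /andP[sx xt].
  have x0 : 0 < x by lra.
  apply: differentiable_continuous; apply/derivable1_diffP.
  by have dx := is_derive1_powR (p - 1) x0; exact: ex_derive.
have [x] := MVT st dd cc; rewrite in_itv/= => /andP[sx xt] ->.
have /andP[b1 b2] : (pw5 (p - 2))^-1 <= x `^ (p - 2) <= pw5 (p - 2).
  by apply: powR_bounds; apply/andP; split; lra.
have ts : 0 <= t - s by lra.
apply/andP; split; apply: ler_wpM2r => //.
  by apply: ler_wpM2l => //; lra.
by nra.
Qed.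

Lemma is_derive_psi z w s : 0 < s ->
  is_derive s (1:R) (psi z w) (p * (p - 1) * w * s `^ (p - 2)).
Proof.
move=> s0; have d := is_derive1_powR (p - 1) s0.
rewrite /psi; apply: is_derive_eq.
by rewrite /GRing.scale/= (_ : p - 1 - 1 = p - 2); [ring|lra].
Qed.

Lemma is_derive_theta M z w s : 0 < s ->
  is_derive s (1:R) (theta M z w) (M * psi z w s).
Proof.
move=> s0; have d := is_derive1_powR p s0.
rewrite /theta; apply: is_derive_eq.
by rewrite /GRing.scale/= /psi; ring.
Qed.

Lemma is_derive_cont (f : R -> R) s df : is_derive s (1:R) f df -> {for s, continuous f}.
Proof.
move=> d; apply: differentiable_continuous; apply/derivable1_diffP; exact: ex_derive.
Qed.

Lemma contI_powR q : contI 1 5 (fun s : R => s `^ q).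
Proof.
move=> s /andP[s1 _]; have s0 : 0 < s by lra.
exact: is_derive_cont (is_derive1_powR q s0).
Qed.

Lemma contI_psi z w : contI 1 5 (psi z w).
Proof.
move=> s /andP[s1 _]; have s0 : 0 < s by lra.
exact: is_derive_cont (is_derive_psi z w s0).
Qed.

Lemma contI_theta M z w : contI 1 5 (theta M z w).
Proof.
move=> s /andP[s1 _]; have s0 : 0 < s by lra.
exact: is_derive_cont (is_derive_theta M z w s0).
Qed.

Lemma contI_costheta M z w : contI 1 5 (fun s => cos (theta M z w s)).
Proof. by apply: contI_comp; [exact: continuous_cos|exact: contI_theta]. Qed.

Lemma contI_sintheta M z w : contI 1 5 (fun s => sin (theta M z w s)).
Proof. by apply: contI_comp; [exact: continuous_sin|exact: contI_theta]. Qed.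

Lemma contI_inv a b (f : R -> R) : contI a b f -> (forall s, a <= s <= b -> f s != 0) ->
  contI a b (fun s => (f s)^-1).
Proof. by move=> hf f0 s hs; apply: cvgV; [exact: f0|exact: hf]. Qed.

(* The graph of [psi] crosses zero at most once on [1, 5], and at a linear rate;
   [t] is the crossing point, clamped to [1, 5]. *)
Lemma psi_zero : 1 < p -> exists2 c : R, 0 < c & forall z w, exists t, [/\ 1 <= t <= 5 &
  forall s, 1 <= s <= 5 -> c * `|w| * `|s - t| <= `|psi z w s|].
Proof.
move=> p1; have [c [C [c0 C1 hc]]] := powR_sub1_incr p1.
exists c => // z w.
have [->|w0] := eqVneq w 0.
  exists 1; split; first by lra.
  by move=> s _; rewrite normr0 mulr0 mul0r.
pose v := - z / (p * w).
have psiE s : psi z w s = p * w * (s `^ (p - 1) - v).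
  by rewrite /psi /v; field; apply/andP; split => //; lra.
suff [t [ht h]] : exists t, [/\ 1 <= t <= 5 &
    forall s, 1 <= s <= 5 -> c * `|s - t| <= `|s `^ (p - 1) - v|].
  exists t; split => // s hs; rewrite psiE !normrM (gtr0_norm (_ : 0 < p)); last by lra.
  have wY : 0 <= `|w| * `|s `^ (p - 1) - v| by apply: mulr_ge0.
  have := ler_wpM2l (normr_ge0 w) (h s hs); nra.
have lim t : 1 <= t <= 5 -> t `^ (p - 1) = v -> forall s, 1 <= s <= 5 -> c * `|s - t| <= `|s `^ (p - 1) - v|.
  move=> /andP[t1 t5] <- s /andP[s1 s5]; have [st|ts] := leP s t.
    have /andP[h _] := hc _ _ s1 st t5.
    by rewrite distrC [leRHS]distrC (ger0_norm (_ : 0 <= t - s)) ?subr_ge0// (le_trans h)// ler_norm.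
  have /andP[h _] := hc _ _ t1 (ltW ts) s5.
  by rewrite (ger0_norm (_ : 0 <= s - t)) ?subr_ge0 ?(ltW ts)// (le_trans h)// ler_norm.
have [v1|v1] := leP v 1.
  exists 1; split => [|s /andP[s1 s5]]; first by lra.
  have /andP[h _] := hc _ _ (lexx 1) s1 s5.
  rewrite powR1 in h.
  rewrite (ger0_norm (_ : 0 <= s - 1)) ?subr_ge0// (le_trans h)// (le_trans _ (ler_norm _))//.
  by lra.
have [v5|v5] := leP (5 `^ (p - 1)) v.
  exists 5; split => [|s /andP[s1 s5]]; first by lra.
  have /andP[h _] := hc _ _ s1 s5 (lexx 5).
  rewrite distrC [leRHS]distrC.
  rewrite (ger0_norm (_ : 0 <= 5 - s)) ?subr_ge0// (le_trans h)// (le_trans _ (ler_norm _))//.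
  by lra.
have pp : 0 < p - 1 by lra.
have vE : (v `^ (p - 1)^-1) `^ (p - 1) = v.
  by rewrite -powRrM mulVf ?powRr1//; lra.
exists (v `^ (p - 1)^-1); have hh : 1 <= v `^ (p - 1)^-1 <= 5.
  have pV : 0 <= (p - 1)^-1 by rewrite invr_ge0; lra.
  apply/andP; split.
    rewrite -[leLHS](_ : 1 `^ (p - 1)^-1 = 1); last by rewrite powR1.
    by apply: ge0_ler_powR; rewrite ?nnegrE//; lra.
  have -> : (5:R) = (5 `^ (p - 1)) `^ (p - 1)^-1.
    by rewrite -powRrM mulfV ?powRr1//; lra.
  by apply: ge0_ler_powR; rewrite ?nnegrE ?powR_ge0//; lra.
by split => //; exact: lim.
Qed.

End Phase.

(** * Oscillatory integrals over arcs *)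

Section Bump.
Variable R : realType.
Implicit Types (x s rho : R).

(** The square makes the first derivative vanish at the ends as well, which is what two integrations
    by parts without boundary terms require. *)
Definition bump x : R := Num.max 0 (1 - x ^+ 2) ^+ 2.
Definition arc s0 rho s : R := bump ((s - s0) / rho).

Lemma bump_in x : `|x| <= 1 -> bump x = (1 - x ^+ 2) ^+ 2.
Proof.
move=> x1; rewrite /bump max_r// subr_ge0 -real_normK ?num_real//.
by rewrite expr_le1.
Qed.

Lemma bump_out x : 1 <= `|x| -> bump x = 0.
Proof.
move=> x1; rewrite /bump max_l ?expr0n// subr_le0 -real_normK ?num_real//.
by rewrite expr_ge1.
Qed.

Lemma bump_ge0 x : 0 <= bump x.
Proof. exact: sqr_ge0. Qed.

Lemma bump_le1 x : bump x <= 1.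
Proof.
have [x1|x1] := leP `|x| 1; last by rewrite bump_out// ltW.
rewrite bump_in// expr_le1//; first by rewrite gerBl sqr_ge0.
by rewrite subr_ge0 -real_normK ?num_real// expr_le1.
Qed.

Lemma continuous_bump : continuous bump.
Proof.
have cm : continuous (fun x : R => Num.max 0 (1 - x ^+ 2)).
  move=> x; apply: (@continuous_max R R (fun=> 0) (fun x => 1 - x ^+ 2)); first exact: cvg_cst.
  by apply: cvgB; [exact: cvg_cst|exact: exprn_continuous].
rewrite /bump; under eq_fun do rewrite expr2.
by move=> x; apply: cvgM; exact: cm.
Qed.

Lemma contI_arc a b s0 rho : contI a b (arc s0 rho).
Proof.
apply: contI_comp; first exact: continuous_bump.
apply: contIM; last exact: contI_cst.
by apply: contIB; [move=> x _; exact: cvg_id|exact: contI_cst].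
Qed.

Lemma arc_ge0 s0 rho s : 0 <= arc s0 rho s.
Proof. exact: bump_ge0. Qed.

Lemma arc_le1 s0 rho s : arc s0 rho s <= 1.
Proof. exact: bump_le1. Qed.

Lemma arc_out s0 rho s : 0 < rho -> rho <= `|s - s0| -> arc s0 rho s = 0.
Proof.
move=> r0 h; apply: bump_out; rewrite normrM normfV (gtr0_norm r0).
by rewrite ler_pdivlMr// mul1r.
Qed.

Lemma arc_in s0 rho s : 0 < rho -> `|s - s0| <= rho ->
  arc s0 rho s = (1 - ((s - s0) / rho) ^+ 2) ^+ 2.
Proof.
move=> r0 h; apply: bump_in; rewrite normrM normfV (gtr0_norm r0).
by rewrite ler_pdivrMr// mul1r.
Qed.

(** Inside its support the cutoff is a polynomial, so that derivative rules apply without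
    differentiating a maximum. *)
Lemma intg_arc s0 rho (f : R -> R) : 0 < rho -> 1 <= s0 - rho -> s0 + rho <= 5 ->
  contI 1 5 f ->
  intg 1 5 (fun s => arc s0 rho s * f s) =
  intg (s0 - rho) (s0 + rho) (fun s => (1 - ((s - s0) / rho) ^+ 2) ^+ 2 * f s).
Proof.
move=> r0 h1 h5 hf.
have hg : contI 1 5 (fun s => arc s0 rho s * f s) by apply: contIM => //; exact: contI_arc.
have z a b : (forall s, a <= s <= b -> rho <= `|s - s0|) -> intg a b (fun s => arc s0 rho s * f s) = 0.
  move=> h; rewrite (@eq_intg _ _ _ _ (fun=> 0 * 0)).
    by rewrite intgZ ?mul0r//; exact: contI_cst.
  by move=> s hs; rewrite arc_out ?mul0r// h.
rewrite (@intg_split _ _ _ _ (s0 - rho))//; last by apply/andP; split; lra.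
rewrite z ?add0r => [|s /andP[? ?]]; last by rewrite ler0_norm; lra.
rewrite (@intg_split _ _ _ _ (s0 + rho)); last 2 first.
- by apply/andP; split; lra.
- by apply: contI_sub hg => //; lra.
rewrite [X in _ + X]z ?addr0 => [|s /andP[? ?]]; last by rewrite ger0_norm; lra.
apply: eq_intg => s /andP[sa sb]; rewrite arc_in// ler_norml; apply/andP; split; lra.
Qed.

End Bump.

Section Kernel.
Variables (R : realType) (p : R).
Implicit Types (M z w s rho lam : R).

Definition ker M s0 rho z w : R :=
  intg 1 5 (fun s => arc s0 rho s * cos (theta p M z w s)).

Lemma ker_le M s0 rho z w : 0 < rho -> 1 <= s0 - rho -> s0 + rho <= 5 ->
  `|ker M s0 rho z w| <= 2 * rho.
Proof.
move=> r0 h1 h5; rewrite /ker intg_arc//; last exact: contI_costheta.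
have -> : 2 * rho = 1 * ((s0 + rho) - (s0 - rho)) by ring.
apply: intg_abs_le; first lra.
  apply: contIM.
    apply: contIX; apply: contIB; first exact: contI_cst.
    apply: contIX; apply: contIM; last exact: contI_cst.
    by apply: contIB; [move=> x _; exact: cvg_id|exact: contI_cst].
  by apply: (@contI_sub _ 1 5) => //; exact: contI_costheta.
move=> s /andP[sa sb]; rewrite -arc_in//; last by rewrite ler_norml; apply/andP; split; lra.
rewrite normrM (ger0_norm (arc_ge0 _ _ _)) mulr_ile1 ?arc_ge0 ?arc_le1//.
by rewrite ler_norml cos_geN1 cos_le1.
Qed.

(* The antiderivative
     X sin(theta) / (M psi) + (X psi - X psi') cos(theta) / (M^2 psi^3)
   packs two integrations by parts into one use of the fundamental theorem:
   its derivative is [X cos theta] plus a term of size [(rho M lam)^-2]. *)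
Lemma ker_nonstationary : 1 < p -> forall kap, 0 <= kap -> exists2 C : R, 0 < C &
  forall M s0 rho z w lam, 0 < M -> 0 < rho -> 1 <= s0 - rho -> s0 + rho <= 5 ->
  0 < lam -> `|w| * rho <= kap * lam ->
  (forall s, s0 - rho <= s <= s0 + rho -> lam <= `|psi p z w s|) ->
  `|ker M s0 rho z w| <= C * (rho / (rho * M * lam) ^+ 2).
Proof.
move=> p1 kap kap0.
pose B1 := p * (p - 1) * pw5 (p - 2).
(* The factor 2 pays for the extra [1 / rho] in the bound of [P2]: an arc inside [1, 5] has
   [rho <= 2]. *)
pose B2 := p * (p - 1) * `|p - 2| * pw5 (p - 3) * 2.
have B10 : 0 <= B1 by rewrite !mulr_ge0// ?(ltW (pw5_gt0 _))//; lra.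
have B20 : 0 <= B2 by rewrite !mulr_ge0// ?(ltW (pw5_gt0 _))//; lra.
pose D := 8 + B2 * kap + 12 * (B1 * kap) + 3 * (B1 * kap) ^+ 2.
have D0 : 0 < D.
  have : 0 <= B2 * kap by rewrite mulr_ge0.
  have : 0 <= B1 * kap by rewrite mulr_ge0.
  have : 0 <= (B1 * kap) ^+ 2 by rewrite sqr_ge0.
  by rewrite /D; lra.
exists (2 * D); first by lra.
have p_gt0 : 0 < p by lra.
have p1_gt0 : 0 < p - 1 by lra.
move=> M s0 rho z w lam M0 r0 h1 h5 lam0 wr hpsi.
(* [X1], [X2] and [P1], [P2] are the first two derivatives of the cutoff [X] and of [P]. [F] is the
   antiderivative announced above, and [F' = X cos + G cos] with error [G]. *)
pose x s := (s - s0) / rho.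
pose X s := (1 - x s ^+ 2) ^+ 2.
pose X1 s := - 4 * x s * (1 - x s ^+ 2) / rho.
pose X2 s := (- 4 + 12 * x s ^+ 2) / rho ^+ 2.
pose P s := psi p z w s.
pose P1 s := p * (p - 1) * w * s `^ (p - 2).
pose P2 s := p * (p - 1) * w * ((p - 2) * s `^ (p - 3)).
pose th := theta p M z w.
pose F s := X s * (M * P s)^-1 * sin (th s) + (X1 s * P s - X s * P1 s) * (M ^+ 2 * P s ^+ 3)^-1 * cos (th s).
pose G s := (X2 s * P s - X s * P2 s) * (M ^+ 2 * P s ^+ 3)^-1 -
   3 * (X1 s * P s - X s * P1 s) * P1 s * (M ^+ 2 * P s ^+ 4)^-1.
have Pn0 s : s0 - rho <= s <= s0 + rho -> P s != 0.
  by move=> hs; rewrite -normr_gt0 (lt_le_trans lam0)// hpsi.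
have cx : contI (s0 - rho) (s0 + rho) x.
  apply: contIM; last exact: contI_cst.
  by apply: contIB; [move=> y _; exact: cvg_id|exact: contI_cst].
have cX : contI (s0 - rho) (s0 + rho) X.
  by apply: contIX; apply: contIB; [exact: contI_cst|exact: contIX].
have cX1 : contI (s0 - rho) (s0 + rho) X1.
  apply: contIM; last exact: contI_cst.
  apply: contIM; last by apply: contIB; [exact: contI_cst|exact: contIX].
  by apply: contIM; [exact: contI_cst|].
have cX2 : contI (s0 - rho) (s0 + rho) X2.
  apply: contIM; last exact: contI_cst.
  apply: contID; first exact: contI_cst.
  by apply: contIM; [exact: contI_cst|exact: contIX].
have sub f : contI 1 5 f -> contI (s0 - rho) (s0 + rho) f.
  by apply: contI_sub.
have cP : contI (s0 - rho) (s0 + rho) P by apply: sub; exact: contI_psi.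
have cP1 : contI (s0 - rho) (s0 + rho) P1.
  by apply: sub; apply: contIM; [exact: contI_cst|exact: contI_powR].
have cP2 : contI (s0 - rho) (s0 + rho) P2.
  apply: sub; apply: contIM; first exact: contI_cst.
  by apply: contIM; [exact: contI_cst|exact: contI_powR].
have cc : contI (s0 - rho) (s0 + rho) (fun s => cos (th s)).
  by apply: sub; exact: contI_costheta.
have cPn k : contI (s0 - rho) (s0 + rho) (fun s => (M ^+ 2 * P s ^+ k)^-1).
  apply: contI_inv.
    by apply: contIM; [exact: contI_cst|exact: contIX].
  by move=> s /Pn0 h; rewrite mulf_neq0 ?expf_neq0// gt_eqF.
have cG : contI (s0 - rho) (s0 + rho) G.
  apply: contIB; last first.
    apply: contIM; last exact: cPn.
    apply: contIM; last exact: cP1.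
    apply: contIM; first exact: contI_cst.
    by apply: contIB; apply: contIM.
  apply: contIM; last exact: cPn.
  by apply: contIB; apply: contIM.
have cGc : contI (s0 - rho) (s0 + rho) (fun s => G s * cos (th s)) by apply: contIM.
have cXc : contI (s0 - rho) (s0 + rho) (fun s => X s * cos (th s)) by apply: contIM.
have dF s : s0 - rho <= s <= s0 + rho ->
    is_derive s (1:R) F (X s * cos (th s) + G s * cos (th s)).
  move=> hs; have s_gt0 : 0 < s by move: hs => /andP[? _]; lra.
  have Ps := Pn0 _ hs.
  have dx : is_derive s (1:R) x rho^-1.
    by rewrite /x; apply: is_derive_eq; rewrite /GRing.scale/=; ring.
  have dX : is_derive s (1:R) X (X1 s).
    rewrite /X; apply: is_derive_eq; rewrite /GRing.scale/= /X1; ring.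
  have dX1 : is_derive s (1:R) X1 (X2 s).
    rewrite /X1; apply: is_derive_eq; rewrite /GRing.scale/= /X2; field; lra.
  have dP : is_derive s (1:R) P (P1 s) by exact: is_derive_psi.
  have dP1 : is_derive s (1:R) P1 (P2 s).
    have d := is_derive1_powR (p - 2) s_gt0.
    rewrite /P1; apply: is_derive_eq; rewrite /GRing.scale/= /P2.
    by rewrite (_ : p - 2 - 1 = p - 3); [ring|lra].
  have dth : is_derive s (1:R) th (M * P s) by exact: is_derive_theta.
  have dI1 : is_derive s (1:R) (fun s => (M * P s)^-1) (- P1 s / (M * P s ^+ 2)).
    have n0 : M * P s != 0 by rewrite mulf_neq0// gt_eqF.
    have dMP : is_derive s (1:R) (fun s => M * P s) (M * P1 s).
      by apply: is_derive_eq; rewrite /GRing.scale/=; ring.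
    have := @is_deriveV _ (fun s => M * P s) _ _ _ n0 dMP; congr (is_derive _ _ _ _).
    by rewrite /GRing.scale/=; field; rewrite Ps gt_eqF.
  have dI3 : is_derive s (1:R) (fun s => (M ^+ 2 * P s ^+ 3)^-1) (- 3 * P1 s / (M ^+ 2 * P s ^+ 4)).
    have n0 : M ^+ 2 * P s ^+ 3 != 0 by rewrite mulf_neq0 ?expf_neq0// gt_eqF.
    have dMP : is_derive s (1:R) (fun s => M ^+ 2 * P s ^+ 3) (M ^+ 2 * (3 * P s ^+ 2 * P1 s)).
      by apply: is_derive_eq; rewrite /GRing.scale/=; ring.
    have := @is_deriveV _ (fun s => M ^+ 2 * P s ^+ 3) _ _ _ n0 dMP; congr (is_derive _ _ _ _).
    by rewrite /GRing.scale/=; field; rewrite Ps gt_eqF.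
  rewrite /F; apply: is_derive_eq; rewrite /GRing.scale/= /G.
  by field; rewrite Ps gt_eqF.
have r0n : rho != 0 by rewrite gt_eqF.
have X_end s : s = s0 - rho \/ s = s0 + rho -> F s = 0.
  move=> hs; have x2 : x s ^+ 2 = 1.
    by case: hs => ->; rewrite /x; field.
  by rewrite /F /X1 /X x2 subrr expr0n/= !(mulr0, mul0r, subr0, addr0).
rewrite /ker intg_arc//; last exact: contI_costheta.
have -> : intg (s0 - rho) (s0 + rho) (fun s => (1 - ((s - s0) / rho) ^+ 2) ^+ 2 * cos (theta p M z w s)) =
    - intg (s0 - rho) (s0 + rho) (fun s => G s * cos (th s)).
  apply/eqP; rewrite -addr_eq0 -intgD//.
  rewrite (FTC _ _ dF); last 2 first.
  - lra.
  - exact: contID.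
  by rewrite (X_end (s0 + rho)) ?(X_end (s0 - rho)) ?subrr//; [left|right].
rewrite normrN.
have -> : 2 * D * (rho / (rho * M * lam) ^+ 2) =
   D / (rho * M * lam) ^+ 2 * (s0 + rho - (s0 - rho)).
  by field; rewrite r0n !gt_eqF.
apply: intg_abs_le => //; first lra.
move=> s hs; rewrite normrM.
apply: (@le_trans _ _ (`|G s| * 1)).
  by rewrite ler_wpM2l// ler_norml cos_geN1 cos_le1.
rewrite mulr1.
have hs5 : 1 <= s <= 5 by clear -hs h1 h5; move: hs => /andP[? ?]; apply/andP; split; lra.
have x1 : x s ^+ 2 <= 1.
  rewrite -real_normK ?num_real// expr_le1// normrM normfV (gtr0_norm r0).
  rewrite ler_pdivrMr// mul1r ler_norml; clear -hs; move: hs => /andP[? ?]; apply/andP; split; lra.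
have x1' : `|x s| <= 1 by rewrite -(@ler_pXn2r _ 2)// ?nnegrE// real_normK ?num_real// expr1n.
have x20 : 0 <= x s ^+ 2 by exact: sqr_ge0.
have y1 : `|1 - x s ^+ 2| <= 1 by rewrite ler_norml; clear -x1 x20; apply/andP; split; lra.
(* The numerators of [G] contain [P s], which is not bounded above in terms of [lam]. Powers of [a]
   are therefore kept until they cancel, and then [a * lam <= 1] finishes. *)
pose a := `|P s|^-1.
have a0 : 0 < a by rewrite invr_gt0 normr_gt0 Pn0.
have al : a <= lam^-1 by rewrite lef_pV2 ?posrE ?normr_gt0 ?Pn0// hpsi.
have bX : `|X s| <= 1 by rewrite normrX expr_le1.
have bX1 : `|X1 s| <= 4 / rho.
  rewrite /X1; move: (x s) x1' y1 => y y1 y1'.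
  rewrite !normrM normfV (gtr0_norm r0) ler_pM2r ?invr_gt0// normrN.
  rewrite (ger0_norm (_ : 0 <= 4))// -mulrA -[leRHS]mulr1 ler_pM2l//.
  exact: mulr_ile1.
have bX2 : `|X2 s| <= 8 / rho ^+ 2.
  rewrite /X2 normrM normfV (gtr0_norm (exprn_gt0 _ r0)) ler_pM2r ?invr_gt0 ?exprn_gt0//.
  rewrite ler_norml; clear -x1 x20; apply/andP; split; lra.
(* So each derivative of [psi] costs a factor [1 / rho] relative to [lam], just like a derivative of
   the cutoff. *)
have wk : `|w| <= kap * lam / rho by rewrite ler_pdivlMr.
have kl0 : 0 <= kap * lam / rho by rewrite !mulr_ge0// ?invr_ge0 ltW.
have bP1 : `|P1 s| <= B1 * (kap * lam / rho).
  rewrite /P1 !normrM (gtr0_norm p_gt0) (gtr0_norm p1_gt0).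
  rewrite (ger0_norm (powR_ge0 _ _)) /B1 -!mulrA (ler_pM2l p_gt0) (ler_pM2l p1_gt0).
  rewrite [in leRHS]mulrC mulrA; have := powR_bounds (p - 2) hs5 => /andP[_ h].
  apply: (le_trans _ (_ : kap * lam / rho * pw5 (p - 2) <= _)); last by rewrite mulrC -!mulrA.
  by apply: ler_pM => //; exact: powR_ge0.
have bP2 : `|P2 s| <= B2 * (kap * lam / rho) / rho.
  rewrite /P2 !normrM (gtr0_norm p_gt0) (gtr0_norm p1_gt0).
  rewrite (ger0_norm (powR_ge0 _ _)) /B2.
  have := powR_bounds (p - 3) hs5 => /andP[_ h].
  have -> : p * (p - 1) * `|p - 2| * pw5 (p - 3) * 2 * (kap * lam / rho) / rho =
     p * (p - 1) * (kap * lam / rho) * (`|p - 2| * pw5 (p - 3) * (2 / rho)) by field.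
  have r2 : 1 <= 2 / rho by rewrite ler_pdivlMr// mul1r; clear -h1 h5; lra.
  have pp0 : 0 <= p * (p - 1) by exact: mulr_ge0 (ltW p_gt0) (ltW p1_gt0).
  apply: ler_pM; first exact: mulr_ge0.
  - by rewrite mulr_ge0 ?powR_ge0.
  - by rewrite ler_wpM2l.
  rewrite -[leLHS]mulr1; apply: ler_pM; rewrite ?mulr_ge0 ?powR_ge0//.
  by rewrite ler_wpM2l.
have Pa : `|P s| = a^-1 by rewrite invrK.
have an0 : a != 0 by rewrite gt_eqF.
have Mn0 : M != 0 by rewrite gt_eqF.
have ln0 : lam != 0 by rewrite gt_eqF.
pose L := lam^-1.
have L0 : 0 < L by rewrite invr_gt0.
have E (k : nat) : `|(M ^+ 2 * P s ^+ k)^-1| = a ^+ k / M ^+ 2.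
  rewrite normfV normrM !normrX (gtr0_norm M0) Pa.
  by rewrite exprVn invfM invrK mulrC.
have la1 : a * lam <= 1 by rewrite -ler_pdivlMr// mul1r.
have la0 : 0 <= a * lam by rewrite mulr_ge0// ltW.
have T1 : `|(X2 s * P s - X s * P2 s) * (M ^+ 2 * P s ^+ 3)^-1| <=
    (8 + B2 * kap) / (rho * M * lam) ^+ 2.
  rewrite normrM E.
  apply: (@le_trans _ _ ((8 / rho ^+ 2 * a^-1 + 1 * (B2 * (kap * lam / rho) / rho)) * (a ^+ 3 / M ^+ 2))).
    apply: ler_wpM2r; first by rewrite divr_ge0 ?exprn_ge0// ltW.
    apply: (le_trans (ler_normB _ _)); rewrite (normrM (X2 s)) (normrM (X s)) -Pa.
    by apply: lerD; apply: ler_pM.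
  have -> : (8 / rho ^+ 2 * a^-1 + 1 * (B2 * (kap * lam / rho) / rho)) * (a ^+ 3 / M ^+ 2) =
    (8 + B2 * kap * (a * lam)) * (a * lam) ^+ 2 / (rho * M * lam) ^+ 2.
    by field; rewrite an0 r0n Mn0 ln0.
  rewrite ler_pM2r ?invr_gt0 ?exprn_gt0 ?mulr_gt0//.
  rewrite -[leRHS]mulr1; apply: ler_pM; rewrite ?exprn_ge0//.
  - by apply: addr_ge0 => //; apply: mulr_ge0 => //; exact: mulr_ge0.
  - by rewrite lerD2l -[leRHS]mulr1 ler_wpM2l// mulr_ge0.
  - exact: exprn_ile1.
have T2 : `|3 * (X1 s * P s - X s * P1 s) * P1 s * (M ^+ 2 * P s ^+ 4)^-1| <=
    (12 * (B1 * kap) + 3 * (B1 * kap) ^+ 2) / (rho * M * lam) ^+ 2.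
  rewrite normrM E (normrM _ (P1 s)) (normrM 3) (ger0_norm (_ : 0 <= 3))//.
  apply: (@le_trans _ _ (3 * (4 / rho * a^-1 + 1 * (B1 * (kap * lam / rho))) * (B1 * (kap * lam / rho)) * (a ^+ 4 / M ^+ 2))).
    apply: ler_wpM2r; first by rewrite divr_ge0 ?exprn_ge0// ltW.
    apply: ler_pM => //.
    apply: ler_wpM2l => //.
    apply: (le_trans (ler_normB _ _)); rewrite (normrM (X1 s)) (normrM (X s)) -Pa.
    by apply: lerD; apply: ler_pM.
  have -> : 3 * (4 / rho * a^-1 + 1 * (B1 * (kap * lam / rho))) * (B1 * (kap * lam / rho)) * (a ^+ 4 / M ^+ 2) =
    (12 * (B1 * kap) + 3 * (B1 * kap) ^+ 2 * (a * lam)) * (a * lam) ^+ 3 / (rho * M * lam) ^+ 2.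
    by field; rewrite an0 r0n Mn0 ln0.
  rewrite ler_pM2r ?invr_gt0 ?exprn_gt0 ?mulr_gt0//.
  have bk : 0 <= B1 * kap by rewrite mulr_ge0.
  have bk2 : 0 <= (B1 * kap) ^+ 2 by rewrite sqr_ge0.
  rewrite -[leRHS]mulr1; apply: ler_pM; rewrite ?exprn_ge0//.
  - by apply: addr_ge0; apply: mulr_ge0 => //; exact: mulr_ge0.
  - by rewrite lerD2l -[leRHS]mulr1 ler_wpM2l// mulr_ge0.
  - exact: exprn_ile1.
apply: (le_trans (ler_normB _ _)); rewrite /D.
have -> : 8 + B2 * kap + 12 * (B1 * kap) + 3 * (B1 * kap) ^+ 2 =
  (8 + B2 * kap) + (12 * (B1 * kap) + 3 * (B1 * kap) ^+ 2) by ring.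
by rewrite [leRHS]mulrDl lerD.
Qed.

End Kernel.

(** * Kernel bounds off the stationary strip and for pairs of arcs *)

Section KernelBounds.
Variables (R : realType) (p : R).
Implicit Types (M z w s rho lam : R).

Lemma psi_lipschitz : 1 < p -> exists2 C : R, 1 <= C & forall z w s t,
  1 <= s <= 5 -> 1 <= t <= 5 -> `|psi p z w s - psi p z w t| <= C * `|w| * `|s - t|.
Proof.
move=> p1; have [c [C [c0 C1 hC]]] := powR_sub1_incr p1.
exists (p * C); first by nra.
have key z w s t : 1 <= s -> s <= t -> t <= 5 ->
    `|psi p z w s - psi p z w t| <= p * C * `|w| * `|s - t|.
  move=> s1 st t5; have /andP[h1 h2] := hC _ _ s1 st t5.
  have h0 : 0 <= t `^ (p - 1) - s `^ (p - 1).
    by apply: le_trans h1; rewrite mulr_ge0 ?subr_ge0// ltW.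
  have -> : psi p z w s - psi p z w t = - (p * w * (t `^ (p - 1) - s `^ (p - 1))).
    by rewrite /psi; ring.
  rewrite normrN !normrM (gtr0_norm (_ : 0 < p)); last lra.
  rewrite (ger0_norm h0) distrC (ger0_norm (_ : 0 <= t - s)) ?subr_ge0//.
  have -> : p * C * `|w| * (t - s) = p * `|w| * (C * (t - s)) by ring.
  by rewrite ler_wpM2l// mulr_ge0//; lra.
move=> z w s t /andP[s1 s5] /andP[t1 t5]; have [st|/ltW ts] := leP s t; first exact: key.
by rewrite distrC [`|s - t|]distrC; exact: key.
Qed.

(** The slope [p s^(p-1)] is at least 1, so [w] can be large only if [z] or [psi] is. This replaces
    an a priori bound on [w], which the stretching of the second coordinate destroys; only [z] stays
    bounded. *)
Lemma psi_ge_weight s z w : 1 < p -> 1 <= s -> `|w| <= `|z| + `|psi p z w s|.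
Proof.
move=> p1 s1.
have h : 1 <= s `^ (p - 1) by rewrite -[leLHS](powRr0 s); apply: ler_powR => //; lra.
have -> : `|z| = `|- z| by rewrite normrN.
apply: le_trans (ler_normD _ _); rewrite /psi addKr !normrM.
rewrite (gtr0_norm (_ : 0 < p)); last lra.
rewrite (ger0_norm (powR_ge0 _ _)); have := normr_ge0 w.
move=> w0; rewrite mulrAC -[leLHS]mul1r ler_wpM2r//; nra.
Qed.

Lemma psi_ge_half (C z w s0 rho s : R) : 0 <= C ->
  (forall z w s t, 1 <= s <= 5 -> 1 <= t <= 5 ->
    `|psi p z w s - psi p z w t| <= C * `|w| * `|s - t|) ->
  1 <= s0 - rho -> s0 + rho <= 5 -> 2 * C * `|w| * rho <= `|psi p z w s0| ->
  s0 - rho <= s <= s0 + rho -> `|psi p z w s0| / 2 <= `|psi p z w s|.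
Proof.
move=> C0 hlip h1 h5 hu /andP[sa sb].
have s15 : 1 <= s <= 5 by apply/andP; split; lra.
have s015 : 1 <= s0 <= 5 by apply/andP; split; lra.
have hl := hlip z w s s0 s15 s015.
have hr : C * `|w| * `|s - s0| <= C * `|w| * rho.
  by apply: ler_wpM2l; [rewrite mulr_ge0|rewrite ler_norml; apply/andP; split; lra].
have := ler_normB (psi p z w s) (psi p z w s - psi p z w s0).
rewrite opprB addrC subrK; move: hl hr hu; clear; lra.
Qed.

(** If the variation of [psi] over the arc exceeded half of its value at [s0], then for
    [rho <= rho1] the previous bound on [w] would give [|w| <= 2 D], and [psi] at [s0] would be
    below [C1 * rho]. So beyond that strip the phase is nonstationary. The bound [C1 * rho1 <= D]
    keeps the strips no wider than the bound on the first coordinate. *)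
Lemma ker_far : 1 < p -> exists2 rho1 : R, 0 < rho1 <= 1 & forall D, 1 <= D ->
  exists C1 C2 : R, [/\ D <= C1, C1 * rho1 <= D, 0 < C2 &
  forall M s0 rho z w, 0 < M -> 0 < rho -> rho <= rho1 -> 1 <= s0 - rho -> s0 + rho <= 5 ->
  `|z| <= D -> C1 * rho < `|psi p z w s0| ->
  `|ker p M s0 rho z w| <= C2 * (rho / (rho * M * `|psi p z w s0|) ^+ 2)].
Proof.
move=> p1; have [C3 C31 hlip] := psi_lipschitz p1.
have [C C0 hC] := ker_nonstationary p1 ler01.
have C30 : 0 < C3 by lra.
exists (4 * C3)^-1.
  by rewrite invr_gt0 invf_le1 ?mulr_gt0//; apply/andP; split; lra.
move=> D D1; exists (4 * C3 * D), (4 * C); split.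
- by nra.
- by rewrite mulrAC mulfV ?mul1r// mulf_neq0//; lra.
- lra.
move=> M s0 rho z w M0 r0 r1 h1 h5 zD; set u := psi p z w s0 => hu.
have r4 : 4 * C3 * rho <= 1.
  by rewrite -[leRHS](@mulfV _ (4 * C3)) ?ler_wpM2l//; [lra|rewrite gt_eqF// mulr_gt0].
have D0 : 0 < D by lra.
have u0 : 0 < `|u| by apply: le_lt_trans hu; rewrite !mulr_ge0 ?ltW.
have w0 := normr_ge0 w.
have s01 : 1 <= s0 by lra.
have ucase : 2 * C3 * `|w| * rho <= `|u|.
  rewrite leNgt; apply/negP => hu2.
  have hw := @psi_ge_weight s0 z w p1 s01; rewrite -/u in hw.
  have h2 : 2 * C3 * `|w| * rho <= `|w| / 2.
    by have := ler_wpM2l w0 r4; clear; lra.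
  have w2 : `|w| <= 2 * D by move: hw h2 hu2 zD; clear; lra.
  have : `|w| * (C3 * rho) <= 2 * D * (C3 * rho) by rewrite ler_wpM2r// mulr_ge0 ?ltW.
  by move: hu hu2; clear; lra.
have L0 : 0 < `|u| / 2 by rewrite divr_gt0.
have := hC M s0 rho z w (`|u| / 2) M0 r0 h1 h5 L0.
have -> : C * (rho / (rho * M * (`|u| / 2)) ^+ 2) = 4 * C * (rho / (rho * M * `|u|) ^+ 2).
  by field; rewrite !gt_eqF.
apply; last by move=> s; apply: (psi_ge_half (ltW C30)).
rewrite mul1r; have : `|w| * rho <= C3 * (`|w| * rho) by rewrite ler_peMl// mulr_ge0// ltW.
by move: ucase; clear; lra.
Qed.

Lemma child_arc (K rho s0 si : R) : `|si - s0| <= rho - rho / K ->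
  s0 - rho <= si - rho / K /\ si + rho / K <= s0 + rho.
Proof. by rewrite ler_norml => /andP[]; set r := rho / K => ? ?; split; lra. Qed.

(* The phase is stationary on at most one of the two separated arcs. *)
Lemma ker_pair (K : R) : 1 < p -> 1 <= K -> exists2 C : R, 0 < C &
  forall M s0 rho s1 s2 z w, 0 < M -> 0 < rho -> 1 <= s0 - rho -> s0 + rho <= 5 ->
  `|s1 - s0| <= rho - rho / K -> `|s2 - s0| <= rho - rho / K ->
  3 * (rho / K) <= `|s1 - s2| ->
  let k := `|ker p M s1 (rho / K) z w| * `|ker p M s2 (rho / K) z w| in
  k <= C * rho ^+ 2 /\
  k * (M * rho * `|psi p z w s0| + M * rho ^+ 2 * `|w|) ^+ 2 <= C * rho ^+ 2.
Proof.
move=> p1 K1; have [C3 C31 hlip] := psi_lipschitz p1.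
have [Ca Ca0 hCa] := ker_nonstationary p1 ler01.
have [c c0 hz] := psi_zero p1.
(* For [lam = c |w| r / 2], the value used on an arc away from the zero of [psi], this choice of
   [kap] gives [kap * lam = |w| r] exactly. *)
have c20 : 0 <= 2 / c by rewrite divr_ge0// ltW.
have [Cb Cb0 hCb] := ker_nonstationary p1 c20.
have K0 : 0 < K by lra.
have C30 : 0 < C3 by lra.
pose Cm := 8 * Cb * (2 * C3 + 1) ^+ 2 * K ^+ 2 / c ^+ 2.
have Cm0 : 0 < Cm by rewrite !mulr_gt0 ?invr_gt0 ?exprn_gt0//; lra.
pose Ct := 4 + 32 * Ca + Cm.
have [C4 C32 Cmt] : [/\ 4 <= Ct, 32 * Ca <= Ct & Cm <= Ct].
  by rewrite /Ct; split; move: Ca0 Cm0; clear; lra.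
exists Ct; first exact: lt_le_trans C4.
move=> M s0 rho s1 s2 z w M0 r0 h1 h5 hs1 hs2 hs12 /=.
have [s1a s1b] := child_arc hs1; have [s2a s2b] := child_arc hs2.
set r := rho / K in s1a s1b s2a s2b hs12 *; set u := psi p z w s0.
have rr : 0 < r by rewrite divr_gt0.
have rrho : r <= rho by rewrite ler_pdivrMr// ler_peMr// ltW.
have rE : rho = K * r by rewrite /r; field; rewrite gt_eqF.
have s11 : 1 <= s1 - r by exact: le_trans s1a.
have s15 : s1 + r <= 5 by exact: le_trans h5.
have s21 : 1 <= s2 - r by exact: le_trans s2a.
have s25 : s2 + r <= 5 by exact: le_trans h5.
set k1 := `|ker p M s1 r z w|; set k2 := `|ker p M s2 r z w|.
have k1r : k1 <= 2 * r by exact: ker_le.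
have k2r : k2 <= 2 * r by exact: ker_le.
have k10 : 0 <= k1 by exact: normr_ge0.
have k20 : 0 <= k2 by exact: normr_ge0.
have w0 := normr_ge0 w.
have rho2 : 0 <= rho ^+ 2 by rewrite sqr_ge0.
split.
  apply: (@le_trans _ _ (2 * rho * (2 * rho))).
    by apply: ler_pM => //; [apply: (le_trans k1r)|apply: (le_trans k2r)]; rewrite ler_pM2l.
  have -> : 2 * rho * (2 * rho) = 4 * rho ^+ 2 by ring.
  exact: ler_wpM2r.
have f0 : 0 <= M * rho * `|u| + M * rho ^+ 2 * `|w|.
  by rewrite addr_ge0// !mulr_ge0// ltW.
(* Either [psi] at the parent centre dominates its variation, and the arc at [s1] is nonstationary;
   or [M rho^2 |w|] dominates the weight. In the second case the centres are [3 r] apart, so one of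
   them is at least [3 r / 2] from the zero [t], and on its arc [|s - t| >= r / 2]. The other kernel
   is always bounded by [2 r]. *)
have [ucase|ucase] := leP (2 * C3 * `|w| * rho) `|u|.
  have wu : `|w| * rho <= `|u| / 2.
    have : `|w| * rho <= C3 * (`|w| * rho) by rewrite ler_peMl// mulr_ge0// ltW.
    by move: ucase; clear; lra.
  have hf : M * rho * `|u| + M * rho ^+ 2 * `|w| <= 2 * M * rho * `|u|.
    have : M * rho * (`|w| * rho) <= M * rho * (`|u| / 2) by rewrite ler_wpM2l// mulr_ge0// ltW.
    have : 0 <= M * rho * `|u| by rewrite !mulr_ge0// ltW.
    by clear; rewrite expr2; lra.
  have [u0|u0] := eqVneq u 0.
    have : 0 <= Ct * rho ^+ 2 by rewrite mulr_ge0// (le_trans _ C4).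
    apply: le_trans; move: hf f0; rewrite u0 normr0 !mulr0 add0r => hf hf0.
    have -> : M * rho ^+ 2 * `|w| = 0 by apply/eqP; rewrite eq_le hf hf0.
    by rewrite expr0n mulr0.
  have un : 0 < `|u| by rewrite normr_gt0.
  have L0 : 0 < `|u| / 2 by rewrite divr_gt0.
  have k1b : k1 <= Ca * (r / (r * M * (`|u| / 2)) ^+ 2).
    apply: hCa => //.
      by rewrite mul1r; apply: le_trans wu; rewrite ler_wpM2l.
    move=> s /andP[sa sb]; apply: (psi_ge_half (ltW C30) hlip h1 h5 ucase).
    by rewrite (le_trans s1a)// (le_trans sb).
  apply: (@le_trans _ _ (Ca * (r / (r * M * (`|u| / 2)) ^+ 2) * (2 * r) * (2 * M * rho * `|u|) ^+ 2)).
    apply: ler_pM => //; first by rewrite mulr_ge0.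
    - exact: sqr_ge0.
    - exact: ler_pM.
    - by apply: lerXn2r; rewrite ?nnegrE// !mulr_ge0// ltW.
  have -> : Ca * (r / (r * M * (`|u| / 2)) ^+ 2) * (2 * r) * (2 * M * rho * `|u|) ^+ 2 = 32 * Ca * rho ^+ 2.
    by clear -M0 rr un; field; rewrite !gt_eqF.
  exact: ler_wpM2r.
have wn : 0 < `|w|.
  rewrite lt_neqAle w0 andbT; apply/eqP => hw; move: ucase; rewrite -hw mulr0 mul0r.
  by rewrite ltNge normr_ge0.
have hf : M * rho * `|u| + M * rho ^+ 2 * `|w| <= (2 * C3 + 1) * M * rho ^+ 2 * `|w|.
  have : M * rho * `|u| <= M * rho * (2 * C3 * `|w| * rho).
    by rewrite ler_wpM2l ?mulr_ge0// ltW.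
  by clear; rewrite expr2; lra.
have [t [ht hpsi]] := hz z w.
have far si : 1 <= si - r -> si + r <= 5 -> 3 / 2 * r <= `|si - t| ->
   `|ker p M si r z w| <= Cb * (r / (r * M * (c * `|w| * (r / 2))) ^+ 2).
  move=> sia sib sit; apply: hCb => //.
  - by apply: mulr_gt0; [exact: mulr_gt0|exact: divr_gt0].
  - have -> : 2 / c * (c * `|w| * (r / 2)) = `|w| * r by clear -c0; field; rewrite gt_eqF.
    exact: lexx.
  move=> s /andP[sa sb].
  apply: le_trans (hpsi s _); last by rewrite (le_trans sia)// (le_trans sb).
  apply: ler_wpM2l; first by rewrite mulr_ge0// ltW.
  have : `|si - s| <= r by rewrite ler_norml; apply/andP; split; move: sa sb; clear; lra.
  have := ler_normD (si - s) (s - t); rewrite addrA subrK; move: sit; clear; lra.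
have hk : k1 * k2 <= Cb * (r / (r * M * (c * `|w| * (r / 2))) ^+ 2) * (2 * r).
  have [h|h] := leP (3 / 2 * r) `|s1 - t|.
    by apply: ler_pM => //; exact: far.
  rewrite mulrC; apply: ler_pM => //; apply: far => //.
  have := ler_normB (s1 - t) (s2 - t); rewrite opprB addrA subrK.
  by move: hs12 h; clear; lra.
apply: (@le_trans _ _ (Cb * (r / (r * M * (c * `|w| * (r / 2))) ^+ 2) * (2 * r) * ((2 * C3 + 1) * M * rho ^+ 2 * `|w|) ^+ 2)).
  apply: ler_pM => //; first by rewrite mulr_ge0.
  - exact: sqr_ge0.
  - by apply: lerXn2r; rewrite ?nnegrE// (le_trans f0).
have -> : Cb * (r / (r * M * (c * `|w| * (r / 2))) ^+ 2) * (2 * r) * ((2 * C3 + 1) * M * rho ^+ 2 * `|w|) ^+ 2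
   = Cm * rho ^+ 2.
  by rewrite /Cm rE; clear -M0 rr wn c0; field; rewrite !gt_eqF.
exact: ler_wpM2r.
Qed.

End KernelBounds.

(** * Decay of the kernel of a whole block *)

Section VanDerCorput.
Variables (R : realType) (p : R).
Implicit Types (M z w s lam : R).

(* The error term [(sin theta - e) psi' / (M psi^2)], [e = 1] or [-1], has a
   constant sign, so only boundary terms survive. *)
Lemma first_derivative_test M z w a b lam : 1 < p -> 0 < M -> 1 <= a -> a <= b -> b <= 5 ->
  0 < lam -> (forall s, a <= s <= b -> lam <= `|psi p z w s|) ->
  `|intg a b (fun s => cos (theta p M z w s))| <= 4 / (M * lam).
Proof.
move=> p1 M0 a1 ab b5 lam0 hpsi.
pose P s := psi p z w s.
pose P1 s := p * (p - 1) * w * s `^ (p - 2).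
pose th := theta p M z w.
have Pn0 s : a <= s <= b -> P s != 0.
  by move=> hs; rewrite -normr_gt0 (lt_le_trans lam0)// hpsi.
have sub f : contI 1 5 f -> contI a b f by apply: contI_sub.
have cc : contI a b (fun s => cos (th s)) by apply: sub; exact: contI_costheta.
pose E e s := (sin (th s) - e) * P1 s * (M * P s ^+ 2)^-1.
have cE e : contI a b (E e).
  apply: contIM; last first.
    apply: contI_inv.
      apply: contIM; first exact: contI_cst.
      by apply: contIX; apply: sub; exact: contI_psi.
    by move=> s /Pn0 h; rewrite mulf_neq0 ?expf_neq0// gt_eqF.
  apply: contIM.
    by apply: contIB; [apply: sub; exact: contI_sintheta|exact: contI_cst].
  by apply: sub; apply: contIM; [exact: contI_cst|exact: contI_powR].
pose F e s := (sin (th s) - e) * (M * P s)^-1.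
have dF e s : a <= s <= b -> is_derive s (1:R) (F e) (cos (th s) + - E e s).
  move=> hs; have s_gt0 : 0 < s by move: hs => /andP[? _]; lra.
  have Ps := Pn0 _ hs.
  have dP : is_derive s (1:R) P (P1 s) by exact: is_derive_psi.
  have dth : is_derive s (1:R) th (M * P s) by exact: is_derive_theta.
  have dI1 : is_derive s (1:R) (fun s => (M * P s)^-1) (- P1 s / (M * P s ^+ 2)).
    have n0 : M * P s != 0 by rewrite mulf_neq0// gt_eqF.
    have dMP : is_derive s (1:R) (fun s => M * P s) (M * P1 s).
      by apply: is_derive_eq; rewrite /GRing.scale/=; ring.
    have := @is_deriveV _ (fun s => M * P s) _ _ _ n0 dMP; congr (is_derive _ _ _ _).
    by rewrite /GRing.scale/=; field; rewrite Ps gt_eqF.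
  rewrite /F; apply: is_derive_eq; rewrite /GRing.scale/= /E.
  by field; rewrite Ps gt_eqF.
have key e : intg a b (fun s => cos (th s)) = F e b - F e a + intg a b (E e).
  have cD : contI a b (fun s => cos (th s) + - E e s) by apply: contID cc (contIN (cE e)).
  rewrite -(FTC ab cD (dF e)) -(intgD cD (cE e)).
  by apply: eq_intg => s _; rewrite addrNK.
have Fb e s : `|e| <= 1 -> a <= s <= b -> `|F e s| <= 2 / (M * lam).
  move=> e1 hs; rewrite /F normrM normfV normrM (gtr0_norm M0).
  apply: ler_pM => //; rewrite ?invr_ge0.
  - by rewrite mulr_ge0// ltW.
  - apply: (le_trans (ler_normB _ _)).
    have : `|sin (th s)| <= 1 by rewrite ler_norml sin_geN1 sin_le1.
    lra.
  - by rewrite lef_pV2 ?posrE ?mulr_gt0 ?normr_gt0 ?Pn0// ler_pM2l// hpsi.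
have Fd e : `|e| <= 1 -> `|F e b - F e a| <= 4 / (M * lam).
  move=> e1; apply: (le_trans (ler_normB _ _)).
  have hb : `|F e b| <= 2 / (M * lam) by apply: Fb => //; rewrite ab lexx.
  have ha : `|F e a| <= 2 / (M * lam) by apply: Fb => //; rewrite ab lexx.
  lra.
have Pc s : a <= s <= b -> 0 <= p * (p - 1) * s `^ (p - 2) * (M * P s ^+ 2)^-1.
  move=> hs; rewrite !mulr_ge0// ?powR_ge0//; try lra.
  by rewrite invr_ge0 mulr_ge0 ?sqr_ge0// ltW.
have EE e s : E e s = (sin (th s) - e) * w * (p * (p - 1) * s `^ (p - 2) * (M * P s ^+ 2)^-1).
  by rewrite /E /P1; ring.
have Elow e : (forall s, 0 <= (sin (th s) - e) * w) -> 0 <= intg a b (E e).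
  by move=> h; apply: intg_ge0 => s hs; rewrite EE mulr_ge0// Pc.
have Ehigh e : (forall s, (sin (th s) - e) * w <= 0) -> intg a b (E e) <= 0.
  move=> h; have -> : 0 = intg a b (fun _ => 0 * 0) by rewrite intgZ ?mul0r//; exact: contI_cst.
  apply: le_intg => //; first exact: contI_cst.
  by move=> s hs; rewrite EE mulr0 mulr_le0_ge0// Pc.
have s1 s : sin (th s) - 1 <= 0 by rewrite subr_le0 sin_le1.
have s2 s : 0 <= sin (th s) - - 1 by rewrite subr_ge0 sin_geN1.
have n1 : `|1 : R| <= 1 by rewrite normr1.
have nN1 : `|- 1 : R| <= 1 by rewrite normrN normr1.
have := Fd _ n1; have := Fd _ nN1; rewrite !ler_norml => /andP[f1 f2] /andP[f3 f4].
(* The sign of the error is that of [(sin theta - e) w], so [e = 1] and [e = -1] give one side of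
   the bound each; the sign of [w] decides which. *)
have [w0|w0] := leP 0 w.
  apply/andP; split.
    have := Elow (-1) (fun s => mulr_ge0 (s2 s) w0); rewrite (key (-1)); lra.
  have := Ehigh 1 (fun s => mulr_le0_ge0 (s1 s) w0); rewrite (key 1); lra.
apply/andP; split.
  have := Elow 1 (fun s => mulr_le0 (s1 s) (ltW w0)); rewrite (key 1); lra.
have := Ehigh (-1) (fun s => mulr_ge0_le0 (s2 s) (ltW w0)); rewrite (key (-1)); lra.
Qed.

(** Squaring avoids a square root in the statement. If [|z| > B |w|], then [|psi| >= |z| / 2], and
    the first derivative test times the trivial bound for the integral gives [1 / (M |z|)].
    Otherwise [psi] grows at rate [c |w|] away from [t]: the neighbourhood of radius [eta] is
    bounded by its length and the rest by the first derivative test, which balance at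
    [eta = (M |w|)^(-1/2)]. *)
Lemma van_der_corput : 1 < p -> exists2 C : R, 0 < C & forall M z w a b,
  0 < M -> 1 <= a -> a <= b -> b <= 5 ->
  intg a b (fun s => cos (theta p M z w s)) ^+ 2 * (M * (`|z| + `|w|)) <= C.
Proof.
move=> p1; have [c c0 hz] := psi_zero p1.
pose B := 2 * (p * pw5 (p - 1)).
have B0 : 0 < B.
  by have := pw5_gt0 (p - 1); rewrite /B => ?; rewrite !mulr_gt0//; lra.
pose A := 2 + 8 / c.
have A0 : 0 < A by rewrite addr_gt0// divr_gt0.
have B1 : 0 < 1 + B^-1 by rewrite addr_gt0// invr_gt0.
have B2 : 0 < 1 + B by rewrite addr_gt0.
have AB : 0 < A ^+ 2 * (1 + B) by rewrite mulr_gt0// exprn_gt0.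
have B32 : 0 < 32 * (1 + B^-1) by rewrite mulr_gt0.
exists (32 * (1 + B^-1) + A ^+ 2 * (1 + B)); first exact: addr_gt0.
move=> M z w a b M0 a1 ab b5; set I := intg _ _ _.
have cc : contI a b (fun s => cos (theta p M z w s)).
  by apply: (@contI_sub _ 1 5) => //; exact: contI_costheta.
have cos1 s : `|cos (theta p M z w s)| <= 1 by rewrite ler_norml cos_geN1 cos_le1.
have [zw|zw] := leP `|z| (B * `|w|); last first.
  have z0 : 0 < `|z| by apply: le_lt_trans zw; rewrite mulr_ge0// ltW.
  have L0 : 0 < `|z| / 2 by lra.
  have h1 : `|I| <= 4 / (M * (`|z| / 2)).
    apply: first_derivative_test => // s /andP[sa sb].
    have hs : 1 <= s <= 5 by apply/andP; split; lra.
    have := powR_bounds (p - 1) hs => /andP[_ h].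
    have := ler_normB (psi p z w s) (p * w * s `^ (p - 1)); rewrite {1}/psi addrK.
    have : `|p * w * s `^ (p - 1)| <= B / 2 * `|w|.
      rewrite !normrM (gtr0_norm (_ : 0 < p)); last lra.
      rewrite (ger0_norm (powR_ge0 _ _)) /B mulrAC.
      have -> : 2 * (p * pw5 (p - 1)) / 2 = p * pw5 (p - 1) by field.
      rewrite ler_wpM2r// ler_wpM2l//; lra.
    lra.
  have h2 : `|I| <= 4.
    have : `|I| <= 1 * (b - a) by apply: intg_abs_le.
    lra.
  have : `|I| * `|I| <= 4 / (M * (`|z| / 2)) * 4 by apply: ler_pM.
  rewrite -expr2 real_normK ?num_real// => h.
  have zw' : `|z| + `|w| <= (1 + B^-1) * `|z|.
    by rewrite mulrDl mul1r lerD2l mulrC ler_pdivlMr// mulrC ltW.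
  apply: (@le_trans _ _ (4 / (M * (`|z| / 2)) * 4 * (M * ((1 + B^-1) * `|z|)))).
    apply: ler_pM => //; first exact: sqr_ge0.
      by rewrite mulr_ge0 ?addr_ge0// ltW.
    by rewrite ler_pM2l.
  have -> : 4 / (M * (`|z| / 2)) * 4 * (M * ((1 + B^-1) * `|z|)) = 32 * (1 + B^-1).
    by field; rewrite !gt_eqF.
  by rewrite lerDl ltW.
have [w0|w0] := eqVneq w 0.
  move: zw; rewrite w0 normr0 mulr0 normr_le0 => /eqP ->.
  by rewrite normr0 addr0 !mulr0 addr_ge0// ltW.
have wn : 0 < `|w| by rewrite normr_gt0.
have Mw : 0 < M * `|w| by rewrite mulr_gt0.
have [t [ht hpsi]] := hz z w.
pose eta := Num.sqrt (M * `|w|)^-1.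
have eta0 : 0 < eta by rewrite sqrtr_gt0 invr_gt0.
have eta2 : eta ^+ 2 = (M * `|w|)^-1 by rewrite sqr_sqrtr// invr_ge0 ltW.
(* The points [t - eta] and [t + eta] clamped to [[a, b]]; an outer piece that degenerates to a
   point contributes zero. *)
pose l := Num.max a (Num.min b (t - eta)).
pose h := Num.max a (Num.min b (t + eta)).
have al : a <= l by rewrite le_max lexx.
have lh : l <= h.
  by rewrite /l /h ge_max !le_max lexx/= le_min !ge_min lexx/= (_ : t - eta <= t + eta) ?orbT//; lra.
have hb : h <= b by rewrite ge_max ab ge_min lexx.
have hl2 : h - l <= 2 * eta.
  suff : h <= l + 2 * eta by lra.
  rewrite /h ge_max; apply/andP; split; first lra.
  have ll : Num.min b (t - eta) <= l by rewrite le_max lexx orbT.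
  have [bt|bt] := leP b (t - eta).
    by rewrite (min_l bt) in ll; rewrite ge_min; apply/orP; left; lra.
  by rewrite (min_r (ltW bt)) in ll; rewrite ge_min; apply/orP; right; lra.
have lam0 : 0 < c * `|w| * eta by rewrite !mulr_gt0.
have b1 : `|intg a l (fun s => cos (theta p M z w s))| <= 4 / (M * (c * `|w| * eta)).
  have [<-|nal] := eqVneq a l.
    rewrite /intg set_itv1 Rintegral_set1 normr0 divr_ge0// mulr_ge0// ltW//.
  have alt : a < l by rewrite lt_neqAle nal.
  have lt : l <= t - eta.
    by move: alt; rewrite {1}/l lt_max ltxx/= lt_min => /andP[_ at_]; rewrite ge_max (ltW at_) ge_min lexx orbT.
  apply: first_derivative_test => //; first exact: le_trans (le_trans lh hb) b5.
  move=> s /andP[sa sb]; apply: le_trans (hpsi s _); last first.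
    by clear -a1 b5 lh hb sa sb; apply/andP; split; lra.
  by rewrite ler_pM2l ?mulr_gt0// ler_normr; apply/orP; right; clear -lt sb; lra.
have b2 : `|intg h b (fun s => cos (theta p M z w s))| <= 4 / (M * (c * `|w| * eta)).
  have [<-|nal] := eqVneq h b.
    rewrite /intg set_itv1 Rintegral_set1 normr0 divr_ge0// mulr_ge0// ltW//.
  have alt : h < b by rewrite lt_neqAle nal.
  have lt : t + eta <= h.
    move: alt; rewrite {1}/h gt_max gt_min ltxx/= => /andP[_ at_].
    by rewrite le_max le_min lexx (ltW at_) orbT.
  apply: first_derivative_test => //; first exact: le_trans a1 (le_trans al lh).
  move=> s /andP[sa sb]; apply: le_trans (hpsi s _); last first.
    by clear -a1 b5 al lh sa sb; apply/andP; split; lra.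
  by rewrite ler_pM2l ?mulr_gt0// ler_normr; apply/orP; left; clear -lt sa; lra.
have b3 : `|intg l h (fun s => cos (theta p M z w s))| <= 2 * eta.
  apply: (@le_trans _ _ (1 * (h - l))); last lra.
  by apply: intg_abs_le => //; apply: contI_sub cc.
have IE : I = intg a l (fun s => cos (theta p M z w s)) +
   (intg l h (fun s => cos (theta p M z w s)) + intg h b (fun s => cos (theta p M z w s))).
  rewrite /I (@intg_split _ _ _ _ l)//; last by rewrite al (le_trans lh).
  rewrite (@intg_split _ l b _ h)//; first by rewrite lh hb.
  exact: contI_sub cc.
have eE : 4 / (M * (c * `|w| * eta)) = 4 / c * eta.
  have e0 : eta != 0 by rewrite gt_eqF.
  have -> : M * (c * `|w| * eta) = c * (M * `|w|) * eta by ring.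
  have -> : M * `|w| = (eta ^+ 2)^-1 by rewrite eta2 invrK.
  by field; rewrite e0 gt_eqF.
have IA : `|I| <= A * eta.
  rewrite IE; apply: (le_trans (ler_normD _ _)).
  apply: (le_trans (lerD b1 (ler_normD _ _))).
  rewrite /A; move: b1 b2 b3; rewrite eE; clear; lra.
have I2 : I ^+ 2 <= A ^+ 2 * (M * `|w|)^-1.
  rewrite -eta2 -exprMn -[leLHS]real_normK ?num_real//.
  by apply: lerXn2r => //; rewrite nnegrE// mulr_ge0// ltW.
have zw' : `|z| + `|w| <= (1 + B) * `|w| by rewrite mulrDl mul1r addrC lerD2l.
apply: (@le_trans _ _ (A ^+ 2 * (M * `|w|)^-1 * (M * ((1 + B) * `|w|)))).
  apply: ler_pM => //; first exact: sqr_ge0.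
    by rewrite mulr_ge0 ?addr_ge0// ltW.
  by rewrite ler_pM2l.
have -> : A ^+ 2 * (M * `|w|)^-1 * (M * ((1 + B) * `|w|)) = A ^+ 2 * (1 + B).
  by field; rewrite !gt_eqF.
by rewrite lerDr ltW.
Qed.

End VanDerCorput.

(** * Quadratic forms with positive kernels *)

Lemma le_of_eq (R : realType) (x y : R) : x = y -> x <= y.
Proof. by move=> ->. Qed.

Section FeatureForms.
Variables (R : realType) (Y : finType).
Implicit Types (nu g h : Y -> R) (om : R -> R).

Definition nrm nu g : R := \sum_y nu y * g y ^+ 2.

Definition pairing nu g h : R := \sum_y nu y * (g y * h y).

Definition bilform nu (k : Y -> Y -> R) g h : R :=
  \sum_y \sum_y' nu y * nu y' * (g y * h y') * k y y'.

Definition kmul nu (k : Y -> Y -> R) h y : R := \sum_y' nu y' * (k y y' * h y').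

Lemma pairing_nrm nu g : pairing nu g g = nrm nu g.
Proof. by apply: eq_bigr => y _; rewrite expr2. Qed.

Lemma pairingC nu g h : pairing nu g h = pairing nu h g.
Proof. by apply: eq_bigr => y _; rewrite (mulrC (g y)). Qed.

Lemma nrm_ge0 nu g : (forall y, 0 <= nu y) -> 0 <= nrm nu g.
Proof. by move=> nu0; apply: sumr_ge0 => y _; rewrite mulr_ge0// sqr_ge0. Qed.

Lemma bilform_kmul nu k g h : bilform nu k g h = pairing nu g (kmul nu k h).
Proof.
apply: eq_bigr => y _; rewrite /kmul !mulr_sumr; apply: eq_bigr => y' _; ring.
Qed.

Lemma pairing_sum (I : finType) nu g (H : I -> Y -> R) :
  pairing nu g (fun y => \sum_i H i y) = \sum_i pairing nu g (H i).
Proof.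
rewrite exchange_big/=; apply: eq_bigr => y _.
by rewrite !mulr_sumr.
Qed.

Lemma discriminant_le (a b c : R) : 0 <= a ->
  (forall t, 0 <= a * t ^+ 2 + 2 * b * t + c) -> b ^+ 2 <= a * c.
Proof.
move=> a0 h; have [a00|an] := eqVneq a 0.
  rewrite a00 mul0r; have [->|bn] := eqVneq b 0; first by rewrite expr0n.
  have := h (- (c + 1) / (2 * b)); rewrite a00.
  have -> : 0 * (- (c + 1) / (2 * b)) ^+ 2 + 2 * b * (- (c + 1) / (2 * b)) + c = - 1 by field.
  lra.
have ap : 0 < a by rewrite lt_neqAle eq_sym an.
have := h (- b / a).
have -> : a * (- b / a) ^+ 2 + 2 * b * (- b / a) + c = (a * c - b ^+ 2) / a by field.
by rewrite pmulr_lge0 ?invr_gt0// subr_ge0.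
Qed.

Lemma pairing_cs nu g h : (forall y, 0 <= nu y) ->
  pairing nu g h ^+ 2 <= nrm nu g * nrm nu h.
Proof.
move=> nu0; apply: discriminant_le; first exact: nrm_ge0.
move=> t; rewrite (_ : _ + _ = nrm nu (fun y => g y * t + h y)); first exact: nrm_ge0.
rewrite /nrm /pairing !mulr_suml mulr_sumr mulr_suml -!big_split/=.
by apply: eq_bigr => y _; ring.
Qed.

Variables (lo hi : R) (C S : Y -> R -> R).
Hypothesis cC : forall y, contI lo hi (C y).
Hypothesis cS : forall y, contI lo hi (S y).

(** The Gram matrix of the curves [s -> (C y s, S y s)] in [L^2(om ds)]. With cosines and sines of
    the phases it is the kernel of [T T*] in real form, [T] being integration of exponentials over
    the arc; its positivity is used throughout. *)
Definition featk om y y' : R :=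
  intg lo hi (fun s => om s * (C y s * C y' s + S y s * S y' s)).

Let T nu (F : Y -> R -> R) g s : R := \sum_y nu y * (g y * F y s).

Let cT nu F g : (forall y, contI lo hi (F y)) -> contI lo hi (T nu F g).
Proof.
move=> cF; apply: contI_sum => y; apply: contIM; first exact: contI_cst.
by apply: contIM => //; exact: contI_cst.
Qed.

Lemma featk_sym om y y' : featk om y y' = featk om y' y.
Proof. by apply: eq_intg => s _; rewrite (mulrC (C y s)) (mulrC (S y s)). Qed.

Lemma bilform_featk nu om g h : contI lo hi om ->
  bilform nu (featk om) g h =
  intg lo hi (fun s => om s * (T nu C g s * T nu C h s + T nu S g s * T nu S h s)).
Proof.
move=> com.
have c1 y y' : contI lo hi (fun s => om s * (C y s * C y' s + S y s * S y' s)).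
  by apply: contIM => //; apply: contID; exact: contIM.
have c2 y y' : contI lo hi (fun s => nu y * nu y' * (g y * h y') * (om s * (C y s * C y' s + S y s * S y' s))).
  by apply: contIM => //; exact: contI_cst.
rewrite /bilform; under eq_bigr => y _ do (under eq_bigr => y' _ do rewrite -intgZ//; rewrite -intg_sum//).
rewrite -intg_sum; last by move=> y; exact: contI_sum.
apply: eq_intg => s _; rewrite /T !mulr_suml -big_split/= mulr_sumr.
apply: eq_bigr => y _; rewrite !mulr_sumr -big_split/= mulr_sumr.
apply: eq_bigr => y' _; ring.
Qed.

Lemma featk_ge0 nu om g : contI lo hi om -> (forall s, 0 <= om s) ->
  0 <= bilform nu (featk om) g g.
Proof.
move=> com om0; rewrite bilform_featk//; apply: intg_ge0 => s _.
by rewrite mulr_ge0// addr_ge0// -expr2 sqr_ge0.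
Qed.

Lemma featk_cs nu om g h : contI lo hi om -> (forall s, 0 <= om s) ->
  bilform nu (featk om) g h ^+ 2 <=
  bilform nu (featk om) g g * bilform nu (featk om) h h.
Proof.
move=> com om0; apply: discriminant_le; first exact: featk_ge0.
move=> t; rewrite (_ : _ + _ = bilform nu (featk om) (fun y => g y * t + h y) (fun y => g y * t + h y)).
  exact: featk_ge0.
have sym : bilform nu (featk om) g h = bilform nu (featk om) h g.
  rewrite /bilform exchange_big/=; apply: eq_bigr => y _; apply: eq_bigr => y' _.
  by rewrite featk_sym; ring.
have -> : 2 * bilform nu (featk om) g h * t = bilform nu (featk om) g h * t + bilform nu (featk om) h g * t.
  by rewrite -sym; ring.
rewrite /bilform !mulr_suml -!big_split/=; apply: eq_bigr => y _.
rewrite !mulr_suml -!big_split/=; apply: eq_bigr => y' _; ring.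
Qed.

(** A positive operator [T <= Q] satisfies [T^2 <= Q T]: apply Cauchy-Schwarz for the form of [T] to
    [T g] and [g]. *)
Lemma kmul_nrm_le nu om (Q : R) g : contI lo hi om -> (forall s, 0 <= om s) ->
  (forall y, 0 <= nu y) -> 0 <= Q ->
  (forall h, bilform nu (featk om) h h <= Q * nrm nu h) ->
  nrm nu (kmul nu (featk om) g) <= Q * bilform nu (featk om) g g.
Proof.
move=> com om0 nu0 Q0 hQ; set h := kmul _ _ _.
have q0 := featk_ge0 nu g com om0.
have n0 := nrm_ge0 h nu0.
have E : bilform nu (featk om) h g = nrm nu h by rewrite bilform_kmul pairing_nrm.
have := featk_cs nu h g com om0; rewrite E => cs.
have : nrm nu h * nrm nu h <= nrm nu h * (Q * bilform nu (featk om) g g).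
  rewrite -expr2 (le_trans cs)// mulrA (mulrC _ Q); exact: ler_wpM2r.
have [h0|hn] := eqVneq (nrm nu h) 0; first by rewrite h0 mulr_ge0.
by rewrite ler_pM2l// lt_neqAle eq_sym hn.
Qed.

Definition corr nu (k1 k2 : Y -> Y -> R) : R :=
  \sum_y \sum_y' nu y * nu y' * (k1 y y' * k2 y y').

(* The trace of the product of two positive operators controls their interaction. *)
Lemma kmul_pairing_le nu om1 om2 g (L : R) : contI lo hi om1 -> contI lo hi om2 ->
  (forall s, 0 <= om1 s) -> (forall s, 0 <= om2 s) -> 0 < L ->
  corr nu (featk om1) (featk om2) <= L ^+ 2 ->
  2 * pairing nu (kmul nu (featk om1) g) (kmul nu (featk om2) g) <=
  L * (bilform nu (featk om1) g g + bilform nu (featk om2) g g).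
Proof.
move=> c1 c2 om10 om20 L0 hJ; set h := kmul nu (featk om2) g.
rewrite pairingC -bilform_kmul bilform_featk//.
set q2 := bilform nu (featk om2) g g.
have q20 : 0 <= q2 by exact: featk_ge0.
(* Cauchy-Schwarz for the form of [om2] bounds the square of the synthesis of [h] at [s] by [q2]
   times that form at the feature vectors of [s]. The integral of [W] against [om1] is the trace
   [corr], so the weighted arithmetic-geometric inequality with parameter [L] leaves [L] in front of
   both forms. *)
pose W s := bilform nu (featk om2) (fun y => C y s) (fun y => C y s) +
            bilform nu (featk om2) (fun y => S y s) (fun y => S y s).
have key F s : T nu F h s ^+ 2 <= bilform nu (featk om2) (fun y => F y s) (fun y => F y s) * q2.
  have -> : T nu F h s = bilform nu (featk om2) (fun y => F y s) g.
    rewrite bilform_kmul; apply: eq_bigr => y _; rewrite (mulrC (h y))//.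
  exact: featk_cs.
have cW : contI lo hi W.
  have cq F : (forall y, contI lo hi (F y)) ->
      contI lo hi (fun s => bilform nu (featk om2) (fun y => F y s) (fun y => F y s)).
    move=> cF; do 2 (apply: contI_sum => ?); apply: contIM; last exact: contI_cst.
    by apply: contIM; [exact: contI_cst|exact: contIM].
  by apply: contID; exact: cq.
have WJ : intg lo hi (fun s => om1 s * W s) = corr nu (featk om1) (featk om2).
  have cc y y' : contI lo hi (fun s => om1 s * (C y s * C y' s + S y s * S y' s)).
    by apply: contIM => //; apply: contID; exact: contIM.
  have cc2 y y' : contI lo hi (fun s => nu y * nu y' * featk om2 y y' * (om1 s * (C y s * C y' s + S y s * S y' s))).
    by apply: contIM => //; exact: contI_cst.
  have -> : corr nu (featk om1) (featk om2) = \sum_y \sum_y' (nu y * nu y' * featk om2 y y') * featk om1 y y'.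
    by apply: eq_bigr => y _; apply: eq_bigr => y' _; ring.
  under [RHS]eq_bigr => y _ do (under eq_bigr => y' _ do rewrite -intgZ//; rewrite -intg_sum//).
  rewrite -intg_sum; last by move=> y; exact: contI_sum.
  apply: eq_intg => s _; rewrite /W -big_split/= mulr_sumr; apply: eq_bigr => y _.
  rewrite -big_split/= mulr_sumr; apply: eq_bigr => y' _; ring.
have cTC : contI lo hi (T nu C g) := cT cC.
have cTS : contI lo hi (T nu S g) := cT cS.
have cHC : contI lo hi (T nu C h) := cT cC.
have cHS : contI lo hi (T nu S h) := cT cS.
have ineq : 2 * intg lo hi (fun s => om1 s * (T nu C h s * T nu C g s + T nu S h s * T nu S g s)) <=
   intg lo hi (fun s => L * (om1 s * (T nu C g s * T nu C g s + T nu S g s * T nu S g s)) + q2 / L * (om1 s * W s)).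
  rewrite -intgZ; last by apply: contIM => //; apply: contID; exact: contIM.
  apply: le_intg.
  - by apply: contIM; [exact: contI_cst|apply: contIM => //; apply: contID; exact: contIM].
  - apply: contID; last by apply: contIM; [exact: contI_cst|exact: contIM].
    apply: contIM; first exact: contI_cst.
    by apply: contIM => //; apply: contID; exact: contIM.
  move=> s _.
  have amgm u v (V : R) : v ^+ 2 <= V * q2 -> 2 * (v * u) <= L * (u * u) + q2 / L * V.
    move=> hv; have h1 : 2 * (v * u) <= L * (u * u) + v ^+ 2 / L.
      have : 0 <= (L * u - v) ^+ 2 / L by rewrite divr_ge0 ?sqr_ge0 ?ltW.
      have -> : (L * u - v) ^+ 2 / L = L * (u * u) + v ^+ 2 / L - 2 * (v * u).
        by field; rewrite gt_eqF.
      lra.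
    apply: (le_trans h1); rewrite lerD2l (_ : q2 / L * V = V * q2 / L); last by ring.
    by rewrite ler_wpM2r// invr_ge0 ltW.
  have a1 := amgm (T nu C g s) _ _ (key C s).
  have a2 := amgm (T nu S g s) _ _ (key S s).
  have := ler_wpM2l (om10 s) (lerD a1 a2).
  rewrite -/(W s) => H; apply: le_trans (le_trans H _).
    by apply: le_of_eq; ring.
  by apply: le_of_eq; rewrite /W; ring.
apply: (le_trans ineq).
rewrite intgD; last 2 first.
- by apply: contIM; [exact: contI_cst|apply: contIM => //; apply: contID; exact: contIM].
- by apply: contIM; [exact: contI_cst|exact: contIM].
rewrite intgZ; last by apply: contIM => //; apply: contID; exact: contIM.
rewrite intgZ; last exact: contIM.
rewrite WJ -bilform_featk// mulrDr lerD2l.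
apply: (@le_trans _ _ (q2 / L * L ^+ 2)); first by rewrite ler_wpM2l// divr_ge0// ltW.
by apply: le_of_eq; field; rewrite gt_eqF.
Qed.

(** With [T_i] the operators of the pieces, the sum [q] of their forms at [g] is [<g, sum T_i g>].
    Expand [|sum T_i g|^2]: near pairs are bounded through [T_i^2 <= Q T_i], far pairs through the
    trace, so it is at most a constant times [q]. Cauchy-Schwarz gives [q^2 <= |g|^2 |sum T_i g|^2],
    and one factor [q] cancels. *)
Lemma broad_narrow nu m (om : 'I_m -> R -> R) (near : rel 'I_m) (n : nat) (Q L : R) :
  (forall i, contI lo hi (om i)) -> (forall i s, 0 <= om i s) -> (forall y, 0 <= nu y) ->
  0 <= Q -> 0 < L -> symmetric near -> (forall i, (#|near i| <= n)%N) ->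
  (forall i h, bilform nu (featk (om i)) h h <= Q * nrm nu h) ->
  (forall i j, ~~ near i j -> corr nu (featk (om i)) (featk (om j)) <= L ^+ 2) ->
  forall g, \sum_i bilform nu (featk (om i)) g g <= (n%:R * Q + m%:R * L) * nrm nu g.
Proof.
move=> com om0 nu0 Q0 L0 nsym ncard hQ hJ g.
pose q i := bilform nu (featk (om i)) g g.
pose H i := kmul nu (featk (om i)) g.
pose q_tot := \sum_i q i.
have q0 i : 0 <= q i by exact: featk_ge0.
have qt0 : 0 <= q_tot by apply: sumr_ge0.
have E : q_tot = pairing nu g (fun y => \sum_i H i y).
  by rewrite pairing_sum; apply: eq_bigr => i _; rewrite /q bilform_kmul.
have N : nrm nu (fun y => \sum_i H i y) = \sum_i \sum_j pairing nu (H i) (H j).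
  rewrite -pairing_nrm pairing_sum.
  by apply: eq_bigr => i _; rewrite pairingC pairing_sum.
have Hle i : nrm nu (H i) <= Q * q i by exact: kmul_nrm_le.
have amgm i j : 2 * pairing nu (H i) (H j) <= nrm nu (H i) + nrm nu (H j).
  rewrite /pairing /nrm mulr_sumr -big_split/=; apply: ler_sum => y _.
  have := mulr_ge0 (nu0 y) (sqr_ge0 (H i y - H j y)); lra.
have B : nrm nu (fun y => \sum_i H i y) <= (n%:R * Q + m%:R * L) * q_tot.
  rewrite N -(ler_pM2l (_ : 0 < 2))// mulr_sumr.
  apply: (@le_trans _ _ (\sum_i \sum_j ((if near i j then Q * q i + Q * q j else 0) + L * (q i + q j)))).
    apply: ler_sum => i _; rewrite mulr_sumr; apply: ler_sum => j _.
    have Lq : 0 <= L * (q i + q j) by rewrite mulr_ge0 ?addr_ge0// ltW.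
    case: ifPn => nij; last by rewrite add0r; apply: kmul_pairing_le => //; exact: hJ.
    apply: (le_trans (amgm i j)); have := Hle i; have := Hle j; lra.
  under eq_bigr do rewrite big_split/=; rewrite big_split/=.
  have -> : 2 * ((n%:R * Q + m%:R * L) * q_tot) =
     (n%:R * (Q * q_tot) + n%:R * (Q * q_tot)) + (m%:R * (L * q_tot) + m%:R * (L * q_tot)) by ring.
  apply: lerD.
    have half : \sum_i \sum_j (if near i j then Q * q i else 0) <= n%:R * (Q * q_tot).
      rewrite /q_tot !mulr_sumr; apply: ler_sum => i _.
      rewrite -big_mkcond/= sumr_const -[leLHS]mulr_natl ler_wpM2r ?mulr_ge0// ler_nat.
      exact: ncard.
    have -> : \sum_i \sum_j (if near i j then Q * q i + Q * q j else 0) =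
       \sum_i \sum_j (if near i j then Q * q i else 0) + \sum_i \sum_j (if near i j then Q * q i else 0).
      rewrite [X in _ = _ + X]exchange_big/= -big_split/=; apply: eq_bigr => i _.
      rewrite -big_split/=; apply: eq_bigr => j _.
      by rewrite (nsym j i); case: ifP => // _; rewrite addr0.
    exact: lerD.
  have e1 : \sum_(i < m) \sum_(j < m) L * q i = m%:R * (L * q_tot).
    rewrite /q_tot !mulr_sumr; apply: eq_bigr => i _.
    by rewrite sumr_const card_ord -[LHS]mulr_natl.
  rewrite -{1}e1 -e1 [X in _ <= _ + X]exchange_big/= -big_split/=.
  apply: ler_sum => i _; rewrite -big_split/=; apply: ler_sum => j _.
  by rewrite mulrDr.
have := pairing_cs g (fun y => \sum_i H i y) nu0; rewrite -E => cs.
have : q_tot * q_tot <= q_tot * ((n%:R * Q + m%:R * L) * nrm nu g).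
  rewrite -expr2 (le_trans cs)//.
  have -> : q_tot * ((n%:R * Q + m%:R * L) * nrm nu g) = nrm nu g * ((n%:R * Q + m%:R * L) * q_tot) by ring.
  by rewrite ler_wpM2l// nrm_ge0.
have c0 : 0 <= n%:R * Q + m%:R * L by rewrite addr_ge0// mulr_ge0// ?ltW.
move=> qq; rewrite -[leLHS]/q_tot.
have [->|qn] := eqVneq q_tot 0; first by rewrite mulr_ge0// nrm_ge0.
by move: qq; rewrite ler_pM2l// lt_neqAle eq_sym qn.
Qed.

End FeatureForms.

(** * Weighted point sets and the scale induction *)

Lemma powR2_lt4 (R : realType) (alpha : R) : alpha < 2 -> 2 `^ alpha / 4 < 1.
Proof.
move=> al2; rewrite ltr_pdivrMr// mul1r.
have -> : (4:R) = 2 `^ 2 by rewrite (powR_mulrn 2)// expr2; lra.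
by rewrite /powR (_ : (2 == 0 :> R) = false) ?pnatr_eq0// ltr_expR ltr_pM2r// ln_gt0//; lra.
Qed.

Lemma layer_const_gt0 (R : realType) (alpha : R) : alpha < 2 -> 0 < 4 / (1 - 2 `^ alpha / 4).
Proof. by move=> al2; rewrite divr_gt0// subr_gt0 powR2_lt4. Qed.

Section WeightedSums.
Variables (R : realType) (Y : finType).
Implicit Types (nu : Y -> R).

Lemma sum_cover n (P : pred Y) (Q : 'I_n -> pred Y) nu : (forall y, 0 <= nu y) ->
  (forall y, P y -> exists i, Q i y) ->
  \sum_(y | P y) nu y <= \sum_(i < n) \sum_(y | Q i y) nu y.
Proof.
move=> nu0 PQ; rewrite big_mkcond/=.
under [leRHS]eq_bigr do rewrite big_mkcond/=.
rewrite exchange_big/=; apply: ler_sum => y _; case: ifPn => [/PQ [i Qi]|_].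
  rewrite (bigD1 i)//= Qi lerDl; apply: sumr_ge0 => j _.
  by case: ifP.
by apply: sumr_ge0 => j _; case: ifP.
Qed.

Lemma ler_sum_pred (P Q : pred Y) nu : (forall y, 0 <= nu y) -> (forall y, P y -> Q y) ->
  \sum_(y | P y) nu y <= \sum_(y | Q y) nu y.
Proof.
move=> nu0 PQ; rewrite big_mkcond [leRHS]big_mkcond/=; apply: ler_sum => y _.
by case: ifPn => [/PQ ->//|_]; case: ifP.
Qed.

Lemma geometric_sum_le (q : R) n : 0 <= q < 1 -> \sum_(i < n) q ^+ i <= (1 - q)^-1.
Proof.
move=> /andP[q0 q1]; rewrite -[leRHS]mul1r ler_pdivlMr; last lra.
have := subrX1 q n => h.
have -> : (\sum_(i < n) q ^+ i) * (1 - q) = 1 - q ^+ n by lra.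
by have := exprn_ge0 n q0; lra.
Qed.

(* Dyadic decomposition: if the mass of [f <= T] grows like T^alpha with
   alpha < 2, a weight decaying like [f^-2] has total mass O(1). *)
Lemma layer_sum nu (f kap : Y -> R) alpha Phi B :
  0 < alpha < 2 -> 0 <= Phi -> 0 <= B -> (forall y, 0 <= nu y) -> (forall y, 0 <= f y) ->
  (forall T, 1 <= T -> \sum_(y | f y <= T) nu y <= Phi * T `^ alpha) ->
  (forall y, kap y <= B) -> (forall y, kap y * f y ^+ 2 <= B) ->
  \sum_y nu y * kap y <= 4 / (1 - 2 `^ alpha / 4) * Phi * B.
Proof.
move=> /andP[al0 al2] Phi0 B0 nu0 f0 hf kB kfB.
pose q : R := 2 `^ alpha / 4.
have q0 : 0 <= q by rewrite divr_ge0 ?powR_ge0.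
have q1 : q < 1 by exact: powR2_lt4.
have [J hJ] : exists J : nat, forall y, f y <= 2 ^+ J.
  exists (Num.bound (\sum_y f y)) => y.
  apply: (@le_trans _ _ (\sum_y f y)).
    by rewrite (bigD1 y)//= lerDl sumr_ge0.
  apply: ltW; apply: lt_le_trans (archi_boundP _) _; first exact: sumr_ge0.
  by rewrite -natrX ler_nat ltnW// ltn_expl.
have pw (j : nat) : (2 ^+ j) `^ alpha / 4 ^+ j = q ^+ j.
  rewrite /q expr_div_n; congr (_ / _).
  by rewrite -(powR_mulrn j (powR_ge0 2 alpha)) -(powR_mulrn j (ler0n R 2)) powRAC.
(* Each [y] is charged to the least [j] with [f y <= 2^j]. For [j = i + 1] this means [f y > 2^i],
   hence [kap y <= B / 4^i]; the factor 4 in the layer weight pays for the shift from [i] to [j],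
   and covers [j = 0]. *)
apply: (@le_trans _ _ (\sum_(j < J.+1) (4 * B / 4 ^+ j) * \sum_(y | f y <= 2 ^+ j) nu y)).
  under [leRHS]eq_bigr do rewrite mulr_sumr big_mkcond/=.
  rewrite exchange_big/=; apply: ler_sum => y _.
  have hex : exists j, f y <= 2 ^+ j by exists J.
  pose j := ex_minn hex.
  have [fj jmin] : f y <= 2 ^+ j /\ forall i, f y <= 2 ^+ i -> (j <= i)%N.
    by rewrite /j; case: ex_minnP.
  have jJ : (j < J.+1)%N by rewrite ltnS jmin.
  rewrite (bigD1 (Ordinal jJ))//= fj.
  have rest : 0 <= \sum_(i < J.+1 | i != Ordinal jJ) (if f y <= 2 ^+ i then 4 * B / 4 ^+ i * nu y else 0).
    apply: sumr_ge0 => i _; case: ifP => // _.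
    by rewrite !mulr_ge0// invr_ge0 exprn_ge0.
  apply: le_trans (_ : 4 * B / 4 ^+ j * nu y <= _); last by rewrite lerDl.
  rewrite mulrC ler_wpM2r//.
  case: (posnP j) => [->|j0]; first by rewrite expr0 divr1; have := kB y; lra.
  have [i ji] : exists i, j = i.+1 by exists j.-1; rewrite prednK.
  have fi : 2 ^+ i < f y.
    by rewrite ltNge; apply/negP => /jmin; rewrite ji ltnn.
  rewrite ji exprS.
  have -> : 4 * B / (4 * 4 ^+ i) = B / 4 ^+ i by field; rewrite expf_neq0.
  rewrite ler_pdivlMr ?exprn_gt0//.
  have [k0|k0] := leP 0 (kap y).
    apply: le_trans (kfB y); rewrite ler_wpM2l//.
    have -> : (4:R) ^+ i = (2 ^+ i) ^+ 2 by rewrite exprAC; congr (_ ^+ i); lra.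
    by apply: lerXn2r; rewrite ?nnegrE ?exprn_ge0// ltW.
  by apply: le_trans B0; rewrite mulr_le0_ge0 ?exprn_ge0// ltW.
apply: (@le_trans _ _ (\sum_(j < J.+1) 4 * B * Phi * q ^+ j)).
  apply: ler_sum => j _; rewrite -pw.
  have h1 : 1 <= 2 ^+ j :> R by rewrite exprn_ege1//; lra.
  have -> : 4 * B * Phi * ((2 ^+ j) `^ alpha / 4 ^+ j) = 4 * B / 4 ^+ j * (Phi * (2 ^+ j) `^ alpha) by ring.
  by rewrite ler_wpM2l ?hf// !mulr_ge0// invr_ge0 exprn_ge0.
rewrite -mulr_sumr.
have -> : 4 / (1 - q) * Phi * B = 4 * B * Phi * (1 - q)^-1 by ring.
rewrite ler_wpM2l//; first by rewrite !mulr_ge0.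
by apply: geometric_sum_le; rewrite q0.
Qed.

(** A Frostman condition with constant 1, obtained by dividing [nu] by its constant, and required
    only at scales above [1 / M], where a discrete measure can satisfy it. *)
Definition spread M alpha (x w nu : Y -> R) := forall x0 w0 a, M^-1 <= a ->
  \sum_(y | (x0 <= x y <= x0 + a) && (w0 <= w y <= w0 + a)) nu y <= a `^ alpha.

(** Cutting the strip into slabs of width [a] in [x] leaves [c w] an interval of length [3 a] in
    each, hence [w] one no longer, as [c >= 1]. There are at most [3 L / a] slabs, each inside a
    square of side [3 a], and [3^alpha <= 9]; hence 27. *)
Lemma strip_le M alpha (x w nu : Y -> R) c x0 u0 a L : 0 < M -> 0 < alpha <= 2 -> 1 <= c ->
  M^-1 <= a -> a <= L -> (forall y, 0 <= nu y) -> spread M alpha x w nu ->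
  \sum_(y | (`|x y - x0| <= L) && (`|x y + c * w y - u0| <= a)) nu y <= 27 * (L / a) * a `^ alpha.
Proof.
move=> M0 /andP[al0 al2] c1 Ma aL nu0 hs.
have a0 : 0 < a by apply: lt_le_trans Ma; rewrite invr_gt0.
have L0 : 0 < L by lra.
have La : 1 <= L / a by rewrite ler_pdivlMr// mul1r.
pose n := (Num.truncn (2 * L / a)).+1.
pose xi (i : nat) := x0 - L + i%:R * a.
pose W i := (u0 - 2 * a - xi i) / c.
pose Q (i : 'I_n) y := (xi i <= x y <= xi i + 3 * a) && (W i <= w y <= W i + 3 * a).
have L2 : 0 <= 2 * L / a by rewrite divr_ge0 ?ltW// mulr_gt0.
apply: (@le_trans _ _ (\sum_(i < n) \sum_(y | Q i y) nu y)).
  apply: sum_cover => // y /andP[]; rewrite !ler_norml => /andP[x1 x2] /andP[u1 u2].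
  have t0 : 0 <= (x y - x0 + L) / a by apply: divr_ge0; lra.
  have tL : (x y - x0 + L) / a <= 2 * L / a by rewrite ler_pM2r ?invr_gt0//; lra.
  have ln : (Num.truncn ((x y - x0 + L) / a) < n)%N by rewrite ltnS le_truncn.
  exists (Ordinal ln); rewrite /Q/=; set i := Num.truncn _.
  have /andP[] := truncn_itv t0; rewrite -/i => i1 i2.
  have ia : i%:R * a <= x y - x0 + L by rewrite -ler_pdivlMr.
  have ib : x y - x0 + L < i%:R * a + a.
    by move: i2; rewrite ltr_pdivrMr// -natr1 mulrDl mul1r.
  have c0 : 0 < c by lra.
  have Wc : c * W i = u0 - 2 * a - xi i by rewrite /W; field; rewrite gt_eqF.
  have ca : a <= c * a by rewrite ler_peMl// ltW.
  apply/andP; split; first by rewrite /xi; apply/andP; split; lra.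
  have h1 : c * W i <= c * w y by rewrite Wc /xi; lra.
  have h2 : c * w y <= c * (W i + 3 * a) by rewrite mulrDr Wc /xi; lra.
  by move: h1 h2; rewrite !ler_pM2l// => -> ->.
apply: (@le_trans _ _ (\sum_(i < n) (3 * a) `^ alpha)).
  by apply: ler_sum => i _; apply: hs; lra.
rewrite sumr_const card_ord -[leLHS]mulr_natl powRM ?(ltW a0)//.
have h3 : 3 `^ alpha <= 9 :> R.
  have -> : (9:R) = 3 `^ 2 by rewrite (powR_mulrn 2)// expr2; lra.
  by apply: ler_powR => //; lra.
have hn : n%:R <= 3 * (L / a).
  rewrite /n -natr1; have := truncn_le (2 * L / a); rewrite L2 => h; lra.
have -> : 27 * (L / a) * a `^ alpha = 3 * (L / a) * (9 * a `^ alpha) by ring.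
apply: ler_pM => //; first by rewrite mulr_ge0 ?powR_ge0.
by rewrite ler_wpM2r ?powR_ge0.
Qed.

Lemma spread_le M alpha (x w nu nu' : Y -> R) : (forall y, nu' y <= nu y) ->
  spread M alpha x w nu -> spread M alpha x w nu'.
Proof.
move=> hn hs x0 w0 a Ma; apply: le_trans (hs x0 w0 a Ma); exact: ler_sum.
Qed.

Lemma schur_test nu k (S : R) g : (forall y, 0 <= nu y) -> (forall y y', k y y' = k y' y) ->
  (forall y, \sum_y' nu y' * `|k y y'| <= S) ->
  bilform nu k g g <= S * nrm nu g.
Proof.
move=> nu0 ksym kS.
have half : \sum_y \sum_y' nu y * nu y' * (g y ^+ 2) * `|k y y'| <= S * nrm nu g.
  rewrite mulr_sumr; apply: ler_sum => y _.
  have -> : \sum_y' nu y * nu y' * g y ^+ 2 * `|k y y'| = nu y * g y ^+ 2 * \sum_y' nu y' * `|k y y'|.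
    by rewrite mulr_sumr; apply: eq_bigr => y' _; ring.
  by rewrite mulrC ler_wpM2r// mulr_ge0// sqr_ge0.
have half' : \sum_y \sum_y' nu y * nu y' * (g y' ^+ 2) * `|k y y'| <= S * nrm nu g.
  rewrite exchange_big/=; apply: le_trans half; apply: ler_sum => y _; apply: ler_sum => y' _.
  by rewrite (ksym y') (mulrC (nu y')).
rewrite -(ler_pM2l (_ : 0 < 2))//.
have -> : 2 * (S * nrm nu g) = S * nrm nu g + S * nrm nu g by ring.
apply: le_trans (lerD half half'); rewrite -big_split/= /bilform mulr_sumr.
apply: ler_sum => y _; rewrite -big_split/= mulr_sumr; apply: ler_sum => y' _.
have n0 : 0 <= nu y * nu y' by rewrite mulr_ge0.
have -> : 2 * (nu y * nu y' * (g y * g y') * k y y') = nu y * nu y' * (2 * (g y * g y') * k y y') by ring.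
have -> : nu y * nu y' * g y ^+ 2 * `|k y y'| + nu y * nu y' * g y' ^+ 2 * `|k y y'| =
   nu y * nu y' * ((g y ^+ 2 + g y' ^+ 2) * `|k y y'|) by ring.
rewrite ler_wpM2l//; apply: le_trans (ler_norm _) _; rewrite normrM ler_wpM2r//.
rewrite ler_norml; apply/andP; split.
  by have := sqr_ge0 (g y + g y'); lra.
by have := sqr_ge0 (g y - g y'); lra.
Qed.

Definition restr n (m : Y -> 'I_n) (c : 'I_n) nu y : R := if m y == c then nu y else 0.

(* Flipping the sign of [g] on odd classes kills, on average, the interaction of
   classes of different parity; in particular of neighbouring classes. *)
Lemma class_split n (m : Y -> 'I_n) nu k (Q S : R) g :
  (forall y, 0 <= nu y) -> (forall y y', k y y' = k y' y) ->
  (forall h, 0 <= bilform nu k h h) ->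
  (forall c h, bilform (restr m c nu) k h h <= Q * nrm (restr m c nu) h) ->
  (forall y, \sum_(y' | (odd (m y') == odd (m y)) && (m y' != m y)) nu y' * `|k y y'| <= S) ->
  bilform nu k g g <= (2 * Q + 2 * S) * nrm nu g.
Proof.
move=> nu0 ksym kpos hQ hS.
pose k1 y y' := if m y == m y' then k y y' else 0.
pose k2 y y' := if (odd (m y') == odd (m y)) && (m y' != m y) then k y y' else 0.
pose sg y : R := (-1) ^+ (odd (m y)).
(* [1 + sg y sg y'] is 2 for equal parities and 0 otherwise. Equal parity means the same class,
   counted by [k1], or classes at least two apart, counted by [k2]. *)
have E : bilform nu k g g + bilform nu k (fun y => sg y * g y) (fun y => sg y * g y) =
   2 * bilform nu k1 g g + 2 * bilform nu k2 g g.
  rewrite /bilform !mulr_sumr -!big_split/=; apply: eq_bigr => y _.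
  rewrite !mulr_sumr -!big_split/=; apply: eq_bigr => y' _.
  rewrite /k1 /k2 /sg; have [mm|mm] := eqVneq (m y) (m y').
    rewrite mm eqxx andbF; case: (odd _); rewrite ?expr0 ?expr1; ring.
  rewrite /= andbT.
  by case: (odd _); case: (odd _); rewrite ?expr0 ?expr1/=; ring.
have B1 : bilform nu k1 g g <= Q * nrm nu g.
  have -> : bilform nu k1 g g = \sum_c bilform (restr m c nu) k g g.
    rewrite /bilform [RHS]exchange_big/=; apply: eq_bigr => y _.
    rewrite [RHS]exchange_big/=; apply: eq_bigr => y' _.
    rewrite (bigD1 (m y))//= big1 ?addr0 => [|c cy].
      rewrite /k1 /restr eqxx (eq_sym (m y')); case: ifP => _; ring.
    by rewrite /restr eq_sym (negbTE cy); ring.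
  have -> : nrm nu g = \sum_c nrm (restr m c nu) g.
    rewrite /nrm exchange_big/=; apply: eq_bigr => y _.
    rewrite (bigD1 (m y))//= big1 ?addr0 => [|c cy]; first by rewrite /restr eqxx.
    by rewrite /restr eq_sym (negbTE cy) mul0r.
  by rewrite mulr_sumr; apply: ler_sum => c _.
have B2 : bilform nu k2 g g <= S * nrm nu g.
  apply: schur_test => // [y y'|y].
    by rewrite /k2 (eq_sym (m y)) (eq_sym (odd (m y))) (ksym y).
  apply: le_trans (hS y); rewrite [leRHS]big_mkcond/=; apply: ler_sum => y' _.
  by rewrite /k2; case: ifP => _ //; rewrite normr0 mulr0.
have := kpos (fun y => sg y * g y); move: E B1 B2; lra.
Qed.

End WeightedSums.

(** * Strips normal to an arc, and the base scale *)

Section Wolff.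
Variables (R : realType) (p : R).

Section Points.
Variables (Y : finType) (x w : Y -> R).
Implicit Types (M rho : R).

Definition kerY M (s0 : R) rho (y y' : Y) : R := ker p M s0 rho (x y - x y') (w y - w y').

Definition cosY M y s : R := cos (theta p M (x y) (w y) s).
Definition sinY M y s : R := sin (theta p M (x y) (w y) s).

Lemma contI_cosY M y : contI 1 5 (cosY M y).
Proof. exact: contI_costheta. Qed.

Lemma contI_sinY M y : contI 1 5 (sinY M y).
Proof. exact: contI_sintheta. Qed.

Lemma cos_theta_sub M y y' s : cos (theta p M (x y - x y') (w y - w y') s) =
  cosY M y s * cosY M y' s + sinY M y s * sinY M y' s.
Proof.
rewrite -cosB; congr cos; rewrite /theta; ring.
Qed.

Lemma kerYE M s0 rho : kerY M s0 rho = featk 1 5 (cosY M) (sinY M) (arc s0 rho).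
Proof.
apply/funext => y; apply/funext => y'; apply: eq_intg => s _.
by rewrite cos_theta_sub.
Qed.

Lemma kerY_sym M s0 rho y y' : kerY M s0 rho y y' = kerY M s0 rho y' y.
Proof. by rewrite kerYE featk_sym. Qed.

Lemma kerY_ge0 M nu s0 rho h : 0 <= bilform nu (kerY M s0 rho) h h.
Proof.
rewrite kerYE; apply: featk_ge0; [exact: contI_cosY|exact: contI_sinY|exact: contI_arc|].
exact: arc_ge0.
Qed.

(** An operator norm bound, for every arc of radius [rho] and every admissible [nu] on the given
    points: the step applies it to restrictions of [nu] to strips and to all test functions, not
    only to the constant one needed at the end. *)
Definition claim M alpha rho (Q : R) := forall nu : Y -> R,
  (forall y, 0 <= nu y) -> spread M alpha x w nu ->
  forall s0, 1 <= s0 - rho -> s0 + rho <= 5 ->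
  forall g, bilform nu (kerY M s0 rho) g g <= Q * nrm nu g.

End Points.

Lemma psi_sub (z w z' w' s : R) :
  psi p (z - z') (w - w') s = (z + p * s `^ (p - 1) * w) - (z' + p * s `^ (p - 1) * w').
Proof. by rewrite /psi; ring. Qed.

Lemma slope_bounds (s : R) : 1 < p -> 1 <= s <= 5 ->
  1 <= p * s `^ (p - 1) <= p * pw5 (p - 1).
Proof.
move=> p1 hs; have /andP[_ h] := powR_bounds (p - 1) hs.
have h1 : 1 <= s `^ (p - 1).
  rewrite -[leLHS](powRr0 s); apply: ler_powR; [by case/andP: hs|lra].
apply/andP; split; first by nra.
by rewrite ler_wpM2l//; lra.
Qed.

(** Compares [rho^alpha] with [M^(-alpha/2)], its value at the critical radius [M^(-1/2)]. *)
Lemma rho_powE (rho M alpha : R) : 0 < rho -> 0 < M ->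
  rho `^ alpha = (rho ^+ 2 * M) `^ (alpha / 2) * M `^ (- (alpha / 2)).
Proof.
move=> r0 M0; rewrite powRM ?sqr_ge0 ?(ltW M0)// -mulrA -powRD; last first.
  by rewrite (gt_eqF M0) implybT.
rewrite subrr powRr0 mulr1 -(powR_mulrn 2 (ltW r0)) -powRrM; congr (_ `^ _).
by field.
Qed.

(** The strip of width [C1 rho T] and length [D T] has mass [O(rho^(alpha-1) T^alpha)], while the
    kernel decays like [T^(-2)] across strips, so [layer_sum] applies. The hypothesis on [K] makes
    the strips wider than [1 / M]; the slack [K] admits the base radii, which may be shorter than
    [M^(-1/2)] by that factor. *)
Lemma far_mass : 1 < p -> exists2 rho1 : R, 0 < rho1 <= 1 &
  forall K D alpha, 1 <= K -> K <= D -> 0 < alpha < 2 ->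
  exists C1 Cf : R, [/\ 0 < C1, 0 < Cf &
  forall (Y : finType) (x w nu : Y -> R) M, 1 <= M -> (forall y, 0 <= nu y) ->
  spread M alpha x w nu -> (forall y y', `|x y - x y'| <= D) ->
  forall rho s0, 0 < rho -> rho <= rho1 -> 1 <= (K * rho) ^+ 2 * M ->
  1 <= s0 - rho -> s0 + rho <= 5 -> forall y,
  let u y' := `|psi p (x y - x y') (w y - w y') s0| in
  \sum_(y' | C1 * rho < u y') nu y' * `|kerY x w M s0 rho y y'| <=
    Cf * (rho `^ alpha / (rho ^+ 2 * M) ^+ 2) /\
  \sum_(y' | ~~ (C1 * rho < u y')) nu y' <= Cf * (rho `^ alpha / rho)].
Proof.
move=> p1; have [rho1 hr1 hker] := ker_far p1; exists rho1 => // K D alpha K1 KD hal.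
have D1 : 1 <= D by lra.
have [C1 [C2 [DC1 C1D C20 hfar]]] := hker D D1.
have /andP[al0 al2] := hal.
have C10 : 0 < C1 by lra.
pose Ca : R := 4 / (1 - 2 `^ alpha / 4).
have Ca0 : 0 < Ca by apply: layer_const_gt0; case/andP: hal.
pose Cn := 27 * D / C1 * C1 `^ alpha.
have Cn0 : 0 < Cn by rewrite !mulr_gt0 ?powR_gt0 ?invr_gt0//; lra.
have CC0 : 0 < Ca * Cn * C2 / C1 ^+ 2.
  by apply: divr_gt0; [apply: mulr_gt0 => //; exact: mulr_gt0|exact: exprn_gt0].
exists C1, (Cn + Ca * Cn * C2 / C1 ^+ 2); split => //.
  exact: addr_gt0.
move=> Y x w nu M M1 nu0 hs hD rho s0 r0 rr1 KrM h1 h5 y u.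
have M0 : 0 < M by lra.
have C1r : 0 < C1 * rho by rewrite mulr_gt0.
have MC : M^-1 <= C1 * rho.
  rewrite -[leLHS]mul1r ler_pdivrMr//.
  apply: (@le_trans _ _ (K * rho * M)); last first.
    by rewrite ler_pM2r// ler_pM2r//; lra.
  rewrite -(@ler_pXn2r _ 2)// ?nnegrE//; last first.
    have K0 : 0 <= K by exact: le_trans ler01 K1.
    by rewrite !mulr_ge0// ltW.
  rewrite expr1n exprMn (le_trans KrM)// ler_wpM2l ?sqr_ge0//.
  by rewrite expr2 ler_peMl// ltW.
have hs15 : 1 <= s0 <= 5 by clear -r0 h1 h5; apply/andP; split; lra.
have /andP[c1 c2] := slope_bounds p1 hs15.
have strip T : 1 <= T -> \sum_(y' | u y' <= C1 * rho * T) nu y' <= Cn * (rho `^ alpha / rho) * T `^ alpha.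
  move=> T1; have T0 : 0 < T by exact: lt_le_trans T1.
  have a0 : 0 < C1 * rho * T by rewrite mulr_gt0.
  have := @strip_le R Y M alpha x w nu (p * s0 `^ (p - 1)) (x y) (x y + p * s0 `^ (p - 1) * w y) (C1 * rho * T) (D * T).
  have -> : 27 * (D * T / (C1 * rho * T)) * (C1 * rho * T) `^ alpha = Cn * (rho `^ alpha / rho) * T `^ alpha.
    rewrite powRM ?(ltW T0) ?(ltW C1r)// powRM ?(ltW r0) ?(ltW C10)// /Cn.
    by field; rewrite !gt_eqF.
  move=> H; apply: le_trans (H _ _ _ _ _ _ _); rewrite ?al0 ?(ltW al2)//.
  - apply: ler_sum_pred => // y'; rewrite /u psi_sub distrC => ->; rewrite andbT distrC.
    by apply: le_trans (hD _ _) _; rewrite ler_peMr// (le_trans ler01 D1).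
  - by apply: le_trans MC _; rewrite ler_peMr// ltW.
  - rewrite ler_pM2r//; apply: le_trans C1D; rewrite ler_wpM2l// ltW//.
have r2M : 0 < rho ^+ 2 * M by rewrite mulr_gt0// exprn_gt0.
split; last first.
  have := strip 1 (lexx _); rewrite mulr1 powR1 mulr1 => H.
  apply: le_trans (le_trans H _); last first.
    rewrite ler_wpM2r ?divr_ge0 ?powR_ge0 ?(ltW r0)// lerDl.
    exact: ltW.
  by apply: ler_sum_pred => // y'; rewrite -leNgt.
pose kap y' := if C1 * rho < u y' then `|kerY x w M s0 rho y y'| else 0.
pose B := C2 * (rho / (rho * M * (C1 * rho)) ^+ 2).
have B0 : 0 <= B by rewrite mulr_ge0 ?divr_ge0 ?sqr_ge0 ?ltW.
have -> : \sum_(y' | C1 * rho < u y') nu y' * `|kerY x w M s0 rho y y'| = \sum_y' nu y' * kap y'.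
  by rewrite big_mkcond/=; apply: eq_bigr => y' _; rewrite /kap; case: ifP; rewrite ?mulr0.
have kl y' : C1 * rho < u y' -> `|kerY x w M s0 rho y y'| <= C2 * (rho / (rho * M * u y') ^+ 2).
  by move=> hu; apply: hfar.
have := @layer_sum R Y nu (fun y' => u y' / (C1 * rho)) kap alpha (Cn * (rho `^ alpha / rho)) B hal.
rewrite -/Ca => H; apply: le_trans (H _ _ _ _ _ _ _) _ => //.
- by rewrite mulr_ge0 ?divr_ge0 ?powR_ge0 ?(ltW r0)// ltW.
- by move=> y'; rewrite divr_ge0 ?(ltW C1r)// normr_ge0.
- move=> T T1; apply: le_trans (strip T T1); apply: ler_sum_pred => // y'.
  by rewrite ler_pdivrMr// mulrC.
- move=> y'; rewrite /kap; case: ifPn => // hu; apply: le_trans (kl _ hu) _.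
  have u0 : 0 < u y' by apply: lt_trans hu.
  rewrite /B ler_pM2l// ler_pM2l// lef_pV2 ?posrE ?exprn_gt0 ?mulr_gt0//.
  have rM : 0 < rho * M by rewrite mulr_gt0.
  have hle : rho * M * (C1 * rho) <= rho * M * u y' by rewrite ler_pM2l// ltW.
  apply: lerXn2r => //; rewrite nnegrE ltW//.
    exact: mulr_gt0 rM C1r.
  exact: mulr_gt0 rM u0.
- move=> y'; rewrite /kap; case: ifPn => // hu; last by rewrite mul0r.
  have u0 : 0 < u y' by apply: lt_trans hu.
  apply: (@le_trans _ _ (C2 * (rho / (rho * M * u y') ^+ 2) * (u y' / (C1 * rho)) ^+ 2)).
    by rewrite ler_wpM2r ?sqr_ge0// kl.
  by rewrite /B; apply: le_of_eq; field; rewrite !gt_eqF.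
have -> : Ca * (Cn * (rho `^ alpha / rho)) * B = Ca * Cn * C2 / C1 ^+ 2 * (rho `^ alpha / (rho ^+ 2 * M) ^+ 2).
  by rewrite /B; field; rewrite !gt_eqF.
by rewrite ler_wpM2r ?lerDr ?(ltW Cn0)// divr_ge0 ?powR_ge0 ?sqr_ge0.
Qed.

(** In the central strip the kernel is at most [2 rho] and the mass [O(rho^(alpha-1))], so Schur's
    test gives [rho^alpha <= M^(-alpha/2)]. The rest carries [(rho^2 M)^(-2)], at most [K^4]. *)
Lemma claim_base : 1 < p -> exists2 rho1 : R, 0 < rho1 <= 1 &
  forall K D alpha, 1 <= K -> K <= D -> 0 < alpha < 2 -> exists2 C : R, 0 < C &
  forall (Y : finType) (x w : Y -> R) M, 1 <= M -> (forall y y', `|x y - x y'| <= D) ->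
  forall rho, 0 < rho -> rho <= rho1 -> 1 <= (K * rho) ^+ 2 * M -> rho ^+ 2 * M <= 1 ->
  claim x w M alpha rho (C * M `^ (- (alpha / 2))).
Proof.
move=> p1; have [rho1 hr1 hfar] := far_mass p1; exists rho1 => // K D alpha K1 KD hal.
have /andP[al0 al2] := hal.
have [C1 [Cf [C10 Cf0 hf]]] := hfar K D alpha K1 KD hal.
exists (Cf * (K ^+ 4 + 2)).
  by rewrite mulr_gt0// addr_gt0// exprn_gt0//; lra.
move=> Y x w M M1 hD rho r0 rr1 KrM rM nu nu0 hs s0 h1 h5 g.
have M0 : 0 < M by lra.
have r2M : 0 < rho ^+ 2 * M by rewrite mulr_gt0// exprn_gt0.
apply: schur_test => //; first exact: kerY_sym.
move=> y; have [/= hA hB] := hf Y x w nu M M1 nu0 hs hD rho s0 r0 rr1 KrM h1 h5 y.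
rewrite (bigID (fun y' => C1 * rho < `|psi p (x y - x y') (w y - w y') s0|))/=.
have near : \sum_(i | ~~ (C1 * rho < `|psi p (x y - x i) (w y - w i) s0|)) nu i * `|kerY x w M s0 rho y i|
    <= 2 * rho * (Cf * (rho `^ alpha / rho)).
  apply: (@le_trans _ _ (\sum_(i | ~~ (C1 * rho < `|psi p (x y - x i) (w y - w i) s0|)) 2 * rho * nu i)).
    apply: ler_sum => i _; rewrite mulrC ler_wpM2r//; exact: ker_le.
  by rewrite -mulr_sumr ler_wpM2l// mulr_ge0// ltW.
apply: (le_trans (lerD hA near)).
have rE := rho_powE alpha r0 M0.
have al20 : 0 <= alpha / 2 by rewrite divr_ge0// ltW.
have q1 : (rho ^+ 2 * M) `^ (alpha / 2) <= 1.
  rewrite -[leRHS](_ : 1 `^ (alpha / 2) = 1); last by rewrite powR1.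
  apply: ge0_ler_powR; rewrite ?nnegrE ?(ltW r2M)//.
have ra : rho `^ alpha <= M `^ (- (alpha / 2)).
  by rewrite rE -[leRHS]mul1r ler_wpM2r ?powR_ge0.
have rV : (rho ^+ 2 * M) ^- 2 <= K ^+ 4.
  have K2 : 0 < K ^+ 2 by rewrite exprn_gt0//; lra.
  have h : (rho ^+ 2 * M)^-1 <= K ^+ 2.
    by rewrite -[leLHS]mul1r ler_pdivrMr// mulrA -exprMn.
  rewrite -exprVn (_ : K ^+ 4 = (K ^+ 2) ^+ 2); last by rewrite -exprM.
  by apply: lerXn2r => //; rewrite nnegrE ?invr_ge0 ltW.
have -> : Cf * (rho `^ alpha / (rho ^+ 2 * M) ^+ 2) + 2 * rho * (Cf * (rho `^ alpha / rho)) =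
   Cf * ((rho ^+ 2 * M) ^- 2 + 2) * rho `^ alpha by field; rewrite !gt_eqF.
apply: ler_pM => //.
- by rewrite mulr_ge0 ?(ltW Cf0)// addr_ge0// invr_ge0 sqr_ge0.
- exact: powR_ge0.
- by rewrite ler_wpM2l ?(ltW Cf0)// lerD2r.
Qed.

End Wolff.

(** The outermost children end exactly where the parent ends. Near an end both bumps vanish to
    second order and the parent lies below the outermost child. Elsewhere some child centre is
    within half a child radius, where its bump is at least [(3/4)^2 = 9/16]; hence the factor 2. *)
Lemma arc_cover (R : realType) (k : nat) (s0 rho s : R) : (0 < k)%N -> 0 < rho ->
  arc s0 rho s <= 2 * \sum_(j < k.*2.+1)
    arc (s0 + (j%:R - k%:R) * (rho / k.+1%:R)) (rho / k.+1%:R) s.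
Proof.
move=> k0 r0; set K : R := k.+1%:R.
have K2 : 2 <= K by rewrite ler_nat.
have K0 : 0 < K by lra.
have rK : 0 < rho / K by rewrite divr_gt0.
pose t := (s - s0) / (rho / K).
have childE (j : nat) : arc (s0 + (j%:R - k%:R) * (rho / K)) (rho / K) s = bump (t - (j%:R - k%:R)).
  by rewrite /arc /t; congr bump; field; rewrite !gt_eqF.
have parentE : arc s0 rho s = bump (t / K) by rewrite /arc /t; congr bump; field; rewrite !gt_eqF.
have kK : k%:R = K - 1 by rewrite /K -natr1; lra.
suff [j [jk hj]] : exists j : nat, (j < k.*2.+1)%N /\ bump (t / K) <= 2 * bump (t - (j%:R - k%:R)).
  rewrite parentE (le_trans hj)// ler_pM2l// (bigD1 (Ordinal jk))//= childE lerDl.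
  by apply: sumr_ge0 => i _; exact: arc_ge0.
have [tK|tK] := leP K `|t|.
  exists 0%N; split => //; rewrite (@bump_out _ (t / K)); first by rewrite mulr_ge0// bump_ge0.
  by rewrite normrM normfV (gtr0_norm K0) ler_pdivlMr// mul1r.
have edge y : 0 <= y -> y < 1 -> bump ((K - 1 + y) / K) <= 2 * bump y.
  move=> y0 y1; have ty : 0 <= (K - 1 + y) / K <= 1.
    by apply/andP; split; [rewrite divr_ge0//; lra|rewrite ler_pdivrMr//; lra].
  have /andP[t0 t1] := ty.
  rewrite (@bump_in _ y); last by rewrite ger0_norm// ltW.
  rewrite bump_in; last by rewrite ger0_norm.
  have h : 1 - ((K - 1 + y) / K) ^+ 2 <= 1 - y ^+ 2.
    have e : 1 - (K - 1 + y) / K = (1 - y) / K by field; rewrite gt_eqF.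
    have eK : (1 - y) / K <= (1 - y) / 2 by rewrite ler_wpM2l ?lef_pV2 ?posrE//; lra.
    have yT : y <= (K - 1 + y) / K by move: e eK; set A := (K - 1 + y) / K; set B := (1 - y) / K; lra.
    by rewrite lerD2l lerN2; apply: lerXn2r; rewrite ?nnegrE.
  have h0 : 0 <= 1 - ((K - 1 + y) / K) ^+ 2 by rewrite subr_ge0 expr_le1.
  have : (1 - ((K - 1 + y) / K) ^+ 2) ^+ 2 <= (1 - y ^+ 2) ^+ 2.
    by apply: lerXn2r => //; rewrite nnegrE// (le_trans h0).
  move/le_trans; apply; rewrite ler_peMl ?sqr_ge0//; lra.
have bumpN (y : R) : bump (- y) = bump y by rewrite /bump sqrrN.
move: tK; rewrite ltr_norml => /andP[tK1 tK2].
have [tk|tk] := leP (K - 1) t.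
  exists k.*2; split => //.
  have -> : t - (k.*2%:R - k%:R) = t - (K - 1) by rewrite -kK -addnn natrD; ring.
  have -> : t / K = (K - 1 + (t - (K - 1))) / K by congr (_ / _); ring.
  by apply: edge; lra.
have [tk'|tk'] := leP t (- (K - 1)).
  exists 0%N; split => //.
  have -> : t - (0%:R - k%:R) = - (- t - (K - 1)) by rewrite kK; ring.
  have -> : t / K = - ((K - 1 + (- t - (K - 1))) / K) by field; rewrite gt_eqF.
  by rewrite !bumpN; apply: edge; lra.
(* The added half makes truncation round to the nearest child centre. *)
pose v := t + k%:R + 2^-1.
have v0 : 0 <= v by rewrite /v kK; lra.
have /andP[j1 j2] := truncn_itv v0.
exists (Num.truncn v); split.
  rewrite -(ltr_nat R) (le_lt_trans j1)// /v -(natr1 k.*2) -addnn natrD kK; lra.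
set j := Num.truncn v in j1 j2 *.
have hy : `|t - (j%:R - k%:R)| <= 2^-1.
  by move: j2; rewrite -natr1 ler_norml => j2; rewrite /v in j1 j2; apply/andP; split; lra.
have y1 : `|t - (j%:R - k%:R)| <= 1 by lra.
apply: (le_trans (bump_le1 _)); rewrite bump_in//.
have : (t - (j%:R - k%:R)) ^+ 2 <= 4^-1.
  rewrite -real_normK ?num_real// (_ : 4^-1 = (2^-1) ^+ 2); last by field.
  by apply: lerXn2r; rewrite ?nnegrE ?normr_ge0.
have := sqr_ge0 (t - (j%:R - k%:R)); nra.
Qed.

Lemma near_card (k n : nat) (i : 'I_n) :
  (#|[pred j : 'I_n | (i < j + k.+1) && (j < i + k.+1)]| <= k.*2.+1)%N.
Proof.
pose s := pmap (fun m => insub m : option 'I_n) (iota (i - k) k.*2.+1).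
apply: (@leq_trans #|s|); last first.
  apply: leq_trans (card_size _) _; rewrite size_pmap_sub.
  by apply: leq_trans (count_size _ _) _; rewrite size_iota.
apply: subset_leq_card; apply/fintype.subsetP => j; rewrite inE => /andP[h1 h2].
by rewrite mem_pmap_sub mem_iota /= -addnn; apply/andP; split; lia.
Qed.

(** * Interaction of separated arcs *)

Section Step.
Variables (R : realType) (p : R).

Lemma restr_ge0 (Y : finType) n (m : Y -> 'I_n) c (nu : Y -> R) :
  (forall y, 0 <= nu y) -> forall y, 0 <= restr m c nu y.
Proof. by move=> nu0 y; rewrite /restr; case: ifP. Qed.

Lemma restr_le (Y : finType) n (m : Y -> 'I_n) c (nu : Y -> R) :
  (forall y, 0 <= nu y) -> forall y, restr m c nu y <= nu y.
Proof. by move=> nu0 y; rewrite /restr; case: ifP. Qed.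

(** The product of the two kernels decays in [f = M rho |psi| + M rho^2 |w|], and [f <= T] lies in a
    box with sides about [T / (M rho)] and [T / (M rho^2)], dual to the arc. About [1 / rho] squares
    of the smaller side cover it, which bounds its mass for [layer_sum]. That sums over the second
    point; the first contributes the total mass [A]. *)
Lemma corr_le (K alpha : R) : 1 < p -> 1 <= K -> 0 < alpha < 2 -> exists2 C : R, 0 < C &
  forall (Y : finType) (x w nu : Y -> R) M A, 1 <= M -> (forall y, 0 <= nu y) ->
  spread M alpha x w nu -> \sum_y nu y <= A ->
  forall rho s0 s1 s2, 0 < rho -> rho <= 1 -> 1 <= s0 - rho -> s0 + rho <= 5 ->
  `|s1 - s0| <= rho - rho / K -> `|s2 - s0| <= rho - rho / K -> 3 * (rho / K) <= `|s1 - s2| ->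
  corr nu (kerY p x w M s1 (rho / K)) (kerY p x w M s2 (rho / K)) <=
    C * A * (rho * ((M * rho)^-1) `^ alpha).
Proof.
move=> p1 K1 hal; have /andP[al0 al2] := hal.
have [Ck Ck0 hk] := ker_pair p1 K1.
pose Ca : R := 4 / (1 - 2 `^ alpha / 4).
have Ca0 : 0 < Ca by apply: layer_const_gt0; case/andP: hal.
(* The long side of the box read in the first coordinate: [|x - x'| <= |psi| + c |w|], with slope
   [c <= p * pw5 (p - 1)]. *)
pose cm := 1 + p * pw5 (p - 1).
have cm1 : 1 <= cm by have := pw5_ge1 (p - 1); rewrite /cm; nra.
have cm0 : 0 < cm by lra.
exists (Ca * (27 * cm) * Ck).
  by apply: mulr_gt0 => //; apply: mulr_gt0 => //; apply: mulr_gt0.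
move=> Y x w nu M A M1 nu0 hs hA rho s0 s1 s2 r0 r1 h1 h5 hs1 hs2 hs12.
have M0 : 0 < M by lra.
have Mr : 0 < M * rho by rewrite mulr_gt0.
have hs15 : 1 <= s0 <= 5 by clear -r0 h1 h5; apply/andP; split; lra.
have /andP[c1 c2] := slope_bounds p1 hs15.
set c := p * s0 `^ (p - 1) in c1 c2.
pose k1 := kerY p x w M s1 (rho / K); pose k2 := kerY p x w M s2 (rho / K).
pose Phi := 27 * (cm / rho) * ((M * rho)^-1) `^ alpha.
have Phi0 : 0 <= Phi.
  by rewrite mulr_ge0 ?powR_ge0// mulr_ge0// divr_ge0// ltW.
have inner y : \sum_y' nu y' * (`|k1 y y'| * `|k2 y y'|) <= Ca * Phi * (Ck * rho ^+ 2).
  have hk' y' := hk M s0 rho s1 s2 (x y - x y') (w y - w y') M0 r0 h1 h5 hs1 hs2 hs12.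
  apply: (@layer_sum R Y nu (fun y' => M * rho * `|psi p (x y - x y') (w y - w y') s0| + M * rho ^+ 2 * `|w y - w y'|)
    (fun y' => `|k1 y y'| * `|k2 y y'|) alpha Phi (Ck * rho ^+ 2)) => //.
  - by rewrite mulr_ge0 ?sqr_ge0// ltW.
  - by move=> y'; rewrite addr_ge0// mulr_ge0 ?normr_ge0// ltW// mulr_gt0// exprn_gt0.
  - move=> T T1; have T0 : 0 < T by exact: lt_le_trans T1.
    have a0 : 0 < T / (M * rho) by rewrite divr_gt0.
    have := @strip_le R Y M alpha x w nu c (x y) (x y + c * w y) (T / (M * rho)) (cm * (T / (M * rho) / rho)).
    have -> : 27 * (cm * (T / (M * rho) / rho) / (T / (M * rho))) * (T / (M * rho)) `^ alpha = Phi * T `^ alpha.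
      rewrite powRM ?(ltW T0) ?invr_ge0 ?(ltW Mr)// /Phi.
      by field; rewrite !gt_eqF.
    move=> H; apply: le_trans (H _ _ _ _ _ _ _); rewrite ?al0 ?(ltW al2)//; last 2 first.
    + rewrite ler_pdivlMr// mulrA mulVf ?mul1r ?gt_eqF//; clear -r1 T1; lra.
    + rewrite mulrCA -{1}[T / (M * rho)]mulr1 ler_pM2l// ler_pdivlMr// mul1r; clear -r1 cm1; lra.
    apply: ler_sum_pred => // y'; rewrite psi_sub -/c => hT.
    have w0 : 0 <= M * rho ^+ 2 * `|w y - w y'|.
      by rewrite mulr_ge0 ?normr_ge0// ltW// mulr_gt0// exprn_gt0.
    have u0 : 0 <= M * rho * `|x y + c * w y - (x y' + c * w y')| by rewrite mulr_ge0// ltW.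
    have hu : `|x y + c * w y - (x y' + c * w y')| <= T / (M * rho).
      by rewrite ler_pdivlMr// mulrC; clear -hT w0; lra.
    rewrite [`|x y' + _ - _|]distrC hu andbT.
    have hw : `|w y - w y'| <= T / (M * rho) / rho.
      rewrite !ler_pdivlMr//; apply: le_trans (_ : M * rho ^+ 2 * `|w y - w y'| <= _); last first.
        by clear -hT u0; lra.
      by apply: le_of_eq; ring.
    have hx : `|x y' - x y| <= `|x y + c * w y - (x y' + c * w y')| + c * `|w y - w y'|.
      have -> : x y' - x y = - (x y + c * w y - (x y' + c * w y')) + c * (w y - w y') by ring.
      apply: (le_trans (ler_normD _ _)); rewrite normrN normrM (ger0_norm (_ : 0 <= c))//.
      exact: le_trans c1.
    apply: (le_trans hx); rewrite /cm mulrDl mul1r; apply: lerD.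
      apply: (le_trans hu); rewrite ler_pdivlMr//.
      by rewrite -[leRHS]mulr1 ler_pM2l.
    by apply: ler_pM => //; move: c1 c2; clear; lra.
  - by move=> y'; have [] := hk' y'.
  - by move=> y'; have [_] := hk' y'.
have -> : Ca * (27 * cm) * Ck * A * (rho * ((M * rho)^-1) `^ alpha) = A * (Ca * Phi * (Ck * rho ^+ 2)).
  by rewrite /Phi; field; rewrite gt_eqF.
have CP : 0 <= Ca * Phi * (Ck * rho ^+ 2).
  by rewrite mulr_ge0// mulr_ge0 ?sqr_ge0// ltW.
apply: (@le_trans _ _ ((\sum_y nu y) * (Ca * Phi * (Ck * rho ^+ 2)))); last exact: ler_wpM2r.
rewrite mulr_suml; apply: ler_sum => y _.
apply: (@le_trans _ _ (nu y * \sum_y' nu y' * (`|k1 y y'| * `|k2 y y'|))); last exact: ler_wpM2l.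
rewrite mulr_sumr; apply: ler_sum => y' _; rewrite [leRHS]mulrA.
by rewrite ler_wpM2l ?mulr_ge0// -normrM ler_norm.
Qed.

End Step.

(** * One step of the induction on the length of the arc *)

Section Induction.
Variables (R : realType) (p : R).

Definition child_center (k : nat) (s0 rho : R) (j : nat) : R :=
  s0 + (j%:R - k%:R) * (rho / k.+1%:R).

Lemma child_center_le k s0 (rho : R) j : 0 < rho -> (j < k.*2.+1)%N ->
  `|child_center k s0 rho j - s0| <= rho - rho / k.+1%:R.
Proof.
move=> r0 jk; rewrite /child_center addrAC subrr add0r normrM.
have K0 : 0 < k.+1%:R :> R by rewrite ltr0n.
rewrite (ger0_norm (_ : 0 <= rho / _)) ?divr_ge0 ?(ltW r0)//.
have -> : rho - rho / k.+1%:R = k%:R * (rho / k.+1%:R) by rewrite -natr1; field; rewrite natr1 gt_eqF.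
rewrite ler_pM2r ?divr_gt0// ler_norml.
have : j%:R <= k%:R + k%:R :> R by rewrite -natrD addnn ler_nat -ltnS.
have := ler0n R j; move=> ? ?; apply/andP; split; lra.
Qed.

Lemma child_center_dist k s0 (rho : R) i j : 0 < rho -> (i + 3 <= j)%N ->
  3 * (rho / k.+1%:R) <= `|child_center k s0 rho i - child_center k s0 rho j|.
Proof.
move=> r0 ij.
have K0 : 0 < k.+1%:R :> R by rewrite ltr0n.
have -> : child_center k s0 rho i - child_center k s0 rho j = - ((j%:R - i%:R) * (rho / k.+1%:R)).
  by rewrite /child_center; ring.
rewrite normrN ger0_norm.
  by rewrite ler_pM2r ?divr_gt0// lerBrDr -natrD ler_nat addnC.
by rewrite mulr_ge0 ?divr_ge0 ?(ltW r0)// subr_ge0 ler_nat; lia.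
Qed.

(* Narrow interactions are absorbed by the estimate at scale [rho / K], broad ones
   are Hilbert-Schmidt; the mass of [nu] enters only through [A]. *)
Lemma broad_narrow_arcs (k : nat) (alpha : R) : 1 < p -> (0 < k)%N -> 0 < alpha < 2 ->
  exists2 C : R, 0 < C &
  forall (Y : finType) (x w nu : Y -> R) M A Q rho s0 L g, 1 <= M -> (forall y, 0 <= nu y) ->
  spread M alpha x w nu -> \sum_y nu y <= A -> 0 <= Q ->
  claim p x w M alpha (rho / k.+1%:R) Q ->
  0 < rho -> rho <= 1 -> 1 <= s0 - rho -> s0 + rho <= 5 ->
  0 < L -> C * A * (rho * ((M * rho)^-1) `^ alpha) <= L ^+ 2 ->
  bilform nu (kerY p x w M s0 rho) g g <= (10 * Q + 2 * k.*2.+1%:R * L) * nrm nu g.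
Proof.
move=> p1 k0 hal.
have K1 : 1 <= k.+1%:R :> R by rewrite ler1n.
have K0 : 0 < k.+1%:R :> R by rewrite ltr0n.
have [C C0 hC] := corr_le p1 K1 hal.
exists C => // Y x w nu M A Q rho s0 L g M1 nu0 hs hA Q0 hQ r0 r1 h1 h5 L0 hL.
pose om (j : 'I_k.*2.+1) := arc (child_center k s0 rho j) (rho / k.+1%:R).
have com j : contI 1 5 (om j) by exact: contI_arc.
have om0 j s : 0 <= om j s by exact: arc_ge0.
pose cY := cosY p x w M; pose sY := sinY p x w M.
have cc y : contI 1 5 (cY y) by exact: contI_cosY.
have cs y : contI 1 5 (sY y) by exact: contI_sinY.
have hcen (j : 'I_k.*2.+1) := child_center_le s0 r0 (ltn_ord j).
have hQ' (j : 'I_k.*2.+1) h : bilform nu (featk 1 5 cY sY (om j)) h h <= Q * nrm nu h.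
  rewrite -kerYE; apply: hQ => //.
    have := hcen j; rewrite ler_norml => /andP[+ _]; move: h1.
    by set q := rho / _; set cj := child_center _ _ _ _; clear; lra.
  have := hcen j; rewrite ler_norml => /andP[_ +]; move: h5.
  by set q := rho / _; set cj := child_center _ _ _ _; clear; lra.
(* Indices at most two apart, so that the others have centres at least three child radii apart.
   These 5 indices, doubled by [arc_cover], give the coefficient 10 of [Q]. *)
pose near : rel 'I_k.*2.+1 := fun i j => ((i < j + 3) && (j < i + 3))%N.
have nsym : symmetric near by move=> i j; rewrite /near andbC.
have ncard i : (#|near i| <= 5)%N by exact: (near_card 2 i).
have hJ i j : ~~ near i j -> corr nu (featk 1 5 cY sY (om i)) (featk 1 5 cY sY (om j)) <= L ^+ 2.
  move=> nij; rewrite -!kerYE; apply: le_trans hL; apply: (hC Y x w nu M A M1 nu0 hs hA rho s0 _ _ r0 r1 h1 h5 (hcen i) (hcen j)).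
  move: nij; rewrite negb_and -!leqNgt => /orP[ij|ij].
    by rewrite distrC; exact: child_center_dist.
  exact: child_center_dist.
have := broad_narrow cc cs com om0 nu0 Q0 L0 nsym ncard hQ' hJ g.
rewrite -(ler_pM2l (_ : 0 < 2))// => H.
apply: (@le_trans _ _ _ _ _ _ (le_trans H _)); last first.
  by apply: le_of_eq; ring.
rewrite kerYE bilform_featk//; last exact: contI_arc.
under eq_bigr do rewrite bilform_featk//.
have cT F : (forall y, contI 1 5 (F y)) -> contI 1 5 (fun s => \sum_y nu y * (g y * F y s)).
  move=> cF; apply: contI_sum => y; apply: contIM; first exact: contI_cst.
  by apply: contIM => //; exact: contI_cst.
have cE : contI 1 5 (fun s => (\sum_y nu y * (g y * cY y s)) * (\sum_y nu y * (g y * cY y s)) +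
   (\sum_y nu y * (g y * sY y s)) * (\sum_y nu y * (g y * sY y s))).
  by apply: contID; apply: contIM; exact: cT.
rewrite -intg_sum; last by move=> j; exact: contIM.
rewrite -intgZ; last by apply: contI_sum => j; exact: contIM.
apply: le_intg.
- by apply: contIM => //; exact: contI_arc.
- by apply: contIM; [exact: contI_cst|apply: contI_sum => j; exact: contIM].
move=> s _; rewrite -mulr_suml mulrA ler_wpM2r//.
  by rewrite addr_ge0// -expr2 sqr_ge0.
exact: arc_cover.
Qed.

(** On one strip the mass is [O(rho^(alpha-1))], so the trace [A rho (M rho)^(-alpha)] of separated
    arcs is [O(M^(-alpha))], and its root has the desired size. Strips of equal parity are more than
    [C1 rho] apart and interact by at most [rho^alpha (rho^2 M)^(-2)], which is at most
    [M^(-alpha/2)] when [rho^2 M >= 1]. The 20, twice the 10 of one strip, depends on neither [k]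
    nor [D]: this is what makes the final loss small. *)
Lemma claim_step : 1 < p -> exists2 rho1 : R, 0 < rho1 <= 1 &
  forall (k : nat) D alpha, (0 < k)%N -> k.+1%:R <= D -> 0 < alpha < 2 -> exists2 C : R, 0 < C &
  forall (Y : finType) (x w : Y -> R) M, 1 <= M -> (forall y y', `|x y - x y'| <= D) ->
  forall rho Q, 0 < rho -> rho <= rho1 -> 1 <= rho ^+ 2 * M -> 0 <= Q ->
  claim p x w M alpha (rho / k.+1%:R) Q ->
  claim p x w M alpha rho (20 * Q + C * M `^ (- (alpha / 2))).
Proof.
move=> p1; have [rho1 hr1 hfar] := far_mass p1; exists rho1 => // k D alpha k0 KD hal.
have /andP[r10 r11] := hr1; have /andP[al0 al2] := hal.
have K1 : 1 <= k.+1%:R :> R by rewrite ler1n.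
have [C1 [Cf [C10 Cf0 hf]]] := hfar _ D alpha K1 KD hal.
have [Cb Cb0 hb] := broad_narrow_arcs p1 k0 hal.
(* [B^2 >= Cb * Cf], so [B * M^(-alpha/2)] serves as [L] without a square root. *)
pose B := 1 + Cb * Cf.
have CC : 0 < Cb * Cf by exact: mulr_gt0.
have B0 : 0 < B by rewrite addr_gt0.
exists (4 * k.*2.+1%:R * B + 2 * Cf).
  by rewrite addr_gt0// !mulr_gt0// ltr0n.
move=> Y x w M M1 hD rho Q r0 rr1 rM Q0 hQ nu nu0 hs s0 h1 h5 g.
have M0 : 0 < M by lra.
have KrM : 1 <= (k.+1%:R * rho) ^+ 2 * M.
  by rewrite exprMn -mulrA; apply: (le_trans rM); rewrite ler_peMl ?exprn_ege1// mulr_ge0 ?sqr_ge0// ltW.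
have rho_le1 : rho <= 1 by exact: le_trans rr1 r11.
have r2M : 0 < rho ^+ 2 * M by rewrite mulr_gt0// exprn_gt0.
have hfm := fun nu nu0 hs y => hf Y x w nu M M1 nu0 hs hD rho s0 r0 rr1 KrM h1 h5 y.
set Ma := M `^ (- (alpha / 2)).
have Ma0 : 0 < Ma by rewrite powR_gt0.
pose c := p * s0 `^ (p - 1).
pose u y := x y + c * w y.
have uE y y' : psi p (x y - x y') (w y - w y') s0 = u y - u y' by rewrite psi_sub.
have C1r : 0 < C1 * rho by rewrite mulr_gt0.
(* Adding [um] makes the rescaled coordinate [t] nonnegative, and its integer part is the index of
   the strip. *)
pose um := \sum_y `|u y|.
pose t y := (u y + um) / (C1 * rho).
have t0 y : 0 <= t y.
  rewrite divr_ge0 ?(ltW C1r)// /um (bigD1 y)//= addrA addr_ge0 ?sumr_ge0//.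
  by rewrite -lerBlDl sub0r; have := ler_norm (- u y); rewrite normrN.
have tE y y' : u y - u y' = (t y - t y') * (C1 * rho) by rewrite /t; field; rewrite !gt_eqF.
pose n := (Num.truncn (\sum_y t y)).+1.
have mn y : (Num.truncn (t y) < n)%N.
  by rewrite ltnS le_truncn// (bigD1 y)//= lerDl sumr_ge0.
pose m y : 'I_n := Ordinal (mn y).
have m1 y : (m y)%:R <= t y by have /andP[] := truncn_itv (t0 y).
have m2 y : t y < (m y)%:R + 1 by have /andP[] := truncn_itv (t0 y); rewrite natr1.
pose L := B * Ma.
have L0 : 0 < L by exact: mulr_gt0.
have in_class ci h : bilform (restr m ci nu) (kerY p x w M s0 rho) h h <=
    (10 * Q + 2 * k.*2.+1%:R * L) * nrm (restr m ci nu) h.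
  have nuc0 := restr_ge0 m ci nu0.
  have nucs := spread_le (restr_le m ci nu0) hs.
  have mass : \sum_y restr m ci nu y <= Cf * (rho `^ alpha / rho).
    have [y0 /eqP my0|none] := pickP (fun y => m y == ci); last first.
      rewrite big1 => [|y _]; last by rewrite /restr none.
      by rewrite mulr_ge0 ?divr_ge0 ?powR_ge0 ?(ltW r0)// ltW.
    have [_ ] := hfm nu nu0 hs y0; apply: le_trans.
    rewrite [leRHS]big_mkcond/=; apply: ler_sum => y _; rewrite /restr.
    case: eqP => [my|_]; last by case: ifP.
    rewrite uE tE normrM (gtr0_norm C1r) ltr_pMl// -leNgt.
    case: ifPn => // /negP; case.
    have := m1 y; have := m2 y; have := m1 y0; have := m2 y0; rewrite my my0.
    by clear; move=> *; rewrite ler_norml; apply/andP; split; lra.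
  apply: (hb Y x w (restr m ci nu) M _ Q rho s0 L h M1 nuc0 nucs mass Q0 hQ r0 rho_le1 h1 h5 L0).
  have -> : Cb * (Cf * (rho `^ alpha / rho)) * (rho * (M * rho)^-1 `^ alpha) = Cb * Cf * Ma ^+ 2.
    have -> : Ma ^+ 2 = M^-1 `^ alpha.
      by rewrite /Ma -powR_mulrn ?powR_ge0// -powRrM -(powR_inv1 (ltW M0)) -powRrM; congr (_ `^ _); field.
    have -> : (M * rho)^-1 = M^-1 * rho^-1 by rewrite invfM.
    rewrite powRM ?invr_ge0 ?(ltW M0) ?(ltW r0)//.
    have -> : rho^-1 `^ alpha = (rho `^ alpha)^-1.
      by rewrite -(powR_inv1 (ltW r0)) -powRrM mulN1r powRN.
    by field; rewrite !gt_eqF// powR_gt0.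
  rewrite exprMn ler_wpM2r ?sqr_ge0// /B; move: CC; clear; nra.
have hS y : \sum_(y' | (odd (m y') == odd (m y)) && (m y' != m y)) nu y' * `|kerY p x w M s0 rho y y'|
    <= Cf * Ma.
  have [H _] := hfm nu nu0 hs y.
  apply: (@le_trans _ _ (Cf * (rho `^ alpha / (rho ^+ 2 * M) ^+ 2))).
    apply: le_trans H.
    apply: (@ler_sum_pred R Y _ _ (fun y' => nu y' * `|kerY p x w M s0 rho y y'|)).
      by move=> y'; rewrite mulr_ge0.
    move=> y' /andP[/eqP par neq]; rewrite uE tE normrM (gtr0_norm C1r) ltr_pMl//.
    have gap i j : (m i < m j)%N -> odd (m i) = odd (m j) -> 1 < t j - t i.
      move=> ij pij; have : ((m i).+2 <= m j)%N.
        by move: ij pij; case: (ltngtP (m i).+1 (m j)) => // <- _ /=; case: (odd _).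
      rewrite -(ler_nat R) -natr1 -natr1 => h; have := m1 j; have := m2 i; move: h; clear; lra.
    have := neq; rewrite -val_eqE neq_ltn => /orP[lt|lt].
      by apply: lt_le_trans (ler_norm _); exact: gap.
    rewrite distrC; apply: lt_le_trans (ler_norm _); exact: gap.
  rewrite ler_pM2l// (rho_powE alpha r0 M0) -/Ma mulrAC -[leRHS]mul1r ler_wpM2r ?(ltW Ma0)//.
  rewrite ler_pdivrMr ?exprn_gt0// mul1r -(powR_mulrn 2 (ltW r2M)); apply: ler_powR => //.
  by move: al2; clear; lra.
apply: le_trans (@class_split R Y n m nu _ _ _ g nu0 (kerY_sym p x w M s0 rho)
  (kerY_ge0 p x w M nu s0 rho) in_class hS) _.
by apply: le_of_eq; rewrite /L; ring.
Qed.

End Induction.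

(** * Block estimates for weighted point sets *)

Section Estimates.
Variables (R : realType) (p : R).

Lemma claim_mono (Y : finType) (x w : Y -> R) M alpha rho Q Q' : Q <= Q' ->
  claim p x w M alpha rho Q -> claim p x w M alpha rho Q'.
Proof.
move=> QQ h nu nu0 hs s0 h1 h5 g; apply: le_trans (h nu nu0 hs s0 h1 h5 g) _.
by rewrite ler_wpM2r// nrm_ge0.
Qed.

(** [m] bounds the number of divisions by [K] that lead from [rho] down to [M^(-1/2)]. Since
    [C * 21^m >= Cb], the additive term of a step is absorbed by one more multiple of the bound,
    which turns 20 into 21. Dividing only while [rho^2 M > 1] keeps every radius at least
    [M^(-1/2) / K]. *)
Lemma claim_iter : 1 < p -> exists2 rho1 : R, 0 < rho1 <= 1 &
  forall (k : nat) D alpha, (0 < k)%N -> k.+1%:R <= D -> 0 < alpha < 2 -> exists2 C : R, 0 < C &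
  forall (Y : finType) (x w : Y -> R) M, 1 <= M -> (forall y y', `|x y - x y'| <= D) ->
  forall (m : nat) rho, 0 < rho -> rho <= rho1 -> 1 <= (k.+1%:R * rho) ^+ 2 * M ->
  rho ^+ 2 * M <= k.+1%:R ^+ m ^+ 2 ->
  claim p x w M alpha rho (C * 21 ^+ m * M `^ (- (alpha / 2))).
Proof.
move=> p1; have [ra /andP[ra0 ra1] hbase] := claim_base p1.
have [rb /andP[rb0 rb1] hstep] := claim_step p1.
exists (Num.min ra rb); first by rewrite lt_min ra0 rb0 ge_min ra1.
move=> k D alpha k0 KD hal.
have K1 : 1 <= k.+1%:R :> R by rewrite ler1n.
have K0 : 0 < k.+1%:R :> R by rewrite ltr0n.
have [Ca Ca0 ha] := hbase _ D alpha K1 KD hal.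
have [Cb Cb0 hb] := hstep k D alpha k0 KD hal.
exists (Ca + Cb); first exact: addr_gt0.
move=> Y x w M M1 hD; elim=> [|m IH] rho r0 rr KrM rm.
  rewrite expr0 mulr1; rewrite expr0 expr1n in rm.
  move: rr; rewrite le_min => /andP[rra _].
  apply: claim_mono (ha Y x w M M1 hD rho r0 rra KrM rm).
  by rewrite ler_wpM2r ?powR_ge0// lerDl ltW.
have e1 : 1 <= 21 ^+ m :> R by rewrite exprn_ege1// ler1n.
have Ma := powR_ge0 M (- (alpha / 2)).
have rra : rho <= ra by move: rr; rewrite le_min => /andP[].
have rrb : rho <= rb by move: rr; rewrite le_min => /andP[].
have [rM|rM] := leP (rho ^+ 2 * M) 1.
  apply: claim_mono (ha Y x w M M1 hD rho r0 rra KrM rM).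
  rewrite ler_wpM2r// exprS.
  have : (Ca + Cb) * 1 <= (Ca + Cb) * 21 ^+ m by rewrite ler_wpM2l// ltW// addr_gt0.
  by move: Ca0 Cb0 e1; clear; nra.
have rK : rho / k.+1%:R <= rho by rewrite ler_pdivrMr// ler_peMr// ltW.
have rK0 : 0 < rho / k.+1%:R by rewrite divr_gt0.
apply: claim_mono (hb Y x w M M1 hD rho ((Ca + Cb) * 21 ^+ m * M `^ (- (alpha / 2))) r0 rrb (ltW rM) _ _); last 2 first.
- by rewrite !mulr_ge0 ?exprn_ge0// addr_ge0 ?ltW.
- apply: IH => //.
  + exact: le_trans rr.
  + by rewrite (mulrC _ (rho / _)) divfK ?gt_eqF// ltW.
  rewrite expr_div_n mulrAC ler_pdivrMr ?exprn_gt0// -exprMn.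
  by rewrite -exprSr.
rewrite [leRHS](_ : _ = 20 * ((Ca + Cb) * 21 ^+ m * M `^ (- (alpha / 2))) +
    (Ca + Cb) * 21 ^+ m * M `^ (- (alpha / 2))); last by rewrite exprS; ring.
rewrite lerD2l ler_wpM2r//.
have : (Ca + Cb) * 1 <= (Ca + Cb) * 21 ^+ m by rewrite ler_wpM2l// ltW// addr_gt0.
by move: Ca0; clear; lra.
Qed.

Definition square_sum (Y : finType) (x w nu : Y -> R) M s : R :=
  (\sum_y nu y * cosY p x w M y s) ^+ 2 + (\sum_y nu y * sinY p x w M y s) ^+ 2.

Lemma contI_square_sum (Y : finType) (x w nu : Y -> R) M : contI 1 5 (square_sum x w nu M).
Proof.
by apply: contID; apply: contIX; apply: contI_sum => y; apply: contIM;
  [exact: contI_cst|exact: contI_cosY|exact: contI_cst|exact: contI_sinY].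
Qed.

Lemma square_sum_ge0 (Y : finType) (x w nu : Y -> R) M s : 0 <= square_sum x w nu M s.
Proof. by rewrite addr_ge0// sqr_ge0. Qed.

Lemma bilform_square_sum (Y : finType) (x w nu : Y -> R) M a b om : 1 <= a -> b <= 5 ->
  contI a b om ->
  bilform nu (featk a b (cosY p x w M) (sinY p x w M) om) (fun=> 1) (fun=> 1) =
  intg a b (fun s => om s * square_sum x w nu M s).
Proof.
move=> a1 b5 com; rewrite bilform_featk//.
- apply: eq_intg => s _; rewrite /square_sum -!expr2.
  by under eq_bigr do rewrite mul1r; under [X in _ + X ^+ 2]eq_bigr do rewrite mul1r.
- by move=> y; apply: (@contI_sub _ 1 5) => //; exact: contI_cosY.
- by move=> y; apply: (@contI_sub _ 1 5) => //; exact: contI_sinY.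
Qed.

Lemma nrm1 (Y : finType) (nu : Y -> R) : nrm nu (fun=> 1) = \sum_y nu y.
Proof. by apply: eq_bigr => y _; rewrite expr1n mulr1. Qed.

(** The nearest centre is within half a radius, where the bump is at least 9/16, as in [arc_cover];
    the centres include 2 and 4, so the ends need no separate argument. *)
Lemma arcs_cover (n : nat) (s : R) : (0 < n)%N -> 2 <= s <= 4 ->
  1 <= 2 * \sum_(j < n.*2.+1) arc (2 + j%:R / n%:R) n%:R^-1 s.
Proof.
move=> n0 /andP[s2 s4]; have N0 : 0 < n%:R :> R by rewrite ltr0n.
pose v := (s - 2) * n%:R + 2^-1.
have v0 : 0 <= v by rewrite addr_ge0// mulr_ge0 ?(ltW N0)// subr_ge0.
have /andP[j1 j2] := truncn_itv v0; set j := Num.truncn v in j1 j2.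
have jn : (j < n.*2.+1)%N.
  have : (s - 2) * n%:R <= 2 * n%:R by rewrite ler_pM2r//; lra.
  move=> h; rewrite -(ltr_nat R) (le_lt_trans j1)// /v -(natr1 n.*2) -addnn natrD.
  by move: h; clear; lra.
have hy : `|s - (2 + j%:R / n%:R)| <= 2^-1 * n%:R^-1.
  have -> : s - (2 + j%:R / n%:R) = ((s - 2) * n%:R - j%:R) / n%:R by field; rewrite gt_eqF.
  rewrite normrM (ger0_norm (_ : 0 <= n%:R^-1)) ?invr_ge0 ?(ltW N0)// ler_pM2r ?invr_gt0//.
  move: j1 j2; rewrite -natr1 /v ler_norml => j1 j2; apply/andP; split; lra.
have h9 : 2^-1 <= arc (2 + j%:R / n%:R) n%:R^-1 s.
  rewrite arc_in ?invr_gt0//; last first.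
    by apply: (le_trans hy); rewrite ler_piMl ?invr_ge0 ?(ltW N0)//; lra.
  set t := (s - _) / _.
  have t2 : t ^+ 2 <= 4^-1.
    rewrite -real_normK ?num_real// (_ : 4^-1 = (2^-1) ^+ 2); last by field.
    apply: lerXn2r; rewrite ?nnegrE ?normr_ge0//.
    by rewrite normrM normfV (gtr0_norm (_ : 0 < n%:R^-1)) ?invr_gt0// ler_pdivrMr ?invr_gt0.
  have := sqr_ge0 t; move: t2; clear; nra.
rewrite (bigD1 (Ordinal jn))//= mulrDr.
have : 0 <= 2 * \sum_(i < n.*2.+1 | i != Ordinal jn) arc (2 + i%:R / n%:R) n%:R^-1 s.
  by rewrite mulr_ge0// sumr_ge0// => i _; exact: arc_ge0.
by move: h9; clear; lra.
Qed.

Lemma intg_sub_le (a b : R) f : 1 <= a -> a <= b -> b <= 5 -> contI 1 5 f ->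
  (forall s, 0 <= f s) -> intg a b f <= intg 1 5 f.
Proof.
move=> a1 ab b5 cf f0.
rewrite (@intg_split _ 1 5 _ a)//; last by apply/andP; split; lra.
rewrite (@intg_split _ a 5 _ b); last 2 first.
- by apply/andP; split.
- exact: contI_sub cf.
have h1 : 0 <= intg 1 a f by exact: intg_ge0.
have h2 : 0 <= intg b 5 f by exact: intg_ge0.
lra.
Qed.

(** The block is covered by arcs of radius [1 / n <= rho1]. [K = k + 1] is taken so large that
    [K^eps >= 21]; with [m] least such that [M <= K^m], the loss [21^m] is at most
    [K^(eps m) <= K^eps M^eps]. Also [K >= n], so these arcs lie above the base scale, and [D] is
    enlarged to at least [K] as the induction demands. *)
Theorem wolff_estimate (alpha eps D : R) : 1 < p -> 0 < alpha < 2 -> 0 < eps ->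
  exists2 C : R, 0 < C & forall (Y : finType) (x w nu : Y -> R) M, 1 <= M ->
  (forall y, 0 <= nu y) -> spread M alpha x w nu -> (forall y y', `|x y - x y'| <= D) ->
  intg 2 4 (square_sum x w nu M) <= C * M `^ (eps - alpha / 2) * \sum_y nu y.
Proof.
have [l12 l24 l45] : [/\ 1 <= 2 :> R, 2 <= 4 :> R & 4 <= 5 :> R] by split; lra.
move=> p1 hal eps0; have [rho1 /andP[r10 r11] hiter] := claim_iter p1.
pose n := (Num.bound rho1^-1).+1.
have n0 : (0 < n)%N by [].
have N0 : 0 < n%:R :> R by rewrite ltr0n.
have nr : n%:R^-1 <= rho1.
  rewrite -[leRHS]invrK lef_pV2 ?posrE ?invr_gt0//.
  apply: ltW; apply: lt_le_trans (archi_boundP _) _; first by rewrite invr_ge0 ltW.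
  by rewrite ler_nat.
pose q := Num.bound (21 `^ eps^-1 : R).
pose k := (n + q).+1.
have Kn : n%:R <= k.+1%:R :> R by rewrite ler_nat /k leqW// leqW// leq_addr.
have Kq : 21 <= k.+1%:R `^ eps :> R.
  have -> : (21:R) = (21 `^ eps^-1) `^ eps by rewrite -powRrM mulVf ?powRr1// gt_eqF.
  apply: ge0_ler_powR; rewrite ?nnegrE ?powR_ge0 ?(ltW eps0)//.
  apply: ltW; apply: lt_le_trans (archi_boundP _) _; first exact: powR_ge0.
  by rewrite ler_nat /k -/q leqW// leqW// leq_addl.
have K0 : 0 < k.+1%:R :> R by rewrite ltr0n.
have KD : k.+1%:R <= Num.max D k.+1%:R by rewrite le_max lexx orbT.
have [C C0 hC] := hiter k (Num.max D k.+1%:R) alpha isT KD hal.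
pose C' := 2 * n.*2.+1%:R * (C * k.+1%:R `^ eps).
exists C'; first by rewrite /C' !mulr_gt0 ?powR_gt0// ltr0n.
move=> Y x w nu M M1 nu0 hs hD.
have M0 : 0 < M by lra.
have hD' y y' : `|x y - x y'| <= Num.max D k.+1%:R by rewrite le_max hD.
have hex : exists m, M <= k.+1%:R ^+ m.
  exists (Num.bound M); apply: ltW; apply: lt_le_trans (archi_boundP _) _; first exact: ltW.
  by rewrite -natrX ler_nat ltnW// ltn_expl.
pose m := ex_minn hex.
have [hm hmin] : M <= k.+1%:R ^+ m /\ forall i, M <= k.+1%:R ^+ i -> (m <= i)%N.
  by rewrite /m; case: ex_minnP.
have e21 : 21 ^+ m <= k.+1%:R `^ eps * M `^ eps.
  have M_eps : 1 <= M `^ eps.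
    by rewrite -[leLHS](powRr0 M); apply: ler_powR => //; exact: ltW.
  have K_eps : 1 <= k.+1%:R `^ eps :> R.
    by rewrite -[leLHS](powRr0 (k.+1%:R:R)); apply: ler_powR; rewrite ?ler1n// ltW.
  case: (posnP m) => [->|m0]; first by rewrite expr0 mulr_ege1.
  have mi : k.+1%:R ^+ m.-1 < M.
    by rewrite ltNge; apply/negP => /hmin; rewrite -ltnS prednK// ltnn.
  apply: (@le_trans _ _ ((k.+1%:R `^ eps) ^+ m)).
    by apply: lerXn2r => //; rewrite nnegrE ?powR_ge0.
  rewrite -{1}(prednK m0) exprS ler_wpM2l ?powR_ge0//.
  rewrite -(powR_mulrn _ (powR_ge0 _ _)) powRAC powR_mulrn ?ler0n//.
  by apply: ge0_ler_powR; rewrite ?nnegrE ?(ltW eps0) ?exprn_ge0 ?(ltW mi) ?(ltW M0).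
have cS : contI 1 5 (square_sum x w nu M) by exact: contI_square_sum.
have carc j : contI 1 5 (fun s => arc (2 + j%:R / n%:R) n%:R^-1 s * square_sum x w nu M s).
  by apply: contIM => //; exact: contI_arc.
have hj (j : 'I_n.*2.+1) : intg 1 5 (fun s => arc (2 + j%:R / n%:R) n%:R^-1 s * square_sum x w nu M s)
   <= C * 21 ^+ m * M `^ (- (alpha / 2)) * \sum_y nu y.
  rewrite -bilform_square_sum// -?kerYE -?nrm1; last exact: contI_arc.
  have nV1 : n%:R^-1 <= 1 :> R by rewrite invf_le1// ler1n.
  have nV0 : 0 < n%:R^-1 :> R by rewrite invr_gt0.
  apply: (hC Y x w M M1 hD' m n%:R^-1) => //.
  - have h1 : 1 <= (k.+1%:R / n%:R) ^+ 2 :> R.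
      by rewrite expr_ge1// ?ler_pdivlMr ?mul1r// divr_ge0// ltW.
    by rewrite -[leLHS]mul1r; apply: ler_pM.
  - apply: (@le_trans _ _ M); first by rewrite ler_piMl ?(ltW M0)// expr_le1// ltW.
    by apply: (le_trans hm); rewrite expr2 ler_peMr ?exprn_ge0// exprn_ege1// ler1n.
  - have : 0 <= j%:R / n%:R :> R by rewrite divr_ge0// ltW.
    by move: nV1; clear; lra.
  - have : j%:R / n%:R <= 2 :> R.
      by rewrite ler_pdivrMr// -natrM ler_nat mul2n -ltnS.
    by move: nV1; clear; lra.
apply: (@le_trans _ _ (2 * \sum_(j < n.*2.+1) intg 1 5 (fun s => arc (2 + j%:R / n%:R) n%:R^-1 s * square_sum x w nu M s))).
  rewrite -intg_sum// -intgZ; last by apply: contI_sum => j; exact: carc.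
  apply: (@le_trans _ _ (intg 2 4 (fun s => 2 * \sum_(j < n.*2.+1) (arc (2 + j%:R / n%:R) n%:R^-1 s * square_sum x w nu M s)))).
    apply: le_intg.
    - exact: (contI_sub l12 l45 cS).
    - apply: (contI_sub l12 l45); apply: contIM; first exact: contI_cst.
      by apply: contI_sum => j; exact: carc.
    move=> s hs24; rewrite -mulr_suml mulrA -[leLHS]mul1r ler_wpM2r ?square_sum_ge0//.
    exact: arcs_cover.
  apply: intg_sub_le => //.
    by apply: contIM; [exact: contI_cst|apply: contI_sum => j; exact: carc].
  move=> s; rewrite mulr_ge0// sumr_ge0// => j _.
  by rewrite mulr_ge0 ?arc_ge0 ?square_sum_ge0.
have nu_ge0 : 0 <= \sum_y nu y by exact: sumr_ge0.
apply: (@le_trans _ _ (2 * (n.*2.+1%:R * (C * 21 ^+ m * M `^ (- (alpha / 2)) * \sum_y nu y)))).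
  rewrite ler_pM2l// (le_trans (ler_sum _ (fun j _ => hj j)))//.
  by rewrite sumr_const card_ord -[leLHS]mulr_natl.
have -> : M `^ (eps - alpha / 2) = M `^ eps * M `^ (- (alpha / 2)).
  by rewrite powRD// (gt_eqF M0) implybT.
have -> : C' * (M `^ eps * M `^ (- (alpha / 2))) * \sum_y nu y =
  2 * (n.*2.+1%:R * (C * (k.+1%:R `^ eps * M `^ eps) * M `^ (- (alpha / 2)) * \sum_y nu y)).
  by rewrite /C'; ring.
rewrite ler_pM2l// ler_wpM2l// ler_wpM2r// ler_wpM2r ?powR_ge0// ler_wpM2l//.
exact: ltW.
Qed.

(** The kernel is [O(q^(-1/2))] with [q = M (|x - x'| + |v - v'|)], the smaller [v] replacing [w].
    Taking [f = q^(1/4)] turns this into the decay [f^(-2)] of [layer_sum]. The mass of [f <= T]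
    then grows like [T^(4 a)], and the requirement [4 a < 2] is the source of [a < 1/2]. *)
Theorem energy_estimate (a : R) : 1 < p -> 0 < a < 1 / 2 ->
  exists2 C : R, 0 < C & forall (Y : finType) (x v w nu : Y -> R) M, 1 <= M ->
  (forall y, 0 <= nu y) -> spread M a x v nu ->
  (forall y y', `|v y - v y'| <= `|w y - w y'|) ->
  intg 2 4 (square_sum x w nu M) <= C * M `^ (- a) * \sum_y nu y.
Proof.
move=> p1 /andP[a0 a2]; have [C C0 hC] := van_der_corput p1.
pose Ca : R := 4 / (1 - 2 `^ (4 * a) / 4).
have a42 : 0 < 4 * a < 2 by apply/andP; split; lra.
have Ca0 : 0 < Ca by apply: layer_const_gt0; case/andP: a42.
exists (Ca * 2 `^ a * (2 + C)).
  by apply: mulr_gt0; [apply: mulr_gt0 => //; exact: powR_gt0|exact: addr_gt0].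
move=> Y x v w nu M M1 nu0 hs hvw.
have M0 : 0 < M by lra.
pose k := featk 2 4 (cosY p x w M) (sinY p x w M) (fun=> 1).
have kE y y' : k y y' = intg 2 4 (fun s => cos (theta p M (x y - x y') (w y - w y') s)).
  by apply: eq_intg => s _; rewrite mul1r cos_theta_sub.
have -> : intg 2 4 (square_sum x w nu M) = bilform nu k (fun=> 1) (fun=> 1).
  rewrite bilform_square_sum; [|lra|lra|exact: contI_cst].
  by apply: eq_intg => s _; rewrite mul1r.
rewrite -nrm1; apply: schur_test => //; first by move=> y y'; exact: featk_sym.
move=> y.
pose q y' := M * (`|x y - x y'| + `|v y - v y'|).
have q0 y' : 0 <= q y' by rewrite mulr_ge0 ?addr_ge0// ltW.
pose f y' := Num.sqrt (Num.sqrt (q y')).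
have f0 y' : 0 <= f y' by exact: sqrtr_ge0.
have f2 y' : f y' ^+ 2 = Num.sqrt (q y') by rewrite sqr_sqrtr// sqrtr_ge0.
have f4 y' : f y' ^+ 4 = q y' by rewrite (exprM _ 2 2) f2 sqr_sqrtr.
have k2 y' : `|k y y'| <= 2.
  rewrite kE; apply: (@le_trans _ _ (1 * (4 - 2))); last by lra.
  apply: intg_abs_le; first lra.
    by apply: (@contI_sub _ 1 5); [lra|lra|exact: contI_costheta].
  by move=> s _; rewrite ler_norml cos_geN1 cos_le1.
have kq y' : `|k y y'| * f y' ^+ 2 <= 1 + C.
  have h : (`|k y y'| * f y' ^+ 2) ^+ 2 <= C.
    rewrite exprMn real_normK ?num_real// -exprM f4 kE.
    apply: (@le_trans _ _ (intg 2 4 (fun s => cos (theta p M (x y - x y') (w y - w y') s)) ^+ 2 *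
        (M * (`|x y - x y'| + `|w y - w y'|)))).
      by rewrite ler_wpM2l ?sqr_ge0// ler_pM2l// lerD2l.
    apply: hC => //; lra.
  have := sqr_ge0 (`|k y y'| * f y' ^+ 2 - 1); move: h C0; clear; set t := _ * _; nra.
have := @layer_sum R Y nu f (fun y' => `|k y y'|) (4 * a) ((2 / M) `^ a) (2 + C) a42.
rewrite -/Ca => H; apply: le_trans (H _ _ _ _ _ _ _) _ => //.
- exact: powR_ge0.
- by rewrite addr_ge0// ltW.
- move=> T T1; have T0 : 0 < T by lra.
  have T4 : 1 <= T ^+ 4 by rewrite exprn_ege1.
  pose b := T ^+ 4 / M.
  have b0 : 0 < b by rewrite divr_gt0// exprn_gt0.
  have -> : (2 / M) `^ a * T `^ (4 * a) = (2 * b) `^ a.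
    have -> : 2 * b = (2 / M) * T ^+ 4 by rewrite /b; ring.
    rewrite [RHS]powRM ?exprn_ge0 ?divr_ge0 ?(ltW T0) ?(ltW M0)//.
    by rewrite -(powR_mulrn 4 (ltW T0)) -powRrM.
  have Mb : M^-1 <= 2 * b.
    rewrite /b mulrA -[leLHS]mul1r ler_pM2r ?invr_gt0//.
    by move: T4; clear; lra.
  apply: le_trans (hs (x y - b) (v y - b) _ Mb).
  apply: ler_sum_pred => // y' fT.
  have qT : q y' <= T ^+ 4.
    by rewrite -f4; apply: lerXn2r; rewrite ?nnegrE ?f0 ?(ltW T0).
  have : `|x y - x y'| + `|v y - v y'| <= b by rewrite /b ler_pdivlMr// mulrC.
  move=> hb.
  have hx : `|x y - x y'| <= b by apply: le_trans hb; rewrite lerDl.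
  have hv : `|v y - v y'| <= b by apply: le_trans hb; rewrite lerDr.
  clear -hx hv; move: hx hv; rewrite !ler_norml => /andP[? ?] /andP[? ?].
  by apply/andP; split; apply/andP; split; lra.
- by move=> y'; apply: (le_trans (k2 y')); rewrite lerDl ltW.
- by move=> y'; apply: (le_trans (kq y')); rewrite lerD2r ler1n.
rewrite powRM ?invr_ge0 ?(ltW M0)//.
have -> : M^-1 `^ a = M `^ (- a) by rewrite -(powR_inv1 (ltW M0)) -powRrM mulN1r.
by apply: le_of_eq; ring.
Qed.

End Estimates.

(** * Discretization of a Frostman measure *)

Section PlaneGeometry.
Variable R : realType.
Implicit Types (x y z : plane R) (r : R) (mu : {measure set (plane R) -> \bar R}).

Lemma le_edist x y : `|x.1 - y.1| <= Defs.edist x y /\ `|x.2 - y.2| <= Defs.edist x y.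
Proof.
by split; rewrite /Defs.edist -sqrtr_sqr ler_wsqrtr// ?lerDl ?lerDr sqr_ge0.
Qed.

Lemma edist_le x y : Defs.edist x y <= `|x.1 - y.1| + `|x.2 - y.2|.
Proof.
have -> : `|x.1 - y.1| + `|x.2 - y.2| = Num.sqrt ((`|x.1 - y.1| + `|x.2 - y.2|) ^+ 2).
  by rewrite sqrtr_sqr [RHS]ger0_norm// addr_ge0.
rewrite /Defs.edist ler_wsqrtr//.
rewrite [leRHS]sqrrD !real_normK ?num_real//.
have : 0 <= `|x.1 - y.1| * `|x.2 - y.2| by rewrite mulr_ge0.
by rewrite mulr2n; lra.
Qed.

Lemma measurable_eball y r : measurable (eball y r).
Proof.
have mf : measurable_fun setT (fun x => Defs.edist y x).
  apply: (@measurableT_comp _ _ _ _ _ _ (@Num.sqrt R)).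
    by apply: continuous_measurable_fun; exact: sqrt_continuous.
  apply: measurable_funD; apply: measurable_funX; apply: measurable_funB;
    [exact: measurable_cst|exact: measurable_fst|exact: measurable_cst|exact: measurable_snd].
have -> : eball y r = setT `&` (fun x => Defs.edist y x) @^-1` [set t | t < r].
  by rewrite setTI.
apply: mf => //.
have -> : [set t | t < r] = `]-oo, r[%classic by apply/seteqP; split => t /=; rewrite in_itv.
exact: measurable_itv.
Qed.

(** A point off the support has a null ball around it, which contains a ball around the point with
    rational centre and radius [1 / (n + 1)]. There are countably many of these; [unpickle] lists
    them as a sequence, with the empty set for idle codes and for balls of positive mass. *)
Lemma negligible_msupportC mu : mu.-negligible (~` msupport mu).
Proof.
pose B (i : rat * rat * nat) : set (plane R) := eball (ratr i.1.1, ratr i.1.2) (i.2.+1%:R)^-1.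
pose V (n : nat) : set (plane R) :=
  if unpickle n is Some i then (if mu (B i) == 0 then B i else set0) else set0.
apply: (@negligibleS _ _ _ _ (\bigcup_n V n)); last first.
  apply: negligible_bigcup => n; rewrite /V; case: unpickle => [i|]; last exact: negligible_set0.
  case: eqP => [h|_]; last exact: negligible_set0.
  by exists (B i); split => //; exact: measurable_eball.
move=> x /= /existsNP [r /not_implyP [r0 /negP]]; rewrite -leNgt => mur.
have mu0 : mu (eball x r) = 0 by apply/eqP; rewrite eq_le mur measure_ge0.
pose n := Num.bound (4 / r).
have n4 : 4 * (n.+1%:R)^-1 < r.
  rewrite ltr_pdivrMr ?ltr0n// -ltr_pdivrMl//.
  rewrite mulrC (lt_le_trans (archi_boundP _))//; first by rewrite divr_ge0// ltW.
  by rewrite ler_nat.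
set e := (n.+1%:R)^-1 : R in n4.
have e0 : 0 < e by rewrite invr_gt0 ltr0n.
have [q1] := @rat_in_itvoo R (x.1 - e / 2) (x.1 + e / 2) (ltac:(lra)).
have [q2] := @rat_in_itvoo R (x.2 - e / 2) (x.2 + e / 2) (ltac:(lra)).
rewrite !in_itv/= => /andP[q2a q2b] /andP[q1a q1b].
have xq1 : `|ratr q1 - x.1| < e / 2 by rewrite ltr_norml; apply/andP; split; lra.
have xq2 : `|ratr q2 - x.2| < e / 2 by rewrite ltr_norml; apply/andP; split; lra.
exists (pickle (q1, q2, n)); [exact: I|rewrite /V pickleK].
have Bsub : B (q1, q2, n) `<=` eball x r.
  move=> z hz0; have hz : Defs.edist (ratr q1, ratr q2) z < e by exact: hz0.
  have [h1 h2] := le_edist (ratr q1, ratr q2) z; rewrite /= in h1 h2.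
  apply: le_lt_trans (edist_le _ _) _.
  have := ler_normB (x.1 - ratr q1) (z.1 - ratr q1); rewrite opprB addrA subrK => g1.
  have := ler_normB (x.2 - ratr q2) (z.2 - ratr q2); rewrite opprB addrA subrK => g2.
  move: g1 g2; rewrite (distrC x.1 (ratr q1)) (distrC x.2 (ratr q2)) (distrC z.1 (ratr q1)) (distrC z.2 (ratr q2)) => g1 g2.
  by move: e0 g1 g2 h1 h2 hz xq1 xq2 n4; clear; lra.
have muB : mu (B (q1, q2, n)) = 0.
  apply/eqP; rewrite eq_le measure_ge0 andbT -mu0; apply: le_measure => //;
    rewrite inE; exact: measurable_eball.
rewrite muB eqxx /B /Defs.eball/=.
apply: le_lt_trans (edist_le _ _) _; rewrite /= -/e; lra.
Qed.

Lemma msupport_box mu d : compact (msupport mu) -> ediam (msupport mu) = d ->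
  exists c : plane R, forall x, msupport mu x -> `|x.1 - c.1| <= d /\ `|x.2 - c.2| <= d.
Proof.
move=> cS dS; have [[c Sc]|none] := pselect (exists c, msupport mu c); last first.
  by exists (0, 0) => x Sx; exfalso; apply: none; exists x.
exists c => x Sx.
have bnd (f : plane R -> R) : continuous f -> exists B, forall z, msupport mu z -> `|f z| <= B.
  move=> cf; have : compact (f @` msupport mu).
    by apply: continuous_compact => //; exact: continuous_subspaceT.
  move/(@compact_bounded R R^o) => [B [_ hB]]; exists (`|B| + 1) => z Sz.
  by apply: hB; [rewrite ltr_pwDr// ler_norm|exists z].
have [B1 hB1] := bnd fst (fun z => cvg_fst).
have [B2 hB2] := bnd snd (fun z => cvg_snd).
(* [sup] is 0 on unbounded sets, so boundedness must be known before the diameter controls any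
   distance. *)
have ub : has_ubound [set Defs.edist z.1 z.2 | z in msupport mu `*` msupport mu].
  exists (B1 + B1 + (B2 + B2)) => _ [[z z'] [/= Sz Sz'] <-].
  apply: le_trans (edist_le _ _) _; apply: lerD; apply: (le_trans (ler_normB _ _)).
    by apply: lerD; exact: hB1.
  by apply: lerD; exact: hB2.
have : Defs.edist x c <= d.
  rewrite -dS /ediam; apply: ub_le_sup => //.
  by exists (x, c).
by have [h1 h2] := le_edist x c; move=> h; split; exact: le_trans h.
Qed.

End PlaneGeometry.

(** * Integrals of bounded functions against a finite measure *)

Section FiniteMeasureIntegral.
Variables (R : realType) (mu : {measure set (plane R) -> \bar R}).
Implicit Types f g : plane R -> R.

Definition nice f := measurable_fun setT f /\ exists B, forall x, `|f x| <= B.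

Definition mean f : R := (\int[mu]_x f x)%R.

Lemma nice_cst c : nice (fun=> c).
Proof. by split; [exact: measurable_cst|exists `|c|]. Qed.

Lemma niceD f g : nice f -> nice g -> nice (fun x => f x + g x).
Proof.
move=> [mf [B hB]] [mg [C hC]]; split; first exact: measurable_funD.
exists (B + C) => x; apply: (le_trans (ler_normD _ _)); exact: lerD.
Qed.

Lemma niceM f g : nice f -> nice g -> nice (fun x => f x * g x).
Proof.
move=> [mf [B hB]] [mg [C hC]]; split; first exact: measurable_funM.
by exists (B * C) => x; rewrite normrM; exact: ler_pM.
Qed.

Lemma nice_norm f : nice f -> nice (fun x => `|f x|).
Proof.
move=> [mf [B hB]]; split; first exact: measurableT_comp.
by exists B => x; rewrite normr_id.
Qed.

Lemma nice_sum (T : Type) (s : seq T) (P : pred T) (F : T -> plane R -> R) :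
  (forall i, nice (F i)) -> nice (fun x => \sum_(i <- s | P i) F i x).
Proof.
move=> hF; elim: s => [|i s IH].
  by under eq_fun do rewrite big_nil; exact: nice_cst.
by under eq_fun do rewrite big_cons; case: (P i) => //; exact: niceD.
Qed.

Lemma nice_indic A : measurable A -> nice (\1_A : plane R -> R).
Proof.
move=> mA; split; first exact: measurable_indic.
by exists 1 => x; rewrite /indic; case: (_ \in _); rewrite ?normr1 ?normr0.
Qed.

Hypothesis muT : (mu setT < +oo)%E.

Lemma nice_integrable f : nice f -> mu.-integrable setT (EFin \o f).
Proof.
move=> [mf [B hB]]; apply: measurable_bounded_integrable => //.
exists B; split; first exact: num_real.
by move=> C BC x _; exact: le_trans (hB x) (ltW BC).
Qed.

Lemma meanD f g : nice f -> nice g -> mean (fun x => f x + g x) = mean f + mean g.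
Proof. by move=> hf hg; apply: RintegralD => //; exact: nice_integrable. Qed.

Lemma meanZ c f : nice f -> mean (fun x => c * f x) = c * mean f.
Proof. by move=> hf; apply: RintegralZl => //; exact: nice_integrable. Qed.

Lemma meanB f g : nice f -> nice g -> mean (fun x => f x - g x) = mean f - mean g.
Proof. by move=> hf hg; apply: RintegralB => //; exact: nice_integrable. Qed.

Lemma mean_le f g : nice f -> nice g -> (forall x, f x <= g x) -> mean f <= mean g.
Proof. by move=> hf hg fg; apply: le_Rintegral => //; exact: nice_integrable. Qed.

Lemma mean_norm f : nice f -> `|mean f| <= mean (fun x => `|f x|).
Proof. by move=> hf; apply: le_normr_Rintegral => //; exact: nice_integrable. Qed.

Lemma mean_indic A : measurable A -> mean (\1_A : plane R -> R) = fine (mu A).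
Proof. by move=> mA; rewrite /mean /Rintegral integral_indic// setIT. Qed.

Lemma mean_cst c : mean (fun=> c) = c * fine (mu setT).
Proof. by rewrite /mean Rintegral_cst. Qed.

Lemma mean_sum (T : Type) (s : seq T) (P : pred T) (F : T -> plane R -> R) :
  (forall i, nice (F i)) ->
  mean (fun x => \sum_(i <- s | P i) F i x) = \sum_(i <- s | P i) mean (F i).
Proof.
move=> hF; elim: s => [|i s IH].
  by under [X in mean X]eq_fun do rewrite big_nil; rewrite mean_cst mul0r big_nil.
under [X in mean X]eq_fun do rewrite big_cons; rewrite big_cons -IH; case: (P i) => //.
by rewrite meanD//; exact: nice_sum.
Qed.

End FiniteMeasureIntegral.

(** * Grid cells and the discretized measure *)

Section Cells.
Variable R : realType.
Implicit Types (b h t : R).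

Definition cellI b h (i : nat) : set R := `[b + i%:R * h, b + i.+1%:R * h[%classic.

Lemma cellIP b h i t : cellI b h i t <-> b + i%:R * h <= t < b + i.+1%:R * h.
Proof. by rewrite /cellI/= in_itv. Qed.

Lemma cellI_ex b h n t : 0 < h -> b <= t < b + n%:R * h -> exists i : 'I_n, cellI b h i t.
Proof.
move=> h0 /andP[bt tn].
have v0 : 0 <= (t - b) / h by rewrite divr_ge0 ?(ltW h0)// subr_ge0.
have /andP[i1 i2] := truncn_itv v0.
rewrite ler_pdivlMr// in i1; rewrite ltr_pdivrMr// in i2.
have iltn : (Num.truncn ((t - b) / h) < n)%N.
  rewrite -(ltr_nat R) -(ltr_pM2r h0); apply: le_lt_trans i1 _; lra.
exists (Ordinal iltn); apply/cellIP; rewrite /=; apply/andP; split; lra.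
Qed.

Lemma cellI_uniq b h i j t : 0 < h -> cellI b h i t -> cellI b h j t -> i = j.
Proof.
move=> h0 /cellIP /andP[i1 i2] /cellIP /andP[j1 j2].
have ij : i%:R * h < j.+1%:R * h by lra.
have ji : j%:R * h < i.+1%:R * h by lra.
by move: ij ji; rewrite !ltr_pM2r// !ltr_nat; lia.
Qed.

Lemma cellI_dist b h i t : cellI b h i t -> `|t - (b + i%:R * h)| <= h.
Proof.
move=> /cellIP; rewrite -natr1 mulrDl mul1r => /andP[i1 i2].
by rewrite ler_norml; apply/andP; split; lra.
Qed.

Lemma measurable_cellI b h i : measurable (cellI b h i).
Proof. exact: measurable_itv. Qed.

End Cells.

Section Discretization.
Variables (R : realType) (mu : {measure set (plane R) -> \bar R}).
Variables (A alpha d : R).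
Hypothesis A0 : 0 < A.
Hypothesis d0 : 0 <= d.
Hypothesis cS : compact (msupport mu).
Hypothesis dS : ediam (msupport mu) = d.
Hypothesis frost : forall (y : plane R) (r : R), 0 < r ->
  (mu (eball y r) <= (A * r `^ alpha)%:E)%E.

(** The margin 1 absorbs the half-open sides and keeps the box nondegenerate when [d = 0]. *)
Definition box (c : plane R) : set (plane R) :=
  `[c.1 - (d + 1), c.1 + (d + 1)[%classic `*` `[c.2 - (d + 1), c.2 + (d + 1)[%classic.

(** The Frostman bound for a ball that contains [box]; it controls the total mass by [A], [alpha]
    and [d] alone. *)
Definition mass_bound : R := A * (4 * (d + 1)) `^ alpha.

Lemma measurable_box c : measurable (box c).
Proof. by apply: measurableX; exact: measurable_itv. Qed.

Lemma ex_box : exists c, mu (~` box c) = 0.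
Proof.
have [c hc] := msupport_box cS dS; exists c.
apply: measure_negligible; first by apply: measurableC; exact: measurable_box.
apply: negligibleS (negligible_msupportC mu) => x nx Sx; apply: nx.
have [h1 h2] := hc x Sx; move: h1 h2; rewrite !ler_norml => /andP[? ?] /andP[? ?].
by split => /=; rewrite in_itv/=; apply/andP; split; lra.
Qed.

Lemma mass_le : (mu setT <= mass_bound%:E)%E.
Proof.
have [c hc] := ex_box; have r0 : 0 < 4 * (d + 1) by have := d0; lra.
rewrite -(setvU (box c)); apply: (@le_trans _ _ (mu (~` box c) + mu (box c))%E).
  by apply: measureU2; [apply: measurableC|]; exact: measurable_box.
rewrite hc add0e; apply: le_trans (frost c r0); apply: le_measure; rewrite ?inE.
- exact: measurable_box.
- exact: measurable_eball.
move=> x [/=]; rewrite !in_itv/= => /andP[a1 a2] /andP[b1 b2].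
apply: le_lt_trans (edist_le _ _) _.
have h1 : `|c.1 - x.1| <= d + 1 by rewrite ler_norml; apply/andP; split; lra.
have h2 : `|c.2 - x.2| <= d + 1 by rewrite ler_norml; apply/andP; split; lra.
by move: h1 h2 r0; lra.
Qed.

Lemma mass_fin : (mu setT < +oo)%E.
Proof. exact: le_lt_trans mass_le (ltry _). Qed.

Lemma fine_mass_le : fine (mu setT) <= mass_bound.
Proof.
rewrite -lee_fin fineK ?mass_le// ge0_fin_numE//; exact: mass_fin.
Qed.

Lemma mass_bound_gt0 : 0 < mass_bound.
Proof. by rewrite mulr_gt0// powR_gt0//; have := d0; lra. Qed.

Lemma discretize (h0 : R) : 0 < h0 -> exists (Y : finType) (x v nu : Y -> R),
  [/\ (forall y, 0 <= nu y) /\ \sum_y nu y <= mass_bound,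
      forall y y', `|x y - x y'| <= 2 * (d + 1),
      forall a1 a2 r, h0 <= r ->
        \sum_(y | (a1 <= x y <= a1 + r) && (a2 <= v y <= a2 + r)) nu y <= A * (4 * r) `^ alpha
    & forall (f : plane R -> R) (L : R), measurable_fun setT f -> (forall z, `|f z| <= 1) -> 0 <= L ->
        (forall z z', `|f z - f z'| <= L * (`|z.1 - z'.1| + `|z.2 - z'.2|)) ->
        `|mean mu f - \sum_y nu y * f (x y, v y)| <= L * h0 * mass_bound].
Proof.
move=> h00; have [c hc] := ex_box; have muT := mass_fin.
pose r1 := d + 1; have r10 : 0 < r1 by rewrite /r1; have := d0; lra.
pose n := (Num.bound (4 * r1 / h0)).+1.
have n0 : 0 < n%:R :> R by rewrite ltr0n.
pose h := 2 * r1 / n%:R.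
have hp : 0 < h by rewrite divr_gt0// mulr_gt0.
have nh : n%:R * h = 2 * r1 by rewrite /h; field; rewrite gt_eqF.
have hh : h <= h0 / 2.
  rewrite /h ler_pdivrMr//.
  have : 4 * r1 / h0 <= n%:R.
    apply: ltW; apply: lt_le_trans (archi_boundP _) _; first by rewrite divr_ge0 ?(ltW h00)// mulr_ge0// ltW.
    by rewrite ler_nat.
  by rewrite ler_pdivrMr//; lra.
pose b1 := c.1 - r1; pose b2 := c.2 - r1.
pose cell (y : 'I_n * 'I_n) : set (plane R) := cellI b1 h y.1 `*` cellI b2 h y.2.
pose x (y : 'I_n * 'I_n) : R := b1 + y.1%:R * h.
pose v (y : 'I_n * 'I_n) : R := b2 + y.2%:R * h.
pose nu (y : 'I_n * 'I_n) : R := mean mu (\1_(cell y)).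
have mcell y : measurable (cell y) by apply: measurableX; exact: measurable_cellI.
have ncell y : nice (\1_(cell y) : plane R -> R) by exact: nice_indic.
have uniq z y y' : cell y z -> cell y' z -> y = y'.
  case: y y' => [i j] [i' j'] [/= h1 h2] [/= h1' h2'].
  by rewrite (ord_inj (cellI_uniq hp h1 h1')) (ord_inj (cellI_uniq hp h2 h2')).
have sumin (P : pred ('I_n * 'I_n)) (g : 'I_n * 'I_n -> R) z y : cell y z ->
    \sum_(y' | P y') g y' * \1_(cell y') z = if P y then g y else 0.
  move=> cz; rewrite big_mkcond (bigD1 y)//= big1 ?addr0 => [|y' yy'].
    by rewrite indicE mem_set// mulr1.
  case: ifP => // _; rewrite indicE memNset ?mulr0// => cz'.
  by move: yy'; rewrite (uniq _ _ _ cz' cz) eqxx.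
have sumout (P : pred ('I_n * 'I_n)) (g : 'I_n * 'I_n -> R) z : ~ (exists y, cell y z) ->
    \sum_(y' | P y') g y' * \1_(cell y') z = 0.
  move=> nz; apply: big1 => y' _; rewrite indicE memNset ?mulr0// => cz'.
  by apply: nz; exists y'.
have inbox z : box c z -> exists y, cell y z.
  move=> [/=]; rewrite !in_itv/= -/r1 => z1 z2.
  have [i hi] := @cellI_ex R b1 h n z.1 hp (ltac:(rewrite nh /b1; move: z1 => /andP[? ?]; apply/andP; split; lra)).
  have [j hj] := @cellI_ex R b2 h n z.2 hp (ltac:(rewrite nh /b2; move: z2 => /andP[? ?]; apply/andP; split; lra)).
  by exists (i, j).
have nu0 y : 0 <= nu y by rewrite /nu mean_indic// fine_ge0.
have sumE (P : pred ('I_n * 'I_n)) (g : 'I_n * 'I_n -> R) :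
    \sum_(y | P y) nu y * g y = mean mu (fun z => \sum_(y | P y) g y * \1_(cell y) z).
  rewrite mean_sum//; last by move=> y; apply: niceM => //; exact: nice_cst.
  by apply: eq_bigr => y _; rewrite meanZ// mulrC.
have nsum (P : pred ('I_n * 'I_n)) (g : 'I_n * 'I_n -> R) :
    nice (fun z : plane R => \sum_(y | P y) g y * \1_(cell y) z).
  by apply: nice_sum => y; apply: niceM => //; exact: nice_cst.
have sum1 (P : pred ('I_n * 'I_n)) : \sum_(y | P y) nu y = \sum_(y | P y) nu y * 1.
  by apply: eq_bigr => y _; rewrite mulr1.
exists ('I_n * 'I_n)%type, x, v, nu; split.
- split => //; rewrite sum1 sumE; apply: (le_trans _ fine_mass_le).
  rewrite -[leRHS]mul1r -mean_cst; apply: mean_le => //; first exact: nice_cst.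
  move=> z; have [[y cz]|nz] := pselect (exists y, cell y z); first by rewrite (sumin _ _ _ _ cz).
  by rewrite sumout.
- move=> y y'; rewrite /x -/r1 -nh addrAC opprD addrA subrr sub0r addrC -mulrBl normrM (gtr0_norm hp).
  rewrite ler_pM2r// ler_norml.
  have h1 : y.1%:R <= n%:R :> R by rewrite ler_nat ltnW.
  have h2 : y'.1%:R <= n%:R :> R by rewrite ler_nat ltnW.
  have := ler0n R y.1; have := ler0n R y'.1; move: h1 h2=> *.
  by apply/andP; split; lra.
- move=> a1 a2 r hr; have rp : 0 < r by exact: lt_le_trans hr.
  have r40 : 0 < 4 * r by rewrite mulr_gt0.
  have mb := measurable_eball ((a1, a2) : plane R) (4 * r).
  apply: (@le_trans _ _ (fine (mu (eball (a1, a2) (4 * r))))); last first.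
    rewrite -lee_fin fineK; first exact: frost.
    by rewrite ge0_fin_numE//; apply: le_lt_trans (frost _ r40) (ltry _).
  rewrite sum1 sumE -mean_indic//; apply: mean_le => //; first exact: nice_indic.
  move=> z; have [[y cz]|nz] := pselect (exists y, cell y z); last first.
    by rewrite sumout// indicE.
  rewrite (sumin _ _ _ _ cz); case: ifPn => [/andP[s1 s2]|_]; last by rewrite indicE.
  rewrite indicE mem_set//.
  have [/cellI_dist h1 /cellI_dist h2] := cz.
  rewrite -/(x y) in h1; rewrite -/(v y) in h2.
  apply: le_lt_trans (edist_le _ _) _; rewrite /=.
  have g1 : `|a1 - z.1| <= r + h.
    move: h1 s1; rewrite !ler_norml => /andP[? ?] /andP[? ?]; apply/andP; split; lra.
  have g2 : `|a2 - z.2| <= r + h.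
    move: h2 s2; rewrite !ler_norml => /andP[? ?] /andP[? ?]; apply/andP; split; lra.
  by move: g1 g2 hh hr rp; lra.
move=> f L mf f1 L0 hL.
have nf : nice f by split => //; exists 1.
have mQ := measurableC (measurable_box c).
rewrite sumE -meanB//.
have nd : nice (fun z : plane R => f z - \sum_(y : 'I_n * 'I_n) f (x y, v y) * \1_(cell y) z).
  have -> : (fun z : plane R => f z - \sum_(y : 'I_n * 'I_n) f (x y, v y) * \1_(cell y) z) =
     (fun z => f z + (-1) * \sum_(y : 'I_n * 'I_n) f (x y, v y) * \1_(cell y) z).
    by apply/funext => z; rewrite mulN1r.
  by apply: niceD => //; apply: niceM => //; exact: nice_cst.
apply: (le_trans (mean_norm muT nd)).
(* Points in no cell lie outside [box]; the indicator pays for them and has integral zero. *)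
apply: (@le_trans _ _ (mean mu (fun z => L * h0 + \1_(~` box c) z))).
  apply: mean_le => //; first exact: nice_norm.
    by apply: niceD; [exact: nice_cst|exact: nice_indic].
  move=> z; have [[y cz]|nz] := pselect (exists y, cell y z).
    rewrite (sumin _ _ _ _ cz)/=.
    have [/cellI_dist h1 /cellI_dist h2] := cz.
    apply: (@le_trans _ _ (L * h0)); last by rewrite lerDl indicE.
    apply: (le_trans (hL _ _)); rewrite ler_wpM2l//=.
    by move: h1 h2 hh; rewrite -/(x y) -/(v y); lra.
  rewrite sumout// subr0; apply: (le_trans (f1 z)).
  rewrite indicE mem_set; last by move=> /inbox.
  by rewrite lerDr mulr_ge0// ltW.
rewrite meanD//; last 2 first.
- exact: nice_cst.
- exact: nice_indic.
rewrite mean_cst mean_indic// hc addr0; apply: ler_wpM2l; last exact: fine_mass_le.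
by apply: mulr_ge0 => //; exact: ltW.
Qed.

End Discretization.

(** * Dyadic blocks and their summation *)

Section TrigLipschitz.
Variable R : realType.

Lemma lipschitz1 (f g : R -> R) : (forall x, is_derive x (1:R) f (g x)) ->
  (forall x, `|g x| <= 1) -> forall a b, `|f a - f b| <= `|a - b|.
Proof.
move=> df g1.
have key a b : a < b -> `|f b - f a| <= `|b - a|.
  move=> ab; have cf : {within `[a, b], continuous f}.
    by apply: contI_within => x _; exact: is_derive_cont (df x).
  have [x _ ->] := MVT ab (fun x _ => df x) cf.
  by rewrite normrM ler_piMl.
move=> a b; have [ab|ba|->] := ltgtP a b; last by rewrite !subrr.
  by rewrite distrC [leRHS]distrC; exact: key.
exact: key.
Qed.

Lemma cos_lipschitz (a b : R) : `|cos a - cos b| <= `|a - b|.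
Proof.
apply: (@lipschitz1 _ (fun x => - sin x)) => x.
by rewrite normrN ler_norml sin_geN1 sin_le1.
Qed.

Lemma sin_lipschitz (a b : R) : `|sin a - sin b| <= `|a - b|.
Proof.
by apply: (@lipschitz1 _ (@cos R)) => x; rewrite ler_norml cos_geN1 cos_le1.
Qed.

End TrigLipschitz.

Section Power.
Variables (R : realType) (p : R).
Implicit Types (mu : {measure set (plane R) -> \bar R}) (t : R) (z : plane R).

Definition curve_phase t z : R := 2 * pi * (t * z.1 + t `^ p * z.2).

Definition power mu t : R :=
  mean mu (fun z => cos (curve_phase t z)) ^+ 2 + mean mu (fun z => sin (curve_phase t z)) ^+ 2.

Lemma measurable_curve_phase t : measurable_fun setT (curve_phase t).
Proof.
apply: measurable_funM; first exact: measurable_cst.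
by apply: measurable_funD; apply: measurable_funM;
  [exact: measurable_cst|exact: measurable_fst|exact: measurable_cst|exact: measurable_snd].
Qed.

Lemma measurable_cos_phase t : measurable_fun setT (fun z => cos (curve_phase t z)).
Proof.
apply: (@measurableT_comp _ _ _ _ _ _ (@cos R)).
  by apply: continuous_measurable_fun; exact: continuous_cos.
exact: measurable_curve_phase.
Qed.

Lemma measurable_sin_phase t : measurable_fun setT (fun z => sin (curve_phase t z)).
Proof.
apply: (@measurableT_comp _ _ _ _ _ _ (@sin R)).
  by apply: continuous_measurable_fun; exact: continuous_sin.
exact: measurable_curve_phase.
Qed.

Lemma norm_cos_le1 (a : R) : `|cos a| <= 1.
Proof. by rewrite ler_norml cos_geN1 cos_le1. Qed.

Lemma norm_sin_le1 (a : R) : `|sin a| <= 1.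
Proof. by rewrite ler_norml sin_geN1 sin_le1. Qed.

Lemma power_ge0 mu t : 0 <= power mu t.
Proof. by rewrite addr_ge0// sqr_ge0. Qed.

Lemma normc_fourier mu t : (mu setT < +oo)%E ->
  ComplexField.Normc.normc (fourier mu (t, t `^ p)) ^+ 2 = power mu t.
Proof.
move=> muT; rewrite /fourier /cintegral /cexpi /ComplexField.Normc.normc.
rewrite sqr_sqrtr ?addr_ge0 ?sqr_ge0//= /power; congr (_ ^+ 2 + _).
  by congr fine; apply: eq_integral => z _; rewrite cosN.
rewrite -[RHS]sqrrN -mulN1r -meanZ//; last first.
  split; first exact: measurable_sin_phase.
  by exists 1 => z; exact: norm_sin_le1.
congr (_ ^+ 2); congr fine; apply: eq_integral => z _.
by rewrite /= mulN1r -sinN.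
Qed.

Lemma curve_phase_lipschitz t T z z' : 0 <= t -> t <= T -> 1 <= p ->
  `|curve_phase t z - curve_phase t z'| <=
  2 * pi * (T + T `^ p) * (`|z.1 - z'.1| + `|z.2 - z'.2|).
Proof.
move=> t0 tT p1; have pi0 : 0 <= 2 * pi :> R by rewrite mulr_ge0// pi_ge0.
have -> : curve_phase t z - curve_phase t z' =
  2 * pi * (t * (z.1 - z'.1) + t `^ p * (z.2 - z'.2)) by rewrite /curve_phase; ring.
rewrite normrM (ger0_norm pi0) -mulrA ler_wpM2l//.
have tp : t `^ p <= T `^ p by apply: ge0_ler_powR; rewrite ?nnegrE; lra.
have T0 : 0 <= T `^ p by exact: powR_ge0.
have tp0 : 0 <= t `^ p by exact: powR_ge0.
apply: (le_trans (ler_normD _ _)); rewrite !normrM (ger0_norm t0) (ger0_norm (powR_ge0 _ _)).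
rewrite mulrDr; apply: lerD; apply: ler_pM => //; lra.
Qed.

Lemma curve_phase_theta (N s : R) z : 0 < N -> 0 <= s ->
  curve_phase (N * s) z = theta p (2 * pi * N) z.1 (N `^ (p - 1) * z.2) s.
Proof.
move=> N0 s0; rewrite /curve_phase /theta powRM ?(ltW N0)//.
have -> : N `^ p = N * N `^ (p - 1).
  have [->|p0] := eqVneq p 0.
    by rewrite sub0r powRr0 powR_inv1 ?(ltW N0)// mulfV// gt_eqF.
  rewrite -{2}(powRr1 (ltW N0)) -powRD; first by congr (_ `^ _); ring.
  by rewrite (gt_eqF N0) implybT.
ring.
Qed.

End Power.

(** * The spread condition for the discretized measure *)

Section Rescaling.
Variables (R : realType) (Y : finType).
Implicit Types (x v nu : Y -> R).

(* A square of side [a] in the rescaled plane is a rectangle [a] by [a / lam],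
   covered by about [lam] small squares. *)
Lemma spread_rescale x v nu (M A alpha h0 lam : R) : 0 < M -> 0 < A -> 0 < alpha -> 1 <= lam ->
  h0 <= M^-1 / lam -> (forall y, 0 <= nu y) ->
  (forall a1 a2 r, h0 <= r ->
     \sum_(y | (a1 <= x y <= a1 + r) && (a2 <= v y <= a2 + r)) nu y <= A * (4 * r) `^ alpha) ->
  spread M alpha x (fun y => lam * v y) (fun y => nu y / (2 * A * 4 `^ alpha * (lam / lam `^ alpha))).
Proof.
move=> M0 A0 al0 lam1 hh nu0 hs x0 w0 a Ma.
have lam0 : 0 < lam by lra.
have a0 : 0 < a by apply: lt_le_trans Ma; rewrite invr_gt0.
have la0 : 0 < lam `^ alpha by rewrite powR_gt0.
have c0 : 0 < 2 * A * 4 `^ alpha * (lam / lam `^ alpha).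
  by rewrite mulr_gt0 ?divr_gt0// mulr_gt0 ?powR_gt0// mulr_gt0.
rewrite -mulr_suml ler_pdivrMr//.
pose b := a / lam.
have b0 : 0 < b by rewrite divr_gt0.
have hb : h0 <= b by apply: (le_trans hh); rewrite ler_pM2r ?invr_gt0.
pose n := (Num.truncn lam).+1.
pose Q (i : 'I_n) y := (x0 + i%:R * b <= x y <= x0 + i%:R * b + b) && (w0 / lam <= v y <= w0 / lam + b).
apply: (@le_trans _ _ (\sum_(i < n) \sum_(y | Q i y) nu y)).
  apply: sum_cover => // y /andP[/andP[x1 x2] /andP[w1 w2]].
  have t0 : 0 <= (x y - x0) / b by rewrite divr_ge0 ?(ltW b0)// subr_ge0.
  have tl : (x y - x0) / b <= lam.
    by rewrite ler_pdivrMr// /b mulrC divfK ?gt_eqF//; lra.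
  have ln : (Num.truncn ((x y - x0) / b) < n)%N by rewrite ltnS le_truncn.
  exists (Ordinal ln); rewrite /Q/=.
  have /andP[] := truncn_itv t0; set i := Num.truncn _; rewrite ler_pdivlMr// ltr_pdivrMr//.
  rewrite -natr1 mulrDl mul1r => i1 i2.
  apply/andP; split; first by apply/andP; split; lra.
  have -> : w0 / lam + b = (w0 + a) / lam by rewrite /b; ring.
  by rewrite ler_pdivrMr// ler_pdivlMr// ![_ * lam]mulrC w1 w2.
apply: (@le_trans _ _ (\sum_(i < n) A * (4 * b) `^ alpha)).
  by apply: ler_sum => i _; exact: hs.
rewrite sumr_const card_ord -[leLHS]mulr_natl.
have hn : n%:R <= 2 * lam.
  have := truncn_le lam; rewrite (ltW lam0) => h.
  by rewrite /n -natr1; move: h lam1; clear; lra.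
have -> : (4 * b) `^ alpha = 4 `^ alpha * (a `^ alpha / lam `^ alpha).
  rewrite powRM ?(ltW b0)// /b powRM ?invr_ge0 ?(ltW a0) ?(ltW lam0)//.
  have -> : lam^-1 `^ alpha = (lam `^ alpha)^-1.
    by rewrite -(powR_inv1 (ltW lam0)) -powRrM mulN1r powRN.
  by [].
have -> : a `^ alpha * (2 * A * 4 `^ alpha * (lam / lam `^ alpha)) =
  (2 * lam) * (A * (4 `^ alpha * (a `^ alpha / lam `^ alpha))) by ring.
by rewrite ler_wpM2r// !mulr_ge0 ?powR_ge0 ?invr_ge0 ?(ltW A0) ?(ltW la0).
Qed.

(** Lowers the exponent from [alpha] to [a]: [r^alpha <= r^a] for [r <= 1], and for [r > 1] the
    total mass is at most [m r^a]. This permits an exponent below 1/2 whatever [alpha] is. *)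
Lemma spread_flat x v nu (M A alpha a h0 m : R) : 0 < M -> 0 < A -> 0 <= a -> a <= alpha ->
  h0 <= M^-1 -> (forall y, 0 <= nu y) -> \sum_y nu y <= m -> 0 <= m ->
  (forall a1 a2 r, h0 <= r ->
     \sum_(y | (a1 <= x y <= a1 + r) && (a2 <= v y <= a2 + r)) nu y <= A * (4 * r) `^ alpha) ->
  spread M a x v (fun y => nu y / (A * 4 `^ alpha + m)).
Proof.
move=> M0 A0 a0 aal hh nu0 hm m0 hs x0 w0 r Mr.
have r0 : 0 < r by apply: lt_le_trans Mr; rewrite invr_gt0.
have A4 : 0 < A * 4 `^ alpha by rewrite mulr_gt0 ?powR_gt0.
have c0 : 0 < A * 4 `^ alpha + m by rewrite ltr_wpDr.
have ra0 : 0 <= r `^ a by exact: powR_ge0.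
rewrite -mulr_suml ler_pdivrMr// mulrDr.
have [r1|r1] := leP r 1.
  apply: le_trans (hs _ _ _ (le_trans hh Mr)) _; rewrite powRM ?(ltW r0)//.
  apply: (@le_trans _ _ (r `^ a * (A * 4 `^ alpha))); last by rewrite lerDl mulr_ge0.
  rewrite mulrA mulrC ler_wpM2r ?(ltW A4)//.
  by apply: ger_powR => //; rewrite r0 r1.
apply: (@le_trans _ _ (r `^ a * m)); last by rewrite lerDr mulr_ge0// ltW.
apply: (@le_trans _ _ m).
  by apply: le_trans hm; rewrite big_mkcond; apply: ler_sum => y _; case: ifP.
rewrite ler_peMl// -[leLHS](powRr0 r); apply: ler_powR => //; exact: ltW.
Qed.

Lemma square_sum_scale x v nu (p M c s : R) :
  c != 0 -> square_sum p x v nu M s = c ^+ 2 * square_sum p x v (fun y => nu y / c) M s.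
Proof.
move=> c0; rewrite /square_sum mulrDr -!exprMn !mulr_sumr.
by congr (_ ^+ 2 + _ ^+ 2); apply: eq_bigr => y _; field.
Qed.

End Rescaling.

Lemma continuous_dominated (R : realType) (g u : R -> R) (t : R) : 0 < t ->
  {for t, continuous u} -> u t = 0 -> (forall t', 0 < t' -> `|g t - g t'| <= u t') ->
  {for t, continuous g}.
Proof.
move=> t0 cu ut h; apply/cvgrPdist_le => e e0.
move/cvgrPdist_le : cu => /(_ e e0); rewrite ut => H.
near=> s; have s0 : 0 < s by near: s; exact: lt_nbhsr.
apply: (le_trans (h s s0)).
have : `|0 - u s| <= e by near: s; exact: H.
by rewrite sub0r normrN; apply: le_trans; exact: ler_norm.
Unshelve. all: by end_near. Qed.

(** * Decay of the transform on one block *)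

Section Blocks.
Variables (R : realType) (p alpha A d : R).
Hypothesis p1 : 1 < p.
Hypothesis A0 : 0 < A.
Hypothesis d0 : 0 <= d.

Definition frostman (mu : {measure set (plane R) -> \bar R}) :=
  [/\ compact (msupport mu), ediam (msupport mu) = d &
  forall (y : plane R) (r : R), 0 < r -> (mu (eball y r) <= (A * r `^ alpha)%:E)%E].

Lemma power_continuous mu t : frostman mu -> 0 < t -> {for t, continuous (power p mu)}.
Proof.
move=> [cS dS frost] t0.
have [c hc] := ex_box cS dS; have muT := mass_fin d0 cS dS frost.
pose B := `|c.1| + `|c.2| + (d + 1).
pose m := fine (mu setT).
pose u t' := 2 * pi * B * m * (`|t - t'| + `|t `^ p - t' `^ p|).
have pi0 : 0 <= 2 * pi :> R by rewrite mulr_ge0// pi_ge0.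
have B0 : 0 <= B by rewrite addr_ge0// ?addr_ge0//.
have cu : {for t, continuous u}.
  apply: cvgM; first exact: cvg_cst.
  apply: cvgD; apply: cvg_norm; apply: cvgB; try exact: cvg_cst; first exact: cvg_id.
  exact: is_derive_cont (is_derive1_powR p t0).
have ut : u t = 0 by rewrite /u !subrr normr0 addr0 mulr0.
have key (f : R -> R) : (forall a b, `|f a - f b| <= `|a - b|) -> (forall a, `|f a| <= 1) ->
    (forall t, measurable_fun setT (fun z => f (curve_phase p t z))) ->
    {for t, continuous (fun t => mean mu (fun z => f (curve_phase p t z)))}.
  move=> lf f1 mf.
  have nf t' : nice (fun z => f (curve_phase p t' z)) by split=> //; exists 1.
  apply: (continuous_dominated t0 cu ut) => t' t'0.
  pose L := 2 * pi * B * (`|t - t'| + `|t `^ p - t' `^ p|).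
  have L0 : 0 <= L by rewrite mulr_ge0 ?addr_ge0// mulr_ge0.
  have mQ := measurableC (measurable_box d c).
  have nd : nice (fun z => f (curve_phase p t z) - f (curve_phase p t' z)).
    have -> : (fun z => f (curve_phase p t z) - f (curve_phase p t' z)) =
      (fun z => f (curve_phase p t z) + (-1) * f (curve_phase p t' z)).
      by apply/funext => z; rewrite mulN1r.
    by apply: niceD => //; apply: niceM => //; exact: nice_cst.
  have n2 : nice (fun z : plane R => 2 * \1_(~` box d c) z).
    by apply: niceM; [exact: nice_cst|exact: nice_indic].
  rewrite -meanB//; apply: (le_trans (mean_norm muT nd)).
  apply: (@le_trans _ _ (mean mu (fun z => L + 2 * \1_(~` box d c) z))); last first.
    rewrite meanD//; last exact: nice_cst.
    rewrite mean_cst// meanZ//; last exact: nice_indic.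
    by rewrite mean_indic// hc mulr0 addr0; apply: le_of_eq; rewrite /L /u -/m; ring.
  apply: mean_le => //; first exact: nice_norm.
    by apply: niceD => //; exact: nice_cst.
  move=> z; have [Qz|nQz] := pselect (box d c z); last first.
    rewrite indicE mem_set// mulr1; apply: (le_trans (ler_normB _ _)).
    by apply: (le_trans (lerD (f1 _) (f1 _))); lra.
  apply: (@le_trans _ _ L); last by rewrite lerDl mulr_ge0.
  apply: (le_trans (lf _ _)).
  have -> : curve_phase p t z - curve_phase p t' z =
     2 * pi * ((t - t') * z.1 + (t `^ p - t' `^ p) * z.2) by rewrite /curve_phase; ring.
  rewrite normrM (ger0_norm pi0) /L -[leRHS]mulrA ler_wpM2l//.
  have [z1 z2] : `|z.1| <= B /\ `|z.2| <= B.
    move: Qz => [/=]; rewrite !in_itv/= => /andP[a1 a2] /andP[b1 b2].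
    have := ler_normD c.1 (z.1 - c.1); rewrite addrC subrK => e1.
    have := ler_normD c.2 (z.2 - c.2); rewrite addrC subrK => e2.
    have q1 : `|z.1 - c.1| <= d + 1 by rewrite ler_distl a1 (ltW a2).
    have q2 : `|z.2 - c.2| <= d + 1 by rewrite ler_distl b1 (ltW b2).
    have := normr_ge0 c.1; have := normr_ge0 c.2; rewrite /B; split; lra.
  apply: (le_trans (ler_normD _ _)); rewrite !normrM mulrDr ![B * _]mulrC.
  by apply: lerD; exact: ler_wpM2l.
apply: cvgD; under eq_fun do rewrite expr2; rewrite expr2; apply: cvgM; apply: key.
- exact: cos_lipschitz.
- exact: norm_cos_le1.
- exact: measurable_cos_phase.
- exact: cos_lipschitz.
- exact: norm_cos_le1.
- exact: measurable_cos_phase.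
- exact: sin_lipschitz.
- exact: norm_sin_le1.
- exact: measurable_sin_phase.
- exact: sin_lipschitz.
- exact: norm_sin_le1.
- exact: measurable_sin_phase.
Qed.

(** The estimates for point sets are uniform in the number of points, so the mesh may be as fine as
    the Lipschitz constant, of size [N + N^p], demands. With [e <= 1] and [e <= eta / 4], the
    inequality [a^2 <= 2 b^2 + 2 (a - b)^2] leaves an error [eta / 2] for each of cosine and
    sine. *)
Lemma power_discretize mu (N eta hmax : R) : frostman mu -> 1 <= N -> 0 < eta -> 0 < hmax ->
  exists (Y : finType) (x v nu : Y -> R),
  [/\ (forall y, 0 <= nu y) /\ \sum_y nu y <= mass_bound A alpha d,
      forall y y', `|x y - x y'| <= 2 * (d + 1),
      forall a1 a2 r, hmax <= r ->
        \sum_(y | (a1 <= x y <= a1 + r) && (a2 <= v y <= a2 + r)) nu y <= A * (4 * r) `^ alpha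
    & forall s, 2 <= s <= 4 -> power p mu (N * s) <=
        2 * square_sum p x (fun y => N `^ (p - 1) * v y) nu (2 * pi * N) s + eta].
Proof.
move=> [cS dS frost] N1 eta0 hmax0; have N0 : 0 < N by lra.
pose L := 2 * pi * (4 * N + (4 * N) `^ p).
have L0 : 0 <= L.
  by rewrite mulr_ge0 ?mulr_ge0 ?pi_ge0// addr_ge0 ?powR_ge0// mulr_ge0// ltW.
have m0 := mass_bound_gt0 alpha A0 d0; set m := mass_bound A alpha d in m0 *.
have Lm : 0 < L * m + 1 by rewrite ltr_wpDl// mulr_ge0// ltW.
pose e := Num.min 1 (eta / 4).
have e0 : 0 < e by rewrite lt_min ltr01 divr_gt0.
pose h0 := Num.min hmax (e / (L * m + 1)).
have h00 : 0 < h0 by rewrite lt_min hmax0 divr_gt0.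
have [Y [x [v [nu [hnu hx hsq herr]]]]] := discretize d0 cS dS frost h00.
exists Y, x, v, nu; split => //.
  by move=> a1 a2 r hr; apply: hsq; apply: le_trans hr; rewrite ge_min lexx.
move=> s /andP[s2 s4].
have Ns0 : 0 <= N * s by rewrite mulr_ge0; lra.
have NsT : N * s <= 4 * N by rewrite mulrC ler_wpM2r//; lra.
have hL : L * h0 * m <= e.
  apply: (@le_trans _ _ (L * m * (e / (L * m + 1)))).
    have h0e : h0 <= e / (L * m + 1) by rewrite /h0 ge_min lexx orbT.
    by rewrite mulrAC; apply: ler_wpM2l => //; apply: mulr_ge0 => //; exact: ltW.
  rewrite mulrA ler_pdivrMr// mulrC ler_wpM2l ?(ltW e0)//; lra.
have close (f : R -> R) : (forall a b, `|f a - f b| <= `|a - b|) -> (forall a, `|f a| <= 1) ->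
    (forall t, measurable_fun setT (fun z => f (curve_phase p t z))) ->
    mean mu (fun z => f (curve_phase p (N * s) z)) ^+ 2 <=
      2 * (\sum_y nu y * f (theta p (2 * pi * N) (x y) (N `^ (p - 1) * v y) s)) ^+ 2 + eta / 2.
  move=> lf f1 mf.
  have := herr (fun z => f (curve_phase p (N * s) z)) L (mf _) (fun z => f1 _) L0.
  have -> : \sum_y nu y * f (curve_phase p (N * s) (x y, v y)) =
     \sum_y nu y * f (theta p (2 * pi * N) (x y) (N `^ (p - 1) * v y) s).
    by apply: eq_bigr => y _; rewrite curve_phase_theta//; lra.
  set a := mean _ _; set b := \sum_y _ => H.
  have hab : `|a - b| <= e.
    apply: le_trans hL; apply: H => z z'; apply: (le_trans (lf _ _)).
    by apply: curve_phase_lipschitz => //; exact: ltW.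
  have ab2 : (a - b) ^+ 2 <= e * 1.
    rewrite -real_normK ?num_real// expr2; apply: ler_pM => //.
    by apply: (le_trans hab); rewrite ge_min lexx.
  have ee : e <= eta / 4 by rewrite ge_min lexx orbT.
  have := sqr_ge0 (a - 2 * b); nra.
have c1 := close _ (@cos_lipschitz R) (@norm_cos_le1 R) (measurable_cos_phase p).
have c2 := close _ (@sin_lipschitz R) (@norm_sin_le1 R) (measurable_sin_phase p).
rewrite /power /square_sum mulrDr.
apply: (le_trans (lerD c1 c2)); apply: le_of_eq; rewrite /cosY /sinY.
by field.
Qed.

Lemma intg_power_le mu (N K eta : R) (Y : finType) (x w nu : Y -> R) M : frostman mu -> 1 <= N ->
  (forall s, 2 <= s <= 4 -> power p mu (N * s) <= 2 * square_sum p x w nu M s + eta) ->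
  intg 2 4 (square_sum p x w nu M) <= K ->
  intg 2 4 (fun s => power p mu (N * s)) <= 2 * K + 2 * eta.
Proof.
move=> hmu N1 hs hK; have N0 : 0 < N by lra.
have [l12 l24 l45] : [/\ 1 <= 2 :> R, 2 <= 4 :> R & 4 <= 5 :> R] by split; lra.
have cS : contI 2 4 (square_sum p x w nu M).
  by apply: (contI_sub l12 l45); exact: contI_square_sum.
have c2S : contI 2 4 (fun s => 2 * square_sum p x w nu M s).
  by apply: contIM => //; exact: contI_cst.
apply: (@le_trans _ _ (intg 2 4 (fun s => 2 * square_sum p x w nu M s + eta))).
  apply: le_intg => //.
    move=> s /andP[s2 s4]; have Ns : 0 < N * s by rewrite mulr_gt0//; lra.
    apply: (@continuous_comp _ _ _ (fun s => N * s) (power p mu)); last exact: power_continuous.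
    by apply: cvgM; [exact: cvg_cst|exact: cvg_id].
  by apply: contID => //; exact: contI_cst.
rewrite intgD//; last exact: contI_cst.
rewrite intgZ// intg_cst//; move: hK; lra.
Qed.

(** Normalizing by [A'], of size [lam^(1-alpha)], costs [A'^2] in the form and gains [1 / A'] in the
    mass, so [lam^(1-alpha)] multiplies [N^(eps - alpha/2)]. The discretization error is chosen
    equal to the resulting power of [N]. *)
Lemma block_wolff eps : 1 < alpha < 2 -> 0 < eps -> exists2 C : R, 0 < C &
  forall mu, frostman mu -> forall N, 1 <= N ->
  intg 2 4 (fun s => power p mu (N * s)) <=
    C * N `^ (- (alpha / 2 - eps + (p - 1) * (alpha - 1))).
Proof.
move=> hal eps0; have /andP[al1 al2] := hal.
have hal' : 0 < alpha < 2 by apply/andP; split; lra.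
have al0 : 0 < alpha by lra.
have [C C0 hC] := wolff_estimate (2 * (d + 1)) p1 hal' eps0.
have m0 := mass_bound_gt0 alpha A0 d0; set m := mass_bound A alpha d in m0 *.
pose q := eps - alpha / 2.
pose C1 := 2 * A * 4 `^ alpha * C * (2 * pi) `^ q * m.
have pi0 : 0 < 2 * pi :> R by rewrite mulr_gt0// pi_gt0.
have C10 : 0 < C1 by rewrite mulr_gt0// mulr_gt0 ?powR_gt0// mulr_gt0// mulr_gt0 ?powR_gt0// mulr_gt0.
exists (2 * C1 + 2); first by rewrite addr_gt0// mulr_gt0.
move=> mu hmu N N1; have N0 : 0 < N by lra.
set be := alpha / 2 - eps + (p - 1) * (alpha - 1).
pose lam := N `^ (p - 1).
have lam1 : 1 <= lam by rewrite -[leLHS](powRr0 N); apply: ler_powR => //; have := p1; lra.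
have lam0 : 0 < lam by lra.
pose M := 2 * pi * N.
have M1 : 1 <= M.
  have : 2 <= pi :> R by exact: pi_ge2.
  by rewrite /M => hpi; rewrite -[leLHS]mulr1; apply: ler_pM => //; lra.
have M0 : 0 < M by lra.
have eta0 : 0 < N `^ (- be) by rewrite powR_gt0.
have h00 : 0 < M^-1 / lam by rewrite divr_gt0// invr_gt0.
have [Y [x [v [nu [[nu0 hm] hx hsq herr]]]]] := power_discretize hmu N1 eta0 h00.
pose A' := 2 * A * 4 `^ alpha * (lam / lam `^ alpha).
have A'0 : 0 < A' by rewrite mulr_gt0 ?divr_gt0 ?powR_gt0// mulr_gt0 ?powR_gt0// mulr_gt0.
have sp := spread_rescale M0 A0 al0 lam1 (lexx _) nu0 hsq.
rewrite -/A' in sp.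
have nu'0 y : 0 <= nu y / A' by rewrite divr_ge0// ltW.
have W := hC Y x (fun y => lam * v y) (fun y => nu y / A') M M1 nu'0 sp hx.
have K : intg 2 4 (square_sum p x (fun y => lam * v y) nu M) <= C1 * N `^ (- be).
  have -> : intg 2 4 (square_sum p x (fun y => lam * v y) nu M) =
     A' ^+ 2 * intg 2 4 (square_sum p x (fun y => lam * v y) (fun y => nu y / A') M).
    rewrite -intgZ.
      by apply: eq_intg => s _; apply: square_sum_scale; rewrite gt_eqF.
    by apply: (@contI_sub _ 1 5); [lra|lra|exact: contI_square_sum].
  apply: (@le_trans _ _ (A' ^+ 2 * (C * M `^ q * (m / A')))).
    rewrite ler_wpM2l ?sqr_ge0// (le_trans W)// -mulr_suml ler_wpM2l//.
      by rewrite mulr_ge0 ?powR_ge0// ltW.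
    by rewrite ler_wpM2r ?invr_ge0 ?(ltW A'0).
  apply: le_of_eq.
  have -> : A' ^+ 2 * (C * M `^ q * (m / A')) = A' * C * M `^ q * m by field; rewrite gt_eqF.
  rewrite /M powRM ?(ltW pi0) ?(ltW N0)// /A' /C1.
  have -> : N `^ (- be) = lam / lam `^ alpha * N `^ q.
    rewrite /lam -powRrM -powRN -!powRD; last 2 first.
    - by rewrite (gt_eqF N0) implybT.
    - by rewrite (gt_eqF N0) implybT.
    by congr (_ `^ _); rewrite /be /q; field.
  ring.
apply: le_trans (intg_power_le hmu N1 herr K) _.
by apply: le_of_eq; ring.
Qed.

(** Stretching by [lam >= 1] only increases distances, so the spread condition is used in the
    original coordinates and no power of [lam] appears. *)
Lemma block_energy a : 0 < a < 1 / 2 -> a <= alpha -> exists2 C : R, 0 < C &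
  forall mu, frostman mu -> forall N, 1 <= N ->
  intg 2 4 (fun s => power p mu (N * s)) <= C * N `^ (- a).
Proof.
move=> ha aal; have /andP[a0 a2] := ha.
have [C C0 hC] := energy_estimate p1 ha.
have m0 := mass_bound_gt0 alpha A0 d0; set m := mass_bound A alpha d in m0 *.
pose A' := A * 4 `^ alpha + m.
have A'0 : 0 < A' by rewrite addr_gt0// mulr_gt0 ?powR_gt0.
pose C1 := A' * C * m.
have C10 : 0 < C1 by rewrite mulr_gt0// mulr_gt0.
exists (2 * C1 + 2); first by rewrite addr_gt0// mulr_gt0.
move=> mu hmu N N1; have N0 : 0 < N by lra.
pose lam := N `^ (p - 1).
have lam1 : 1 <= lam by rewrite -[leLHS](powRr0 N); apply: ler_powR => //; have := p1; lra.
have lam0 : 0 < lam by lra.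
pose M := 2 * pi * N.
have NM : N <= M.
  have : 2 <= pi :> R by exact: pi_ge2.
  by rewrite /M => hpi; rewrite -[leLHS]mul1r ler_wpM2r ?(ltW N0)//; lra.
have M1 : 1 <= M by lra.
have M0 : 0 < M by lra.
have eta0 : 0 < N `^ (- a) by rewrite powR_gt0.
have h00 : 0 < M^-1 by rewrite invr_gt0.
have [Y [x [v [nu [[nu0 hm] hx hsq herr]]]]] := power_discretize hmu N1 eta0 h00.
have sp := spread_flat M0 A0 (ltW a0) aal (lexx _) nu0 hm (ltW m0) hsq.
rewrite -/m -/A' in sp.
have nu'0 y : 0 <= nu y / A' by rewrite divr_ge0// ltW.
have vw y y' : `|v y - v y'| <= `|lam * v y - lam * v y'|.
  by rewrite -mulrBr normrM (gtr0_norm lam0) ler_peMl.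
have W := hC Y x v (fun y => lam * v y) (fun y => nu y / A') M M1 nu'0 sp vw.
have K : intg 2 4 (square_sum p x (fun y => lam * v y) nu M) <= C1 * N `^ (- a).
  have -> : intg 2 4 (square_sum p x (fun y => lam * v y) nu M) =
     A' ^+ 2 * intg 2 4 (square_sum p x (fun y => lam * v y) (fun y => nu y / A') M).
    rewrite -intgZ.
      by apply: eq_intg => s _; apply: square_sum_scale; rewrite gt_eqF.
    by apply: (@contI_sub _ 1 5); [lra|lra|exact: contI_square_sum].
  have MN : M `^ (- a) <= N `^ (- a).
    rewrite !powRN lef_pV2 ?posrE ?powR_gt0//.
    by apply: ge0_ler_powR; rewrite ?nnegrE ?(ltW a0) ?(ltW M0) ?(ltW N0).
  apply: (@le_trans _ _ (A' ^+ 2 * (C * N `^ (- a) * (m / A')))).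
    rewrite ler_wpM2l ?sqr_ge0// (le_trans W)// -mulr_suml.
    apply: ler_pM => //.
    - by rewrite mulr_ge0 ?powR_ge0// ltW.
    - by rewrite mulr_ge0 ?sumr_ge0// invr_ge0 ltW.
    - by rewrite ler_wpM2l// ltW.
    - by rewrite ler_wpM2r ?invr_ge0 ?(ltW A'0).
  by apply: le_of_eq; rewrite /C1; field; rewrite gt_eqF.
apply: le_trans (intg_power_le hmu N1 herr K) _.
by apply: le_of_eq; ring.
Qed.

Lemma block_estimate gamma :
  [\/ 1 < alpha < 2 /\ -1 < gamma < alpha * p - alpha / 2 - p,
      1 / 2 < alpha <= 1 /\ -1 < gamma < - (1 / 2)
    | 0 < alpha <= 1 / 2 /\ -1 < gamma < alpha - 1] ->
  exists beta C : R, [/\ gamma + 1 < beta, 0 < C &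
  forall mu, frostman mu -> forall N, 1 <= N ->
  intg 2 4 (fun s => power p mu (N * s)) <= C * N `^ (- beta)].
Proof.
case=> [[hal /andP[g1 g2]]|[/andP[al1 al2] /andP[g1 g2]]|[/andP[al1 al2] /andP[g1 g2]]].
(* Half of the room left by [gamma], so that the decay exponent is exactly [gamma + 1 + eps]. *)
- pose eps := (alpha * p - alpha / 2 - p - gamma) / 2.
  have eps0 : 0 < eps by rewrite divr_gt0//; lra.
  have [C C0 hC] := block_wolff hal eps0.
  exists (alpha / 2 - eps + (p - 1) * (alpha - 1)), C; split => //.
  by rewrite /eps; lra.
(* The midpoint of [gamma + 1] and 1/2; in the last case, of [gamma + 1] and [alpha]. *)
- pose a := (gamma + 1 + 1 / 2) / 2.
  have ha : 0 < a < 1 / 2 by rewrite /a; apply/andP; split; lra.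
  have aal : a <= alpha by rewrite /a; lra.
  have [C C0 hC] := block_energy ha aal.
  by exists a, C; split => //; rewrite /a; lra.
- pose a := (gamma + 1 + alpha) / 2.
  have ha : 0 < a < 1 / 2 by rewrite /a; apply/andP; split; lra.
  have aal : a <= alpha by rewrite /a; lra.
  have [C C0 hC] := block_energy ha aal.
  by exists a, C; split => //; rewrite /a; lra.
Qed.

End Blocks.

(** * Dyadic decomposition of the half-line *)

Section DyadicSummation.
Variable R : realType.
Implicit Types (f : R -> R) (D : (set R)^nat).

Lemma integral_bigcup_le D f (K q : R) : 0 <= K -> 0 <= q < 1 ->
  (forall k, measurable (D k)) -> trivIset setT D ->
  measurable_fun (\bigcup_k D k) f -> (forall t, (\bigcup_k D k) t -> 0 <= f t) ->
  (forall k, (\int[lebesgue_measure]_(t in D k) (f t)%:E <= (K * q ^+ k)%:E)%E) ->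
  (\int[lebesgue_measure]_(t in \bigcup_k D k) (f t)%:E <= (K * (1 - q)^-1)%:E)%E.
Proof.
move=> K0 q01 mD tD mf f0 hD.
rewrite ge0_integral_bigcup//; last exact/measurable_EFinP.
apply: lime_le.
  apply: is_cvg_nneseries => k _ _; apply: integral_ge0 => t Dt.
  by rewrite lee_fin f0//; exists k.
apply: nearW => n; apply: (@le_trans _ _ (\sum_(0 <= k < n) (K * q ^+ k)%:E)%E).
  by apply: lee_sum => k _; exact: hD.
rewrite sumEFin lee_fin big_mkord -mulr_sumr ler_wpM2l//.
exact: geometric_sum_le.
Qed.

(** The block estimate needs [N = 2^k >= 1] and so covers [t > 2]. Below 2 the transform is bounded
    by the mass, and the intervals shrink to 0 instead. Half-open intervals make both families
    disjoint. *)
Definition small_dyadic (k : nat) : set R := `]2 ^- k, 2 * 2 ^- k]%classic.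
Definition large_dyadic (k : nat) : set R := `]2 * 2 ^+ k, 4 * 2 ^+ k]%classic.

Let pow2_gt0 k : 0 < 2 ^+ k :> R. Proof. exact: exprn_gt0. Qed.

Let pow2_homo i j : (i <= j)%N -> 2 ^+ i <= 2 ^+ j :> R.
Proof. by move=> ij; rewrite ler_eXn2l// ltr1n. Qed.

Lemma bigcup_small_dyadic : \bigcup_k small_dyadic k = `]0, 2]%classic.
Proof.
apply/seteqP; split => t /=.
  move=> [k _]; rewrite /small_dyadic/= !in_itv/= => /andP[t1 t2].
  have k1 : 2 ^- k <= 1 :> R by rewrite invf_le1// exprn_ege1// ler1n.
  have k0 : 0 < 2 ^- k :> R by rewrite invr_gt0.
  by apply/andP; split; lra.
rewrite in_itv/= => /andP[t0 t2].
have hex : exists k, 2 ^- k < t.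
  exists (Num.bound t^-1); rewrite -[ltRHS]invrK ltf_pV2 ?posrE ?invr_gt0//.
  apply: lt_le_trans (archi_boundP _) _; first by rewrite invr_ge0 ltW.
  by rewrite -natrX ler_nat ltnW// ltn_expl.
pose k := ex_minn hex.
have [hk kmin] : 2 ^- k < t /\ forall i, 2 ^- i < t -> (k <= i)%N by rewrite /k; case: ex_minnP.
exists k => //; rewrite /small_dyadic/= in_itv/= hk/=.
case: (posnP k) => [->|k0]; first by rewrite expr0 invr1 mulr1.
rewrite -(prednK k0) exprS invfM mulrA mulfV ?mul1r ?pnatr_eq0//.
by rewrite leNgt; apply/negP => /kmin; rewrite -ltnS prednK// ltnn.
Qed.

Lemma bigcup_large_dyadic : \bigcup_k large_dyadic k = `]2, +oo[%classic.
Proof.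
apply/seteqP; split => t /=.
  move=> [k _]; rewrite /large_dyadic/= !in_itv/= andbT => /andP[t1 t2].
  have k1 : 1 <= 2 ^+ k :> R by rewrite exprn_ege1// ler1n.
  by lra.
rewrite in_itv/= andbT => t2.
have hex : exists k, t <= 4 * 2 ^+ k.
  exists (Num.bound t); apply: ltW; apply: lt_le_trans (archi_boundP _) _; first by lra.
  apply: (@le_trans _ _ (2 ^+ Num.bound t)); first by rewrite -natrX ler_nat ltnW// ltn_expl.
  by rewrite ler_peMl ?(ltW (pow2_gt0 _))// ler1n.
pose k := ex_minn hex.
have [hk kmin] : t <= 4 * 2 ^+ k /\ forall i, t <= 4 * 2 ^+ i -> (k <= i)%N by rewrite /k; case: ex_minnP.
exists k => //; rewrite /large_dyadic/= in_itv/= hk andbT.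
case: (posnP k) => [->|k0]; first by rewrite expr0 mulr1.
rewrite -(prednK k0) exprS mulrA -natrM.
by rewrite ltNge; apply/negP => /kmin; rewrite -ltnS prednK// ltnn.
Qed.

Lemma trivIset_ltn D : (forall i j t, (i < j)%N -> D i t -> D j t -> False) -> trivIset setT D.
Proof.
move=> h; apply/trivIsetP => i j _ _; rewrite neq_ltn => /orP[ij|ij];
  by apply/seteqP; split => t // [/= ti tj]; exact: (h _ _ t ij).
Qed.

Lemma trivIset_small_dyadic : trivIset setT small_dyadic.
Proof.
apply: trivIset_ltn => i j t ij; rewrite /small_dyadic/= !in_itv/= => /andP[t1 _] /andP[_ t2].
have : 2 * 2 ^- j <= 2 ^- i :> R.
  rewrite -[leRHS]mul1r ler_pdivrMr// mulrAC ler_pdivlMr// mul1r -exprS.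
  exact: pow2_homo.
lra.
Qed.

Lemma trivIset_large_dyadic : trivIset setT large_dyadic.
Proof.
apply: trivIset_ltn => i j t ij; rewrite /large_dyadic/= !in_itv/= => /andP[_ t1] /andP[t2 _].
have : 4 * 2 ^+ i <= 2 * 2 ^+ j :> R.
  have -> : 4 * 2 ^+ i = 2 * 2 ^+ i.+1 :> R by rewrite exprS mulrA -natrM.
  by rewrite ler_pM2l// pow2_homo.
lra.
Qed.

Lemma integral_intg (a b : R) f : contI a b f ->
  (\int[lebesgue_measure]_(t in `]a, b]) (f t)%:E = (intg a b f)%:E)%E.
Proof.
move=> cf; have hi := contI_integrable cf.
rewrite /intg /Rintegral fineK; last exact: integrable_fin_num.
apply: integral_itv_obnd_cbnd; have := measurable_int _ hi.
by apply: measurable_funS => //; apply: subset_itvr; rewrite bnd_simp.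
Qed.

Lemma intg_dilate (N a b : R) f : 0 < N -> a <= b -> contI (N * a) (N * b) f ->
  intg (N * a) (N * b) f = N * intg a b (fun s => f (N * s)).
Proof.
move=> N0 ab cf.
have dN s : is_derive s (1:R) (fun s => N * s) N.
  by apply: is_derive_eq; rewrite /GRing.scale/=; ring.
have dE : (fun s : R => N * s)^`()%classic = cst N.
  by apply/funext => s; rewrite derive1E; have d := dN s; exact: derive_val.
have cc s : {for s, continuous (fun s => N * s)} by exact: is_derive_cont (dN s).
have cfN : contI a b (fun s => f (N * s)).
  move=> s /andP[sa sb]; apply: (@continuous_comp _ _ _ (fun s => N * s) f); first exact: cc.
  by apply: cf; rewrite !ler_pM2l// sa sb.
rewrite -intgZ// /intg /Rintegral.
rewrite (@integration_by_substitution_increasing R (fun s => N * s) f a b)//.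
- by rewrite dE; congr fine; apply: eq_integral => s _ /=; rewrite mulrC.
- by move=> s t _ _ st; rewrite ltr_pM2l.
- by move=> s _; rewrite dE; exact: cvg_cst.
- by rewrite dE; exact: is_cvg_cst.
- by rewrite dE; exact: is_cvg_cst.
- split.
  + by move=> s _; have d := dN s; exact: ex_derive.
  + by apply: cvg_at_right_filter; exact: cc.
  + by apply: cvg_at_left_filter; exact: cc.
- exact: contI_within.
Qed.

End DyadicSummation.

(** * Convergence of the weighted integral *)

Section Assembly.
Variables (R : realType) (p alpha A d gamma : R).
Hypothesis A0 : 0 < A.
Hypothesis d0 : 0 <= d.

Lemma power_le (mu : {measure set (plane R) -> \bar R}) t : frostman alpha A d mu ->
  power p mu t <= 2 * mass_bound A alpha d ^+ 2.
Proof.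
move=> [cS dS frost]; have muT := mass_fin d0 cS dS frost.
have m0 := mass_bound_gt0 alpha A0 d0; have fm := fine_mass_le d0 cS dS frost.
have key (f : plane R -> R) : measurable_fun setT f -> (forall z, `|f z| <= 1) ->
    mean mu f ^+ 2 <= mass_bound A alpha d ^+ 2.
  move=> mf f1; have nf : nice f by split => //; exists 1.
  rewrite -[leLHS]real_normK ?num_real//; apply: lerXn2r; rewrite ?nnegrE ?(ltW m0)//.
  apply: (le_trans (mean_norm muT nf)); apply: le_trans fm.
  rewrite -[leRHS]mul1r -mean_cst; apply: mean_le => //; first exact: nice_norm.
  exact: nice_cst.
have h1 := key _ (measurable_cos_phase p t) (fun z => norm_cos_le1 _).
have h2 := key _ (measurable_sin_phase p t) (fun z => norm_sin_le1 _).
by rewrite /power; lra.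
Qed.

Definition weighted_power (mu : {measure set (plane R) -> \bar R}) t : R :=
  power p mu t * t `^ gamma.

Lemma weighted_power_continuous mu t : frostman alpha A d mu -> 0 < t ->
  {for t, continuous (weighted_power mu)}.
Proof.
move=> hmu t0; have h : {for t, continuous (power p mu)} := power_continuous d0 hmu t0.
have h' : {for t, continuous (fun t : R => t `^ gamma)}.
  exact: is_derive_cont (is_derive1_powR gamma t0).
by rewrite /weighted_power; apply: cvgM; [exact: h|exact: h'].
Qed.

Lemma contI_weighted_power mu a b : frostman alpha A d mu -> 0 < a -> contI a b (weighted_power mu).
Proof.
by move=> hmu a0 t /andP[ta _]; apply: weighted_power_continuous => //; exact: lt_le_trans ta.
Qed.

Lemma contI_power mu a b : frostman alpha A d mu -> 0 < a -> contI a b (power p mu).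
Proof.
by move=> hmu a0 t /andP[ta _]; apply: (power_continuous d0 hmu); exact: lt_le_trans ta.
Qed.

Lemma contI_power_dilate mu N a b : frostman alpha A d mu -> 0 < N -> 0 < a ->
  contI a b (fun s => power p mu (N * s)).
Proof.
move=> hmu N0 a0 s /andP[sa _].
apply: (@continuous_comp _ _ _ (fun s => N * s) (power p mu)).
  by apply: cvgM; [exact: cvg_cst|exact: cvg_id].
by apply: (power_continuous d0 hmu); rewrite mulr_gt0// (lt_le_trans a0).
Qed.

Lemma weight_le N t : 0 < N -> N <= t <= 5 * N -> t `^ gamma <= N `^ gamma * pw5 gamma.
Proof.
move=> N0 /andP[t1 t2]; have -> : t = N * (t / N) by field; rewrite gt_eqF.
have s1 : 1 <= t / N by rewrite ler_pdivlMr// mul1r.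
have s5 : t / N <= 5 by rewrite ler_pdivrMr.
rewrite powRM ?(ltW N0) ?ler_wpM2l ?powR_ge0//; last by rewrite (le_trans _ s1).
by have /andP[] := @powR_bounds R gamma (t / N) (introT andP (conj s1 s5)).
Qed.

(** In the exponent [gamma + 1], the 1 comes from [dt = N ds]. *)
Lemma intg_weighted_le mu N a b K : frostman alpha A d mu -> 0 < N -> 1 <= a -> a <= b -> b <= 5 ->
  intg a b (fun s => power p mu (N * s)) <= K ->
  intg (N * a) (N * b) (weighted_power mu) <= pw5 gamma * K * N `^ (gamma + 1).
Proof.
move=> hmu N0 a1 ab b5 hK; have Na : 0 < N * a by rewrite mulr_gt0//; lra.
have Nab : N * a <= N * b by rewrite ler_pM2l.
have W0 : 0 <= N `^ gamma * pw5 gamma by rewrite mulr_ge0 ?powR_ge0// ltW// pw5_gt0.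
apply: (@le_trans _ _ (intg (N * a) (N * b) (fun t => N `^ gamma * pw5 gamma * power p mu t))).
  apply: le_intg.
  - exact: contI_weighted_power.
  - by apply: contIM; [exact: contI_cst|exact: contI_power].
  move=> t /andP[ta tb]; rewrite /weighted_power mulrC ler_wpM2r ?power_ge0//.
  apply: weight_le => //; apply/andP; split.
    by apply: le_trans ta; rewrite ler_peMr// ltW.
  by apply: (le_trans tb); rewrite mulrC ler_wpM2r// ltW.
rewrite intgZ; last exact: contI_power.
rewrite intg_dilate//; last exact: contI_power.
have -> : N `^ (gamma + 1) = N `^ gamma * N.
  by rewrite powRD ?powRr1 ?(ltW N0)// (gt_eqF N0) implybT.
have -> : pw5 gamma * K * (N `^ gamma * N) = N `^ gamma * pw5 gamma * (N * K) by ring.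
by rewrite ler_wpM2l// ler_pM2l.
Qed.

Lemma pow2_powR (q : R) (k : nat) : (2 ^+ k) `^ q = (2 `^ q) ^+ k.
Proof. by rewrite -(powR_mulrn k (powR_ge0 2 q)) -(powR_mulrn k (ler0n R 2)) powRAC. Qed.

Lemma powR2_lt1 (q : R) : q < 0 -> 0 <= 2 `^ q < 1.
Proof.
move=> q0; rewrite powR_ge0/= /powR (_ : (2 == 0 :> R) = false) ?pnatr_eq0//.
by rewrite -[ltRHS]expR0 ltr_expR nmulr_rlt0 ?ln_gt0 ?ltr1n.
Qed.

Lemma weighted_power_integral_le beta C : -1 < gamma -> gamma + 1 < beta -> 0 < C ->
  exists C' : R, forall mu, frostman alpha A d mu ->
  (forall N, 1 <= N -> intg 2 4 (fun s => power p mu (N * s)) <= C * N `^ (- beta)) ->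
  (\int[lebesgue_measure]_(t in `]0%R, +oo[) (weighted_power mu t)%:E <= C'%:E)%E.
Proof.
move=> g1 gb C0; pose m := mass_bound A alpha d.
(* Ratios of the two geometric series: [q1 < 1], for small [t], is [gamma > -1]; [q2 < 1], for large
   [t], is [gamma + 1 < beta]. *)
pose K1 := pw5 gamma * (2 * m ^+ 2); pose q1 : R := 2 `^ (- (gamma + 1)).
pose K2 := pw5 gamma * C; pose q2 : R := 2 `^ (gamma + 1 - beta).
have hq1 : 0 <= q1 < 1 by apply: powR2_lt1; lra.
have hq2 : 0 <= q2 < 1 by apply: powR2_lt1; lra.
have pw0 := pw5_gt0 gamma.
have K10 : 0 <= K1 by rewrite mulr_ge0 ?(ltW pw0)// mulr_ge0 ?sqr_ge0.
have K20 : 0 <= K2 by rewrite mulr_ge0 ?(ltW pw0)// ltW.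
exists (K1 * (1 - q1)^-1 + K2 * (1 - q2)^-1) => mu hmu hblock.
have mf : measurable_fun (`]0%R, +oo[%classic : set R) (weighted_power mu).
  apply: open_continuous_measurable_fun; first exact: interval_open.
  move=> t; rewrite inE/= in_itv/= andbT => t0.
  exact: weighted_power_continuous.
have f0 t : 0 <= weighted_power mu t by rewrite mulr_ge0 ?power_ge0 ?powR_ge0.
have -> : `]0%R, +oo[%classic = `]0%R, 2%R] `|` `]2%R, +oo[ :> set R.
  by rewrite -itv_bndbnd_setU// bnd_simp.
have sub1 : (`]0%R, 2%R]%classic : set R) `<=` `]0%R, +oo[%classic.
  by apply: subset_itvl; rewrite bnd_simp.
have sub2 : (`]2%R, +oo[%classic : set R) `<=` `]0%R, +oo[%classic.
  by apply: subset_itvr; rewrite bnd_simp.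
rewrite ge0_integral_setU//=; last 3 first.
- apply/measurable_EFinP; apply: measurable_funS mf => //.
  by move=> t [/sub1|/sub2].
- by move=> t _; rewrite lee_fin.
- by apply/disj_setPS => t [/=]; rewrite !in_itv/= => /andP[_ t2] /andP[t3 _]; lra.
rewrite EFinD; apply: leeD.
  rewrite -bigcup_small_dyadic; apply: integral_bigcup_le => //.
  - by move=> k; exact: measurable_itv.
  - exact: trivIset_small_dyadic.
  - by rewrite bigcup_small_dyadic; apply: measurable_funS mf.
  move=> k; have N0 : 0 < 2 ^- k :> R by rewrite invr_gt0 exprn_gt0.
  rewrite /small_dyadic integral_intg; last exact: contI_weighted_power.
  rewrite lee_fin -[X in intg X]mulr1 (mulrC 2).
  have -> : K1 * q1 ^+ k = K1 * (2 ^- k) `^ (gamma + 1).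
    rewrite /q1 powRN exprVn -pow2_powR -powRN.
    by rewrite -(powR_inv1 (ltW (exprn_gt0 k (ltr0n R 2)))) -powRrM mulN1r.
  apply: intg_weighted_le => //; [lra|lra|].
  have cN : contI 1 2 (fun s => power p mu (2 ^- k * s)) by exact: contI_power_dilate.
  apply: (@le_trans _ _ (intg 1 2 (fun=> 2 * m ^+ 2))).
    by apply: le_intg => //; [exact: contI_cst|move=> s _; exact: power_le].
  by rewrite intg_cst; lra.
rewrite -bigcup_large_dyadic; apply: integral_bigcup_le => //.
- by move=> k; exact: measurable_itv.
- exact: trivIset_large_dyadic.
- by rewrite bigcup_large_dyadic; apply: measurable_funS mf.
move=> k; have N1 : 1 <= 2 ^+ k :> R by rewrite exprn_ege1// ler1n.
have N0 : 0 < 2 ^+ k :> R by rewrite exprn_gt0.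
rewrite /large_dyadic integral_intg; last first.
  by apply: contI_weighted_power => //; rewrite mulr_gt0.
rewrite lee_fin (mulrC 2) (mulrC 4).
have -> : K2 * q2 ^+ k = pw5 gamma * (C * (2 ^+ k) `^ (- beta)) * (2 ^+ k) `^ (gamma + 1).
  rewrite /q2 -pow2_powR powRD; last by rewrite (gt_eqF N0) implybT.
  by rewrite /K2; ring.
apply: intg_weighted_le => //; [lra|lra|lra|exact: hblock].
Qed.

End Assembly.

Theorem theorem1p2 (R : realType) (p alpha gamma : R) (hp : 1 < p)
    (hag : [\/ 1 < alpha < 2 /\ -1 < gamma < alpha * p - alpha / 2 - p,
               1 / 2 < alpha <= 1 /\ -1 < gamma < - (1 / 2)
             | 0 < alpha <= 1 / 2 /\ -1 < gamma < alpha - 1])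
    (A d : R) (hA : 0 < A) (hd : 0 <= d) :
  exists C : R, forall mu : {measure set (plane R) -> \bar R},
    compact (msupport mu) -> ediam (msupport mu) = d ->
    (forall (y : plane R) (r : R), 0 < r ->
       (mu (eball y r) <= (A * r `^ alpha)%:E)%E) ->
    (\int[lebesgue_measure]_(t in `]0%R, +oo[)
       ((ComplexField.Normc.normc (fourier mu (t, t `^ p)) ^+ 2
         * t `^ gamma)%R)%:E <= C%:E)%E.
Proof.
have g1 : -1 < gamma by case: hag => -[_ /andP[]].
have [beta [C [gb C0 hblock]]] := block_estimate hp hA hd hag.
have [C' hC'] := weighted_power_integral_le p alpha hA hd g1 gb C0.
exists C' => mu cS dS frost.
have hmu : frostman alpha A d mu by [].
have muT := mass_fin hd cS dS frost.
apply: le_trans (hC' mu hmu (hblock mu hmu)).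
rewrite le_eqVlt; apply/orP; left; apply/eqP; apply: eq_integral => t _.
by rewrite /weighted_power normc_fourier.
Qed.
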